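(* Let $K$ and $V$ be closed convex bodies in $\mathbb{R}^m$ that are centrally symmetric with respect to the origin. Let $f_0\in B_V\cap C(\mathbb{R}^m)$ be a real-valued extremal function in inequality (I) or in inequality (II), where $$\text{(I)}\quad \|\nabla f(x)\|_K\le M(K,V)\,\|f\|_{C(\mathbb{R}^m)},\qquad \text{(II)}\quad \|\nabla f(x)\|_K^2+M^2(K,V)f^2(x)\le M^2(K,V)\,\|f\|_{C(\mathbb{R}^m)}^2,$$ and extremal means that there exists a point of $\mathbb{R}^m$ at which equality holds in the respective inequality for $f=f_0$. Then there exists a function $g(x):=R_1\cos(\mathbf{a},x)+R_2\sin(\mathbf{a},x)$, where $\mathbf{a}\in\mathcal{A}(K,V)$, $R_1\in\mathbb{R}$, and $R_2\in\mathbb{R}$, and there exists a straight line $x=x_0+\tau y_0$ in $\mathbb{R}^m$, where $x_0\in\mathbb{R}^m$, $y_0\in\mathcal{B}(V^*,K^* )$, and $\tau\in\mathbb{R}$, such that for all $\tau\in\mathbb{R}$ the following equalities hold: $$f_0(x_0+\tau y_0)=g(x_0+\tau y_0),\qquad \nabla f_0(x_0+\tau y_0)=\nabla g(x_0+\tau y_0).$$ In addition, $f_0(x_0)=0$.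
   Context: $(t,y)=\sum_{j=1}^m t_jy_j$; $\nabla f(x)=(\partial f(x)/\partial x_1,\ldots,\partial f(x)/\partial x_m)$. A convex body is a compact convex set with non-empty interior; $\partial(V)$ is the boundary of $V$. For an origin-symmetric convex body $V$, its polar is $V^*=\{y\in\mathbb{R}^m: |(t,y)|\le 1 \text{ for all } t\in V\}$ (and $V^{**}=V$). Norms: $\|x\|_V:=\max_{t\in V^*}|(t,x)|$ on $\mathbb{R}^m$ (unit ball $V$), and $\|z\|_{V^*}:=\max_{t\in V}|\sum_{j=1}^m t_jz_j|$ for $z\in\mathbb{C}^m$; likewise for $K$. Define $M(K,V):=\max_{y\in V}\|y\|_K$ and $$\mathcal{A}(K,V):=\{\mathbf{a}\in\partial(V):\|\mathbf{a}\|_K=M(K,V)\},\qquad \mathcal{B}(V^*,K^* ):=\{\mathbf{b}\in\partial(K^* ):\|\mathbf{b}\|_{V^*}=M(V^*,K^* )\},$$ where $M(V^*,K^* )=\max_{y\in K^*}\|y\|_{V^*}$. $C(\mathbb{R}^m)$ is the space of continuous complex-valued functions $F$ on $\mathbb{R}^m$ with finite norm $\|F\|_{C(\mathbb{R}^m)}=\sup_{x\in\mathbb{R}^m}|F(x)|$. $B_V$ is the set of entire functions $f:\mathbb{C}^m\to\mathbb{C}$ of exponential type $V$, i.e. such that for every $\varepsilon>0$ there is a constant $C_0(\varepsilon,f)>0$ with $|f(z)|\le C_0(\varepsilon,f)\exp[(1+\varepsilon)\|z\|_{V^*}]$ for all $z\in\mathbb{C}^m$. The same notation is used for $f\in B_V$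 and its restriction to $\mathbb{R}^m$. Inequality (I) holds for all $f\in B_V\cap C(\mathbb{R}^m)$ and all $x\in\mathbb{R}^m$; inequality (II) holds for all real-valued $f\in B_V\cap C(\mathbb{R}^m)$ and all $x\in\mathbb{R}^m$.
   Formalization: For inequality (II), ''extremal'' is taken to mean equality at a point where ∇f_0(x) ≠ 0; with equality at any point the claim is false, e.g. f_0 = 1 gives equality in (II) everywhere but has no zero x_0. *)

(* Defs.v *)
From mathcomp Require Import all_boot all_order all_algebra.
From mathcomp Require Import complex.
From mathcomp Require Import all_classical all_reals all_analysis.

Set Implicit Arguments.
Unset Strict Implicit.
Unset Printing Implicit Defensive.

Import Order.TTheory GRing.Theory Num.Theory.
Import numFieldNormedType.Exports.

Local Open Scope classical_set_scope.
Local Open Scope ring_scope.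
Local Open Scope complex_scope.

Definition dot (A : comNzRingType) (m : nat) (t y : 'rV[A]_m) : A :=
  \sum_(j < m) t 0 j * y 0 j.

Definition toC (R : realType) (m : nat) (x : 'rV[R]_m) : 'rV[R[i]]_m :=
  map_mx (real_complex R) x.

(* The modulus |z| as an element of R; the library's norm on R[i] takes its
   values in R[i]. *)
Definition cmod (R : realType) (z : R[i]) : R := ComplexField.Normc.normc z.

Definition convex_body (R : realType) (m : nat) (V : set 'rV[R]_m) : Prop :=
  [/\ compact V, convex_set V & interior V !=set0].

Definition origin_symmetric (R : realType) (m : nat) (V : set 'rV[R]_m) : Prop :=
  forall x, V x -> V (- x).

Definition boundary (R : realType) (m : nat) (V : set 'rV[R]_m) : set 'rV[R]_m :=
  closure V `\` interior V.

Definition polar (R : realType) (m : nat) (V : set 'rV[R]_m) : set 'rV[R]_m :=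
  [set y | forall t, V t -> `|dot t y| <= 1].

(* Maxima over compact sets are written as suprema in the next four
   definitions: for symmetric convex bodies the sets of values are nonempty
   and bounded, and the suprema are attained. *)

(* ||x||_V *)
Definition bnorm (R : realType) (m : nat) (V : set 'rV[R]_m) (x : 'rV[R]_m) : R :=
  sup [set `|dot t x| | t in polar V].

(* ||z||_{V^*}, for complex z *)
Definition dnorm (R : realType) (m : nat) (V : set 'rV[R]_m) (z : 'rV[R[i]]_m) : R :=
  sup [set cmod (dot (toC t) z) | t in V].

(* M(K, V) *)
Definition maxnorm (R : realType) (m : nat) (K V : set 'rV[R]_m) : R :=
  sup [set bnorm K y | y in V].

(* M(V^*, K^* ), as a function of the bodies V and K themselves *)
Definition maxnorm_dual (R : realType) (m : nat) (V K : set 'rV[R]_m) : R :=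
  sup [set dnorm V (toC y) | y in polar K].

(* A(K, V) *)
Definition extremal_pts (R : realType) (m : nat) (K V : set 'rV[R]_m) :
    set 'rV[R]_m :=
  [set a | boundary V a /\ bnorm K a = maxnorm K V].

(* B(V^*, K^* ), as a function of the bodies V and K themselves *)
Definition extremal_pts_dual (R : realType) (m : nat) (V K : set 'rV[R]_m) :
    set 'rV[R]_m :=
  [set b | boundary (polar K) b /\ dnorm V (toC b) = maxnorm_dual V K].

(* Complex Frechet differentiability on C^m; the alias R[i]^o carries the
   normed-space structure of R[i] over itself. *)
Definition entire (R : realType) (m : nat) (f : 'rV[R[i]]_m -> R[i]) : Prop :=
  forall z, differentiable (f : 'rV[R[i]]_m -> R[i]^o) z.

(* f \in B_V *)
Definition exp_type (R : realType) (m : nat) (V : set 'rV[R]_m)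
    (f : 'rV[R[i]]_m -> R[i]) : Prop :=
  entire f /\
  forall eps : R, 0 < eps -> exists2 C0 : R, 0 < C0 &
    forall z, cmod (f z) <= C0 * expR ((1 + eps) * dnorm V z).

Definition restr (R : realType) (m : nat) (f : 'rV[R[i]]_m -> R[i]) :
    'rV[R]_m -> R[i] :=
  fun x => f (toC x).

(* F \in C(R^m): continuous with finite supremum norm *)
Definition bounded_continuous (R : realType) (m : nat) (F : 'rV[R]_m -> R[i]) :
    Prop :=
  continuous (F : 'rV[R]_m -> R[i]^o) /\
  exists N : R, forall x, cmod (F x) <= N.

Definition Cnorm (R : realType) (m : nat) (F : 'rV[R]_m -> R[i]) : R :=
  sup [set cmod (F x) | x in [set: 'rV[R]_m]].

Definition gradient (R : realType) (m : nat) (f : 'rV[R]_m -> R) (x : 'rV[R]_m) :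
    'rV[R]_m :=
  \row_(j < m) 'D_('e_j) f x.

(* In the next two definitions the second function argument F is f viewed as
   an element of C(R^m). *)

Definition extremal_I (R : realType) (m : nat) (K V : set 'rV[R]_m)
    (f : 'rV[R]_m -> R) (F : 'rV[R]_m -> R[i]) : Prop :=
  exists x, bnorm K (gradient f x) = maxnorm K V * Cnorm F.

(* The point of equality is required not to be critical.  At a point where
   |f| attains ||f||_C(R^m) one has gradient f x = 0, and the Bernstein-Szego
   equality below holds trivially for every f; e.g. it holds for f = 1, which
   vanishes nowhere, so without this requirement an extremal function need not
   have a zero.  At a point of equality, gradient f x != 0 is equivalent to
   |f x| < Cnorm F. *)
Definition extremal_II (R : realType) (m : nat) (K V : set 'rV[R]_m)
    (f : 'rV[R]_m -> R) (F : 'rV[R]_m -> R[i]) : Prop :=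
  exists x,
    bnorm K (gradient f x) ^+ 2 + maxnorm K V ^+ 2 * f x ^+ 2
      = maxnorm K V ^+ 2 * Cnorm F ^+ 2
    /\ gradient f x != 0.

Definition trig (R : realType) (m : nat) (R1 R2 : R) (a : 'rV[R]_m) :
    'rV[R]_m -> R :=
  fun x => R1 * cos (dot a x) + R2 * sin (dot a x).

(* Main.v *)
Require Import Defs.
From mathcomp Require Import all_boot all_order all_algebra.
From mathcomp Require Import complex.
From mathcomp Require Import all_classical all_reals all_analysis.
From mathcomp Require Import ring lra.
Import Order.TTheory GRing.Theory Num.Theory.
Import numFieldNormedType.Exports.
Local Open Scope classical_set_scope.
Local Open Scope ring_scope.
Local Open Scope complex_scope.
Set Implicit Arguments.
Unset Strict Implicit.
Unset Printing Implicit Defensive.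
Local Notation Re := complex.Re.
Local Notation Im := complex.Im.

(** The theorem rests on the equality case of the Bernstein-Szegő inequality in
one variable.

Let [phi] be entire of exponential type [sigma], real on the real line, with
[|phi| <= 1] there. For each Chebyshev polynomial [T_n], the function [T_n (phi)]
has type [n sigma] and is again bounded by [1] on the line, so
[|T_n (phi (x + i y))| <= exp (n sigma y)] for [y >= 0] by Phragmén-Lindelöf
([exptype_bound]). Write [phi = (J + 1 / J) / 2] with [|J| >= 1]; letting [n] grow
gives [|J| <= exp (sigma y)], that is, [phi (x + i y)] lies in the ellipse with
foci [-1], [1] and semi-axes [cosh (sigma y)], [sinh (sigma y)]
([bernstein_ellipse]). As [y] tends to [0] this becomes
[phi' ^ 2 <= sigma ^ 2 (1 - phi ^ 2)] ([bernstein_szego]).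

Suppose now that [sigma = 1] and that equality holds at a point where
[phi' <> 0]. The nonnegative function [1 - phi ^ 2 - phi' ^ 2] vanishes there, so
its derivative does, and [phi'' = - phi] at the point. The inequality says that
the operators [p + q d/dx] with [p ^ 2 + q ^ 2 = 1] preserve the class of
functions considered, and they preserve equality; hence the same conclusion for
[p phi + q phi'], and by induction [phi + phi''] vanishes at the point with all
its derivatives ([extremal_derivatives]). These are uniformly bounded on the
line, so [phi'' = - phi] everywhere ([extremal_sinusoid]).

In several variables let [M = M(K, V)], let [N] be the norm of [f0], and choose
[y] in the polar of [K] with [(y, grad f0) = ||grad f0||_K] at the point of
equality. On the line through this point in the direction [y], [f0] has type at
most [M] and attains equality, so [f0 (x0 + tau y) = N sin (M tau)] for a suitable
[x0] on the line ([extremal_direction]). Put [a = grad f0 (x0) / N]. The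
one-variable inequality in the directions of the polar of [V] shows that [a] is in
the bipolar of [V], which is [V] ([bipolar]); moreover [(a, y) = M]. Both [M(K, V)]
and its dual are the maximum of the pairing on [V] and the polar of [K], so a pair
attaining it consists of extremal points ([extremal_pair]).

Finally, [sin (M tau) f0 + cos (M tau) D_y f0 / M] is at most [N] on the whole
space, with equality on the line. Its derivatives across the line therefore vanish:
each component [u] of the gradient satisfies [M sin (M tau) u + cos (M tau) u' = 0],
and differentiating this relation yields [u'' = - M ^ 2 u] with [u' (0) = 0]
([gradient_extremal_line]). So [grad f0 = cos (M tau) grad f0 (x0)] on the line, as
for [g = N sin ((a, x) - (a, x0))].

The complex analysis is obtained from Goursat's theorem on rectangles. In the
variable [log (z - a)] circles are vertical segments, so the theorem, applied to
[f (a + exp w)] and [(f (a + exp w) - f a) exp (- w)], gives the mean value property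
and Cauchy's formula for the derivative; the first implies the maximum principle,
the second the differentiability of derivatives and the symmetry of mixed ones.
Integrals of continuous functions are increments of antiderivatives. *)

(** * Complex numbers and complex differentiability *)

Section ComplexNumbers.
Variable R : realType.
Implicit Types z w : R[i].
Notation C := R[i].

Lemma cmod_ge0 z : 0 <= cmod z.
Proof. by case: z => a b; exact: sqrtr_ge0. Qed.

Lemma cmod_sqr z : cmod z ^+ 2 = Re z ^+ 2 + Im z ^+ 2.
Proof. by case: z => a b /=; rewrite sqr_sqrtr // addr_ge0 // sqr_ge0. Qed.

Lemma cmod0 : cmod (0 : C) = 0.
Proof. exact: ComplexField.Normc.normc0. Qed.

Lemma cmod0_eq0 z : cmod z = 0 -> z = 0.
Proof. exact: ComplexField.Normc.eq0_normc. Qed.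

Lemma cmod_gt0 z : z != 0 -> 0 < cmod z.
Proof.
move=> z0; rewrite lt_neqAle cmod_ge0 andbT eq_sym.
by apply: contraNneq z0 => /cmod0_eq0 ->.
Qed.

Lemma cmodM z w : cmod (z * w) = cmod z * cmod w.
Proof. exact: ComplexField.Normc.normcM. Qed.

Lemma cmodD z w : cmod (z + w) <= cmod z + cmod w.
Proof. exact: le_normcD. Qed.

Lemma cmodN z : cmod (- z) = cmod z.
Proof. exact: normcN. Qed.

Lemma cmodB z w : cmod (z - w) <= cmod z + cmod w.
Proof. by rewrite -(cmodN w) cmodD. Qed.

Lemma cmodBC z w : cmod (z - w) = cmod (w - z).
Proof. by rewrite -cmodN opprB. Qed.

Lemma cmodX z n : cmod (z ^+ n) = cmod z ^+ n.
Proof.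
elim: n => [|n IH]; first by rewrite !expr0; exact: ComplexField.Normc.normc1.
by rewrite !exprS cmodM IH.
Qed.

Lemma cmod1 : cmod (1 : C) = 1.
Proof. exact: ComplexField.Normc.normc1. Qed.

Lemma cmodV z : cmod z^-1 = (cmod z)^-1.
Proof.
have [->|z0] := eqVneq z 0; first by rewrite invr0 cmod0 invr0.
apply: (@mulIf _ (cmod z)); first by rewrite gt_eqF // cmod_gt0.
by rewrite -cmodM !mulVf ?cmod1 // gt_eqF // cmod_gt0.
Qed.

Lemma cmod_real (x : R) : cmod x%:C = `|x|.
Proof. by rewrite /cmod /= expr0n /= addr0 sqrtr_sqr. Qed.

Lemma cmodi : cmod ('i : C) = 1.
Proof. by rewrite /cmod /= expr0n /= expr1n add0r sqrtr1. Qed.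

Lemma ler_abs_Re z : `|Re z| <= cmod z.
Proof.
by rewrite -(ler_pXn2r (n:=2)) ?nnegrE ?cmod_ge0 // cmod_sqr real_normK ?num_real //; have := sqr_ge0 (Im z); lra.
Qed.

Lemma ler_abs_Im z : `|Im z| <= cmod z.
Proof.
by rewrite -(ler_pXn2r (n:=2)) ?nnegrE ?cmod_ge0 // cmod_sqr real_normK ?num_real //; have := sqr_ge0 (Re z); lra.
Qed.

Lemma ler_Re z : Re z <= cmod z.
Proof. by apply: le_trans (ler_abs_Re z); exact: ler_norm. Qed.

Lemma cmod_le z : cmod z <= `|Re z| + `|Im z|.
Proof.
have h := normr_ge0 (Re z); have h' := normr_ge0 (Im z).
rewrite -(ler_pXn2r (n:=2)) ?nnegrE ?cmod_ge0 ?addr_ge0 //.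
rewrite cmod_sqr -(real_normK (num_real (Re z))) -(real_normK (num_real (Im z))); nra.
Qed.

Lemma ReM z w : Re (z * w) = Re z * Re w - Im z * Im w.
Proof. by case: z => a b; case: w => c d. Qed.

Lemma ImM z w : Im (z * w) = Re z * Im w + Im z * Re w.
Proof. by case: z => a b; case: w => c d. Qed.

Lemma ReD z w : Re (z + w) = Re z + Re w.
Proof. by case: z => a b; case: w => c d. Qed.

Lemma ImD z w : Im (z + w) = Im z + Im w.
Proof. by case: z => a b; case: w => c d. Qed.

Lemma ReN z : Re (- z) = - Re z.
Proof. by case: z. Qed.

Lemma ImN z : Im (- z) = - Im z.
Proof. by case: z. Qed.

Lemma ceqP z w : Re z = Re w -> Im z = Im w -> z = w.
Proof. by case: z => a b; case: w => c d /= -> ->. Qed.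

Definition cE := (ReM, ImM, ReD, ImD, ReN, ImN).

(** After this rotation the real part computes the modulus of [z], so that
estimates of moduli reduce to estimates of real functions. *)
Lemma rotation_exists z : exists2 c : C, cmod c = 1 & c * z = (cmod z)%:C.
Proof.
have [->|z0] := eqVneq z 0.
  by exists 1; [exact: ComplexField.Normc.normc1 | rewrite cmod0 mulr0].
exists ((cmod z)%:C / z); last by rewrite divfK.
rewrite cmodM cmodV cmod_real ger0_norm ?cmod_ge0 //.
by rewrite divff // gt_eqF // cmod_gt0.
Qed.

Definition ccont (g : C -> C) z := forall e : R, 0 < e -> exists2 d : R, 0 < d &
  forall w, cmod (w - z) < d -> cmod (g w - g z) < e.

(** Carathéodory's form of complex differentiability: it turns the product and
the chain rule into algebra. *)
Definition hasD (f : C -> C) z l := exists q : C -> C,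
  [/\ forall w, f w = f z + q w * (w - z), q z = l & ccont q z].

Lemma ccont_cst c z : ccont (fun=> c) z.
Proof. by move=> e e0; exists 1 => // w _; rewrite subrr cmod0. Qed.

Lemma ccont_id z : ccont id z.
Proof. by move=> e e0; exists e. Qed.

Lemma ccontD f g z : ccont f z -> ccont g z -> ccont (fun w => f w + g w) z.
Proof.
move=> hf hg e e0.
have e2 : 0 < e / 2 by lra.
have [d1 d10 h1] := hf _ e2; have [d2 d20 h2] := hg _ e2.
exists (Num.min d1 d2) => [|w]; first by rewrite lt_min d10.
rewrite lt_min => /andP[/h1 k1 /h2 k2].
have -> : f w + g w - (f z + g z) = (f w - f z) + (g w - g z) by ring.
have := cmodD (f w - f z) (g w - g z); lra.
Qed.

Lemma ccontM f g z : ccont f z -> ccont g z -> ccont (fun w => f w * g w) z.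
Proof.
move=> hf hg e e0.
pose A := 1 + cmod (f z) + cmod (g z).
have fz0 := cmod_ge0 (f z); have gz0 := cmod_ge0 (g z).
have A0 : 0 < A by rewrite /A; lra.
pose e' := Num.min 1 (e / (3 * A)).
have e'0 : 0 < e' by rewrite lt_min ltr01 divr_gt0 // mulr_gt0.
have e'A : e' * A <= e / 3.
  have : e' <= e / (3 * A) by rewrite ge_min lexx orbT.
  rewrite -(ler_pM2r A0) => /le_trans; apply.
  by rewrite le_eqVlt; apply/orP; left; apply/eqP; field; lra.
have [d1 d10 h1] := hf _ e'0; have [d2 d20 h2] := hg _ e'0.
exists (Num.min d1 d2) => [|w]; first by rewrite lt_min d10.
rewrite lt_min => /andP[/h1 k1 /h2 k2].
have -> : f w * g w - f z * g z =
  (f w - f z) * (g w - g z) + f z * (g w - g z) + (f w - f z) * g z by ring.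
have e'1 : e' <= 1 by rewrite ge_min lexx.
have x0 := cmod_ge0 (f w - f z); have y0 := cmod_ge0 (g w - g z).
have t1 := cmodD ((f w - f z) * (g w - g z) + f z * (g w - g z)) ((f w - f z) * g z).
have t2 := cmodD ((f w - f z) * (g w - g z)) (f z * (g w - g z)).
rewrite !cmodM in t1 t2.
clear h1 h2 A0; move: e'1 e'A k1 k2 x0 y0 t1 t2 fz0 gz0; rewrite /A.
move: (cmod (f w - f z)) (cmod (g w - g z)) (cmod (f z)) (cmod (g z)) e' e'0.
move=> x y a b r r0 r1 rA xr yr x0 y0 t1 t2 a0 b0.
have p1 : x * y <= r by nra.
have p2 : a * y <= a * r by nra.
have p3 : x * b <= r * b by nra.
nra.
Qed.

Lemma ccont_comp f g z : ccont g z -> ccont f (g z) -> ccont (fun w => f (g w)) z.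
Proof.
move=> hg hf e e0; have [d d0 hd] := hf _ e0; have [d' d'0 hd'] := hg _ d0.
by exists d' => // w /hd' /hd.
Qed.

Lemma ccont_eq f g z : (forall w, f w = g w) -> ccont f z -> ccont g z.
Proof. by move=> /funext ->. Qed.

Lemma hasD_ccont f z l : hasD f z l -> ccont f z.
Proof.
move=> [q [fq ql qc]]; apply: (@ccont_eq (fun w => f z + q w * (w - z))) => [w|].
  by rewrite -fq.
apply: ccontD; first exact: ccont_cst.
apply: ccontM => //; apply: ccontD; [exact: ccont_id|exact: ccont_cst].
Qed.

Lemma hasD_cst c z : hasD (fun=> c) z 0.
Proof. by exists (fun=> 0); split=> [w||]; [rewrite mul0r addr0| |exact: ccont_cst]. Qed.

Lemma hasD_id z : hasD id z 1.
Proof. by exists (fun=> 1); split=> [w||]; [rewrite mul1r addrC subrK| |exact: ccont_cst]. Qed.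

Lemma hasDD f g z l k : hasD f z l -> hasD g z k ->
  hasD (fun w => f w + g w) z (l + k).
Proof.
move=> [q [fq ql qc]] [r [gr rk rc]]; exists (fun w => q w + r w); split=> [w||].
- by rewrite (fq w) (gr w); ring.
- by rewrite ql rk.
- exact: ccontD.
Qed.

Lemma hasDM f g z l k : hasD f z l -> hasD g z k ->
  hasD (fun w => f w * g w) z (l * g z + f z * k).
Proof.
move=> hf hg; have gc := hasD_ccont hg.
case: hf => q [fq ql qc]; case: hg => r [gr rk rc].
exists (fun w => q w * g w + f z * r w); split=> [w||].
- by rewrite (fq w) (gr w); ring.
- by rewrite ql rk.
- by apply: ccontD; apply: ccontM => //; exact: ccont_cst.
Qed.

Lemma hasD_comp f g z l k : hasD g z k -> hasD f (g z) l ->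
  hasD (fun w => f (g w)) z (l * k).
Proof.
move=> hg; have gc := hasD_ccont hg; case: hg => r [gr rk rc] [q [fq ql qc]].
exists (fun w => q (g w) * r w); split=> [w||].
- by rewrite (fq (g w)) {2}(gr w); ring.
- by rewrite ql rk.
- by apply: ccontM => //; exact: ccont_comp.
Qed.

Lemma hasD_eq f g z l k : hasD f z l -> (forall w, f w = g w) -> l = k -> hasD g z k.
Proof. by move=> + /funext <- <-. Qed.

Lemma hasDZ c f z l : hasD f z l -> hasD (fun w => c * f w) z (c * l).
Proof.
by move=> hf; apply: hasD_eq (hasDM (hasD_cst c z) hf) _ _ => //; ring.
Qed.

Lemma hasDN f z l : hasD f z l -> hasD (fun w => - f w) z (- l).
Proof.
by move=> hf; apply: hasD_eq (hasDZ (-1) hf) _ _ => [w|]; rewrite mulN1r.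
Qed.

Lemma hasDB f g z l k : hasD f z l -> hasD g z k ->
  hasD (fun w => f w - g w) z (l - k).
Proof. by move=> hf hg; apply: hasDD => //; exact: hasDN. Qed.

(** The little-o form, in which derivatives are obtained from estimates. *)
Lemma hasDP f z l : hasD f z l <-> forall e : R, 0 < e -> exists2 d : R, 0 < d &
  forall h, cmod h < d -> cmod (f (z + h) - f z - l * h) <= e * cmod h.
Proof.
split=> [[q [fq ql qc]] e e0|H].
  have [d d0 hd] := qc _ e0; exists d => // h hh.
  have -> : f (z + h) - f z - l * h = (q (z + h) - q z) * h.
    by rewrite (fq (z + h)) ql; ring.
  by rewrite cmodM ler_wpM2r ?cmod_ge0 // ltW // hd // (addrC z) addrK.
exists (fun w => if w == z then l else (f w - f z) / (w - z)); split=> [w||].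
- have [->|wz] := eqVneq w z; first by rewrite subrr mulr0 addr0.
  by rewrite divfK ?subr_eq0 // addrC subrK.
- by rewrite eqxx.
move=> e e0; have e2 : 0 < e / 2 by lra.
have [d d0 hd] := H _ e2; exists d => // w wd; rewrite eqxx.
have [_|wz] := eqVneq w z; first by rewrite subrr cmod0.
have wz0 : w - z != 0 by rewrite subr_eq0.
have := hd _ wd; rewrite (addrC z) subrK => hw.
rewrite -(ltr_pM2r (cmod_gt0 wz0)) -cmodM mulrBl divfK //.
have := cmod_gt0 wz0; nra.
Qed.

Lemma hasD_unique f z l k : hasD f z l -> hasD f z k -> l = k.
Proof.
move=> hf hg; apply/eqP; rewrite -subr_eq0; apply/eqP.
have [q [fq ql qc]] := hasDB hf hg.
have qz w : w != z -> q w = 0.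
  move=> wz; have := fq w; rewrite !subrr add0r => /esym/eqP.
  by rewrite mulf_eq0 subr_eq0 (negbTE wz) orbF => /eqP.
apply: cmod0_eq0; apply/eqP; rewrite eq_le cmod_ge0 andbT leNgt; apply/negP => e0.
have [d d0 hd] := qc _ e0.
have d20 : 0 < d / 2 by lra.
have : cmod (z + (d / 2)%:C - z) < d by rewrite addrC addKr cmod_real; clear ql; rewrite ger0_norm; lra.
move=> /hd; rewrite qz; last first.
  rewrite -subr_eq0 addrC addKr; clear ql; apply/eqP => /(congr1 (@complex.Re R)) /=; lra.
by rewrite ql sub0r cmodN ltxx.
Qed.

End ComplexNumbers.

(** * Functions of a real variable and antiderivatives *)

Section RealVariable.
Variable R : realType.
Notation C := R[i].

Definition rderiv (f : R -> R) (x l : R) := is_derive x 1 f l.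

Lemma rderiv_eq f g x l k : rderiv f x l -> (forall t, f t = g t) -> l = k ->
  rderiv g x k.
Proof. by rewrite /rderiv => + /funext <- <-. Qed.

Lemma rderivP f x l : rderiv f x l <-> exists g : R -> R,
  [/\ forall z, f z - f x = g z * (z - x), g x = l &
  forall e, 0 < e -> exists2 d, 0 < d & forall z, `|z - x| < d -> `|g z - l| < e].
Proof.
rewrite /rderiv is_derive1_caratheodory; split=> -[g]; last first.
  move=> [fg gl gc]; exists g; split=> //; rewrite /prop_for /continuous_at gl.
  apply/cvgrPdist_lt => e /gc[d d0 hd]; apply/nbhs_ballP; exists d => //= z.
  by rewrite /ball /= distrC => /hd; rewrite distrC.
move=> [fg gc gl]; exists g; split=> // e e0.
move: gc; rewrite /prop_for /continuous_at gl => /cvgrPdist_lt /(_ _ e0) /nbhs_ballP[d /= d0 hd].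
by exists d => // z zx; rewrite distrC; apply: hd; rewrite /ball /= distrC.
Qed.

Lemma rderivD f g x l k : rderiv f x l -> rderiv g x k ->
  rderiv (fun t => f t + g t) x (l + k).
Proof.
move=> hf hg; apply: (@rderiv_eq (f + g) _ _ (l + k)) => //; exact: is_deriveD.
Qed.

Lemma rderivB f g x l k : rderiv f x l -> rderiv g x k ->
  rderiv (fun t => f t - g t) x (l - k).
Proof.
move=> hf hg; apply: (@rderiv_eq (f - g) _ _ (l - k)) => //; exact: is_deriveB.
Qed.

Lemma rderivM f g x l k : rderiv f x l -> rderiv g x k ->
  rderiv (fun t => f t * g t) x (l * g x + f x * k).
Proof.
move=> hf hg; apply: (@rderiv_eq (f * g) _ _ (f x *: k + g x *: l)) => //.
  exact: is_deriveM.
by rewrite /GRing.scale /= addrC; congr (_ + _); rewrite mulrC.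
Qed.

Lemma rderivZ c f x l : rderiv f x l -> rderiv (fun t => c * f t) x (c * l).
Proof.
move=> hf; apply: (@rderiv_eq (c \*: f) _ _ (c *: l)) => //; exact: is_deriveZ.
Qed.

Lemma rderiv_continuous f x l : rderiv f x l -> {for x, continuous f}.
Proof. by case => df _; apply/differentiable_continuous/derivable1_diffP. Qed.

Lemma mvt f df (a b : R) : a <= b ->
  (forall x, a <= x <= b -> rderiv f x (df x)) ->
  exists2 c, a <= c <= b & f b - f a = df c * (b - a).
Proof.
move=> ab H; have [x||c + ->] := @MVT_segment R f df a b ab.
- by move=> /[1!in_itv]/= /andP[/ltW ax /ltW xb]; apply: H; rewrite ax.
- apply: continuous_in_subspaceT => x; rewrite inE/= in_itv/= => xab.
  exact: rderiv_continuous (H _ xab).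
- by rewrite in_itv/= => cab; exists c.
Qed.

Lemma mvt_le f df (a b B : R) : a <= b ->
  (forall x, a <= x <= b -> rderiv f x (df x)) ->
  (forall x, a <= x <= b -> df x <= B) -> f b - f a <= B * (b - a).
Proof.
by move=> ab /(mvt ab)[c cab ->] /(_ _ cab); apply: ler_wpM2r; rewrite subr_ge0.
Qed.

Lemma rderiv0_cst f : (forall x, rderiv f x 0) -> forall x y, f x = f y.
Proof. by move=> H x y; exact: is_derive_0_is_cst. Qed.

Lemma rderiv_id x : rderiv (fun t => t) x 1.
Proof. exact: is_derive_id. Qed.

Lemma rderiv_linear c x : rderiv (fun t => c * t) x c.
Proof. by apply: rderiv_eq (rderivZ c (rderiv_id x)) _ _ => //; rewrite mulr1. Qed.

Lemma rderiv_cos_linear c x : rderiv (fun t => cos (c * t)) x (- sin (c * x) * c).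
Proof. exact: (is_derive1_comp (is_derive_cos _) (rderiv_linear c x)). Qed.

Lemma rderiv_sin_linear c x : rderiv (fun t => sin (c * t)) x (cos (c * x) * c).
Proof. exact: (is_derive1_comp (is_derive_sin _) (rderiv_linear c x)). Qed.

Lemma rantiderivative_right (f : R -> R) (a : R) : (forall x, {for x, continuous f}) ->
  exists F, forall x, a < x -> rderiv F x (f x).
Proof.
move=> cf; exists (fun x => \int[lebesgue_measure]_(t in `[a, x]) f t)%R => x ax.
have xx1 : x < x + 1 by rewrite ltrDl.
have int : lebesgue_measure.-integrable `[a, x + 1] (EFin \o f).
  apply: (@continuous_compact_integrable R f); first exact: segment_compact.
  exact: continuous_subspaceT.
have [d e] := @continuous_FTC1_closed R f _ x _ xx1 int ax (cf x).
exact: DeriveDef d (etrans (esym (derive1E _ _)) e).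
Qed.

(** The Lebesgue integral from [- n] gives an antiderivative to the right of [- n];
normalized at [0], these agree on common domains. *)
Lemma rantiderivative (f : R -> R) : (forall x, {for x, continuous f}) ->
  exists F, forall x, rderiv F x (f x).
Proof.
move=> cf.
have /choice[A dA] : forall n : nat, exists F, forall x, - n%:R < x -> rderiv F x (f x).
  by move=> n; exact: rantiderivative_right.
have glue n p x : `|x| < n%:R -> (n <= p)%N -> A n x - A n 0 = A p x - A p 0.
  move=> xn np; have np' : (n%:R : R) <= p%:R by rewrite ler_nat.
  have n0 : 0 < n%:R :> R by apply: le_lt_trans xn.
  move: xn; rewrite ltr_norml => /andP[nx xn].
  have D y : - n%:R < y -> rderiv (fun t => A n t - A p t) y 0.
    move=> ny; apply: (@rderiv_eq (A n - A p) _ _ (f y - f y)) => //; last exact: subrr.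
    by apply: is_deriveB; [exact: dA|apply: dA; lra].
  have [x0|x0] := leP 0 x.
    have [y /andP[y0 yx]|c _] := @mvt (fun t => A n t - A p t) (fun=> 0) 0 x x0.
      by apply: D; lra.
    by rewrite mul0r; lra.
  have [y /andP[y0 yx]|c _] := @mvt (fun t => A n t - A p t) (fun=> 0) x 0 (ltW x0).
    by apply: D; lra.
  by rewrite mul0r; lra.
pose F x := A (Num.bound x) x - A (Num.bound x) 0.
exists F => x; pose N := Num.bound (`|x| + 1).
have hN : `|x| + 1 < N%:R.
  have := archi_boundP (normr_ge0 (`|x| + 1)); rewrite /N.
  rewrite /Num.Def.archi_bound !normr_id ger0_norm; first exact.
  by rewrite addr_ge0.
have {dA}dA : rderiv (fun y => A N y - A N 0) x (f x).
  apply: (@rderiv_eq (A N - cst (A N 0)) _ _ (f x - 0)) => //; last exact: subr0.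
  apply: is_deriveB; apply: dA.
  have := ler_norm (- x); rewrite normrN => h.
  have : 0 < 1 :> R by []. lra.
apply: near_eq_is_derive dA.
apply/nbhs_ballP; exists 1 => //= y; rewrite /ball/= => xy.
have y1 : `|y| < N%:R.
  apply: le_lt_trans hN; have -> : y = x - (x - y) by ring.
  by apply: le_trans (ler_normB _ _) _; rewrite lerD2l ltW.
have yb : `|y| < (Num.bound y)%:R.
  by have := archi_boundP (normr_ge0 y); rewrite /Num.Def.archi_bound normr_id.
rewrite /F; have [le|/ltnW le] := leqP N (Num.bound y).
  exact: glue.
by apply/esym/glue.
Qed.

Definition pcont (g : R -> C) t := forall e : R, 0 < e -> exists2 d : R, 0 < d &
  forall s, `|s - t| < d -> cmod (g s - g t) < e.

(** Carathéodory's form again, for curves in the complex plane. *)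
Definition pderiv (P : R -> C) t l := exists q : R -> C,
  [/\ forall s, P s = P t + q s * (s - t)%:C, q t = l & pcont q t].

Lemma rderiv_pderiv P t l : rderiv (fun s => Re (P s)) t (Re l) ->
  rderiv (fun s => Im (P s)) t (Im l) -> pderiv P t l.
Proof.
move=> /rderivP[g [fg gl gc]] /rderivP[h [fh hl hc]].
exists (fun s => g s +i* h s); split=> [s||e e0].
- apply: ceqP; rewrite !cE /= mulr0.
    by rewrite subr0 -fg addrC subrK.
  by rewrite add0r -fh addrC subrK.
- by rewrite gl hl; case: (l).
have e2 : 0 < e / 2 by lra.
have [d1 d10 h1] := gc _ e2; have [d2 d20 h2] := hc _ e2.
exists (Num.min d1 d2) => [|s]; first by rewrite lt_min d10.
rewrite lt_min => /andP[/h1 k1 /h2 k2]; apply: le_lt_trans (cmod_le _) _.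
by rewrite !cE /= gl hl; lra.
Qed.

Lemma pderiv_rderiv P t l : pderiv P t l -> rderiv (fun s => Re (P s)) t (Re l) /\
  rderiv (fun s => Im (P s)) t (Im l).
Proof.
move=> [q [Pq ql qc]]; split; apply/rderivP.
  exists (fun s => Re (q s)); rewrite ql; split=> // [s|e /qc[d d0 hd]].
    by rewrite (Pq s) !cE /=; ring.
  exists d => // s /hd; rewrite ql; apply: le_lt_trans.
  by have := ler_abs_Re (q s - l); rewrite !cE.
exists (fun s => Im (q s)); rewrite ql; split=> // [s|e /qc[d d0 hd]].
  by rewrite (Pq s) !cE /=; ring.
exists d => // s /hd; rewrite ql; apply: le_lt_trans.
by have := ler_abs_Im (q s - l); rewrite !cE.
Qed.

Lemma pderiv_eq P Q t l k : pderiv P t l -> (forall s, P s = Q s) -> l = k ->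
  pderiv Q t k.
Proof. by move=> + /funext <- <-. Qed.

Lemma pcont_eq P Q t : pcont P t -> (forall s, P s = Q s) -> pcont Q t.
Proof. by move=> + /funext <-. Qed.

Lemma pderivD P Q t l k : pderiv P t l -> pderiv Q t k ->
  pderiv (fun s => P s + Q s) t (l + k).
Proof.
move=> [q [Pq ql qc]] [r [Qr rk rc]]; exists (fun w => q w + r w); split=> [w||e e0].
- by rewrite (Pq w) (Qr w); ring.
- by rewrite ql rk.
have e2 : 0 < e / 2 by lra.
have [d1 d10 h1] := qc _ e2; have [d2 d20 h2] := rc _ e2.
exists (Num.min d1 d2) => [|s]; first by rewrite lt_min d10.
rewrite lt_min => /andP[/h1 k1 /h2 k2].
have -> : q s + r s - (q t + r t) = (q s - q t) + (r s - r t) by ring.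
have := cmodD (q s - q t) (r s - r t); lra.
Qed.

Lemma pcontZ c g t : pcont g t -> pcont (fun s => c * g s) t.
Proof.
move=> gc e e0; have c0 := cmod_ge0 c.
have e2 : 0 < e / (1 + cmod c) by rewrite divr_gt0 // ltr_pwDl.
have [d d0 h] := gc _ e2; exists d => // s /h.
rewrite -mulrBr cmodM ltr_pdivlMr ?ltr_pwDl // => ?.
have := cmod_ge0 (g s - g t); nra.
Qed.

Lemma pderivZ c P t l : pderiv P t l -> pderiv (fun s => c * P s) t (c * l).
Proof.
move=> [q [Pq ql qc]]; exists (fun w => c * q w); split=> [w||].
- by rewrite (Pq w); ring.
- by rewrite ql.
- exact: pcontZ.
Qed.

Lemma pderivB P Q t l k : pderiv P t l -> pderiv Q t k ->
  pderiv (fun s => P s - Q s) t (l - k).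
Proof.
move=> hP /(pderivZ (-1)) hQ.
by apply: pderiv_eq (pderivD hP hQ) _ _ => [s|]; rewrite mulN1r.
Qed.

Lemma hasD_pderiv f z v t l : hasD f (z + t%:C * v) l ->
  pderiv (fun s : R => f (z + s%:C * v)) t (l * v).
Proof.
move=> [q [fq ql qc]]; exists (fun s : R => q (z + s%:C * v) * v).
split=> [s||e e0].
- by rewrite (fq (z + s%:C * v)) rmorphB; ring.
- by rewrite ql.
have v0 := cmod_ge0 v.
have e2 : 0 < e / (1 + cmod v) by rewrite divr_gt0 // ltr_pwDl.
have [d d0 h] := qc _ e2.
exists (d / (1 + cmod v)) => [|s hs]; first by rewrite divr_gt0 // ltr_pwDl.
have hh : cmod (z + s%:C * v - (z + t%:C * v)) < d.
  have -> : z + s%:C * v - (z + t%:C * v) = (s - t)%:C * v by rewrite rmorphB; ring.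
  move: hs; rewrite ltr_pdivlMr ?ltr_pwDl // cmodM cmod_real => hs.
  by have := normr_ge0 (s - t); nra.
move/h: hh; rewrite -mulrBl cmodM ltr_pdivlMr ?ltr_pwDl // => ?.
have := cmod_ge0 (q (z + s%:C * v) - q (z + t%:C * v)); nra.
Qed.

Lemma ccont_pcont f z v t : ccont f (z + t%:C * v) ->
  pcont (fun s : R => f (z + s%:C * v)) t.
Proof.
move=> fc e /fc[d d0 h]; have v0 := cmod_ge0 v.
exists (d / (1 + cmod v)) => [|s hs]; first by rewrite divr_gt0 // ltr_pwDl.
apply: h.
have -> : z + s%:C * v - (z + t%:C * v) = (s - t)%:C * v by rewrite rmorphB; ring.
move: hs; rewrite ltr_pdivlMr ?ltr_pwDl // cmodM cmod_real => hs.
by have := normr_ge0 (s - t); nra.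
Qed.

Lemma antiderivative (g : R -> C) : (forall t, pcont g t) ->
  exists P, forall t, pderiv P t (g t).
Proof.
move=> gc.
have [|F hF] := @rantiderivative (fun s => Re (g s)).
  move=> t; apply/cvgrPdist_lt => e /gc -/(_ t)[d d0 hd].
  apply/nbhs_ballP; exists d => //= s; rewrite /ball /= distrC => /hd.
  by rewrite cmodBC; apply: le_lt_trans; have := ler_abs_Re (g t - g s); rewrite !cE.
have [|G hG] := @rantiderivative (fun s => Im (g s)).
  move=> t; apply/cvgrPdist_lt => e /gc -/(_ t)[d d0 hd].
  apply/nbhs_ballP; exists d => //= s; rewrite /ball /= distrC => /hd.
  by rewrite cmodBC; apply: le_lt_trans; have := ler_abs_Im (g t - g s); rewrite !cE.
by exists (fun s => F s +i* G s) => t; exact: rderiv_pderiv.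
Qed.

(** Rotating the increment onto the real axis reduces the complex mean value
inequality to the real one. *)
Lemma mean_value_ineq (P dP : R -> C) (a b B : R) : a <= b ->
  (forall t, a <= t <= b -> pderiv P t (dP t)) ->
  (forall t, a <= t <= b -> cmod (dP t) <= B) ->
  cmod (P b - P a) <= B * (b - a).
Proof.
move=> ab HP HB; have [c c1 cP] := rotation_exists (P b - P a).
have -> : cmod (P b - P a) = Re (c * P b) - Re (c * P a).
  by rewrite -[LHS]/(Re (cmod (P b - P a))%:C) -cP mulrBr [LHS]ReD ReN.
apply: (@mvt_le (fun t => Re (c * P t)) (fun t => Re (c * dP t))) => // t tab.
  by have [] := pderiv_rderiv (pderivZ c (HP _ tab)).
by apply: le_trans (ler_Re _) _; rewrite cmodM c1 mul1r HB.
Qed.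

(** Integrals are increments of antiderivatives; this makes them independent of
the antiderivative. *)
Lemma pderiv_incr (P Q g : R -> C) : (forall t, pderiv P t (g t)) ->
  (forall t, pderiv Q t (g t)) -> forall a b, P b - P a = Q b - Q a.
Proof.
move=> hP hQ.
have D t : pderiv (fun s => P s - Q s) t 0.
  by rewrite -(subrr (g t)); exact: pderivB.
have E a b : a <= b -> P b - P a = Q b - Q a.
  move=> ab; have /(_ 0) := mean_value_ineq ab (fun t _ => D t).
  rewrite mul0r cmod0 => /(_ (fun _ _ => lexx _)) h.
  have /cmod0_eq0 h' : cmod (P b - Q b - (P a - Q a)) = 0.
    by apply/eqP; rewrite eq_le h cmod_ge0.
  apply/eqP; rewrite -subr_eq0; apply/eqP; rewrite -[RHS]h'; ring.
move=> a b; have [/E //|/ltW/E h] := leP a b.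
by rewrite -opprB h opprB.
Qed.

End RealVariable.

(** * Goursat's theorem on rectangles *)

Section Goursat.
Variable R : realType.
Notation C := R[i].

Definition holo (f : C -> C) := forall z, exists l, hasD f z l.

Lemma pderiv_horizontal f x y (l : C) : hasD f (x +i* y) l ->
  pderiv (fun t => f (t +i* y)) x l.
Proof.
move=> h; have e t : (0 +i* y) + t%:C * 1 = t +i* y by apply: ceqP; rewrite !cE /=; ring.
have := @hasD_pderiv _ f (0 +i* y) 1 x l; rewrite e => /(_ h) H.
by apply: pderiv_eq H _ _ => [t|]; rewrite ?e ?mulr1.
Qed.

Lemma pderiv_vertical f x y (l : C) : hasD f (x +i* y) l ->
  pderiv (fun t => f (x +i* t)) y (l * 'i).
Proof.
move=> h; have e t : x%:C + t%:C * 'i = x +i* t by apply: ceqP; rewrite !cE /=; ring.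
have := @hasD_pderiv _ f x%:C 'i y l; rewrite e => /(_ h) H.
by apply: pderiv_eq H _ _ => [t|]; rewrite ?e.
Qed.

Lemma pcont_vertical (f : C -> C) x y : ccont f (x +i* y) -> pcont (fun t => f (x +i* t)) y.
Proof.
move=> h; have e t : x%:C + t%:C * 'i = x +i* t by apply: ceqP; rewrite !cE /=; ring.
have := @ccont_pcont _ f x%:C 'i y; rewrite e => /(_ h) H.
by apply: pcont_eq H _ => t; rewrite e.
Qed.

Lemma pcont_horizontal (f : C -> C) x y : ccont f (x +i* y) -> pcont (fun t => f (t +i* y)) x.
Proof.
move=> h; have e t : (0 +i* y) + t%:C * 1 = t +i* y by apply: ceqP; rewrite !cE /=; ring.
have := @ccont_pcont _ f (0 +i* y) 1 x; rewrite e => /(_ h) H.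
by apply: pcont_eq H _ => t; rewrite e.
Qed.

Lemma holo_ccont (f : C -> C) z : holo f -> ccont f z.
Proof. by move=> /(_ z)[l /hasD_ccont]. Qed.

Section Rectangles.
Variable f : C -> C.
Hypothesis fh : holo f.
Variables H V : R -> R -> C.
Hypothesis dH : forall y t, pderiv (H y) t (f (t +i* y)).
Hypothesis dV : forall x t, pderiv (V x) t (f (x +i* t)).

(** The integral over the boundary of the rectangle with lower left corner
[x + i y] and sides [a], [b]. *)
Let rect (x y a b : R) : C :=
  (H y (x + a) - H y x) + 'i * (V (x + a) (y + b) - V (x + a) y)
  - (H (y + b) (x + a) - H (y + b) x) - 'i * (V x (y + b) - V x y).

Let rect_quarter x y a b : exists p : bool * bool,
  cmod (rect x y a b) / 4 <=
  cmod (rect (x + (a / 2) *+ p.1) (y + (b / 2) *+ p.2) (a / 2) (b / 2)).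
Proof.
apply: contrapT => /forallNP h.
have h00 := h (false, false); have h01 := h (false, true).
have h10 := h (true, false); have h11 := h (true, true).
move: h00 h01 h10 h11 => /= /negP; rewrite -ltNge => h00 /negP; rewrite -ltNge => h01.
move=> /negP; rewrite -ltNge => h10 /negP; rewrite -ltNge => h11.
rewrite !mulr0n !mulr1n !addr0 in h00 h01 h10 h11.
have E : rect x y a b = (rect x y (a / 2) (b / 2) + rect x (y + b / 2) (a / 2) (b / 2))
   + (rect (x + a / 2) y (a / 2) (b / 2) + rect (x + a / 2) (y + b / 2) (a / 2) (b / 2)).
  rewrite /rect -!(addrA x) -!(addrA y) -!splitr; ring.
have := cmodD (rect x y (a / 2) (b / 2)) (rect x (y + b / 2) (a / 2) (b / 2)).
have := cmodD (rect (x + a / 2) y (a / 2) (b / 2)) (rect (x + a / 2) (y + b / 2) (a / 2) (b / 2)).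
have := cmodD (rect x y (a / 2) (b / 2) + rect x (y + b / 2) (a / 2) (b / 2))
  (rect (x + a / 2) y (a / 2) (b / 2) + rect (x + a / 2) (y + b / 2) (a / 2) (b / 2)).
rewrite -E; clear E; lra.
Qed.

(** The affine part of [f] at [z] has zero boundary integral, so only the little-o
remainder contributes. *)
Let rect_small z e : 0 < e -> exists2 d, 0 < d & forall x y a b,
  0 <= a -> 0 <= b -> a + b < d -> x <= Re z <= x + a -> y <= Im z <= y + b ->
  cmod (rect x y a b) <= 2 * e * (a + b) ^+ 2.
Proof.
move=> e0; have [l /hasDP hl] := fh z; have [d d0 hd] := hl _ e0.
exists d => // x y a b a0 b0 abd /andP[xz zx] /andP[yz zy].
pose A w := f z - l * z + l * w.
pose B (w : C) := (f z - l * z) * w + l / 2 * (w * w).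
have dB w : hasD B w (A w).
  have h := hasDD (hasDZ (f z - l * z) (hasD_id w)) (hasDZ (l / 2) (hasDM (hasD_id w) (hasD_id w))).
  apply: (hasD_eq h) => [v|]; first exact: erefl.
  by rewrite /A mulr1 mul1r; field.
have small s t : x <= s <= x + a -> y <= t <= y + b ->
    cmod (f (s +i* t) - A (s +i* t)) <= e * (a + b).
  move=> /andP[xs sx] /andP[yt ty].
  pose h := (s +i* t) - z.
  have hab : cmod h <= a + b.
    apply: le_trans (cmod_le _) _; rewrite /h !cE /= lerD // ler_norml; apply/andP; split; lra.
  have -> : f (s +i* t) - A (s +i* t) = f (z + h) - f z - l * h.
    by rewrite /A /h (addrC z) subrK; ring.
  apply: le_trans (hd _ _) _; first exact: le_lt_trans abd.
  by rewrite ler_wpM2l // ltW.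
have hor t : y <= t <= y + b ->
    cmod (H t (x + a) - H t x - (B ((x + a) +i* t) - B (x +i* t))) <= e * (a + b) * a.
  move=> ht.
  have -> : H t (x + a) - H t x - (B ((x + a) +i* t) - B (x +i* t)) =
     (H t (x + a) - B ((x + a) +i* t)) - (H t x - B (x +i* t)) by ring.
  have ax : a = x + a - x by ring.
  rewrite [X in _ <= _ * X]ax.
  apply: (@mean_value_ineq _ (fun s => H t s - B (s +i* t)) (fun s => f (s +i* t) - A (s +i* t))).
  - lra.
  - by move=> s _; apply: pderivB => //; apply: pderiv_horizontal.
  - by move=> s hs; apply: small.
have ver s : x <= s <= x + a ->
    cmod ('i * (V s (y + b) - V s y) - (B (s +i* (y + b)) - B (s +i* y))) <= e * (a + b) * b.
  move=> hs.
  have -> : 'i * (V s (y + b) - V s y) - (B (s +i* (y + b)) - B (s +i* y)) =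
     ('i * V s (y + b) - B (s +i* (y + b))) - ('i * V s y - B (s +i* y)) by ring.
  have ax : b = y + b - y by ring.
  rewrite [X in _ <= _ * X]ax.
  apply: (@mean_value_ineq _ (fun t => 'i * V s t - B (s +i* t)) (fun t => (f (s +i* t) - A (s +i* t)) * 'i)).
  - lra.
  - move=> t _; apply: pderiv_eq (pderivB (pderivZ 'i (dV s t)) (pderiv_vertical (dB _))) _ _ => //.
    by ring.
  - by move=> t ht; rewrite cmodM cmodi mulr1; apply: small.
have h1 : cmod (H y (x + a) - H y x - (B ((x + a) +i* y) - B (x +i* y))) <= e * (a + b) * a.
  by apply: hor; lra.
have h2 : cmod (H (y + b) (x + a) - H (y + b) x - (B ((x + a) +i* (y + b)) - B (x +i* (y + b)))) <= e * (a + b) * a.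
  by apply: hor; lra.
have h3 : cmod ('i * (V x (y + b) - V x y) - (B (x +i* (y + b)) - B (x +i* y))) <= e * (a + b) * b.
  by apply: ver; lra.
have h4 : cmod ('i * (V (x + a) (y + b) - V (x + a) y) - (B ((x + a) +i* (y + b)) - B ((x + a) +i* y))) <= e * (a + b) * b.
  by apply: ver; lra.
move: h1 h2 h3 h4.
set X1 := (X in cmod X <= _ -> _); set X2 := (X in _ -> cmod X <= _ -> _).
set X3 := (X in _ -> _ -> cmod X <= _ -> _); set X4 := (X in _ -> _ -> _ -> cmod X <= _ -> _).
have -> : rect x y a b = (X1 + X4) - (X2 + X3).
  by rewrite /rect /X1 /X2 /X3 /X4; ring.
have := cmodB (X1 + X4) (X2 + X3); have := cmodD X1 X4; have := cmodD X2 X3.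
clear; move: (cmod X1) (cmod X2) (cmod X3) (cmod X4) (cmod (X1 + X4)) (cmod (X2 + X3)) (cmod (X1 + X4 - (X2 + X3))).
by move=> r1 r2 r3 r4 r5 r6 r7 *; nra.
Qed.

Lemma goursat x y a b : 0 <= a -> 0 <= b ->
  (H y (x + a) - H y x) + 'i * (V (x + a) (y + b) - V (x + a) y) =
  (H (y + b) (x + a) - H (y + b) x) + 'i * (V x (y + b) - V x y).
Proof.
move=> a0 b0.
suff h0 : rect x y a b = 0.
  by apply/eqP; rewrite -subr_eq0 opprD addrA; apply/eqP; exact: h0.
pose sz (c : R) n := c / 2 ^+ n.
have sz0 c n : 0 <= c -> 0 <= sz c n by move=> c0; rewrite /sz divr_ge0 // exprn_ge0.
have szS c n : sz c n / 2 = sz c n.+1.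
  by rewrite /sz exprS invfM mulrA [LHS]mulrAC.
have /choice[g hg] : forall u : nat * (R * R), exists p : bool * bool,
  cmod (rect u.2.1 u.2.2 (sz a u.1) (sz b u.1)) / 4 <=
  cmod (rect (u.2.1 + (sz a u.1.+1) *+ p.1) (u.2.2 + (sz b u.1.+1) *+ p.2) (sz a u.1.+1) (sz b u.1.+1)).
  move=> [n [s t]] /=; rewrite -!szS; exact: rect_quarter.
pose step n (p : R * R) := (p.1 + sz a n.+1 *+ (g (n, p)).1, p.2 + sz b n.+1 *+ (g (n, p)).2).
pose u := fix u n := if n is m.+1 then step m (u m) else (x, y).
have big n : cmod (rect x y a b) / 4 ^+ n <= cmod (rect (u n).1 (u n).2 (sz a n) (sz b n)).
  elim: n => [|n IH]; first by rewrite expr0 /sz expr0 !divr1.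
  apply: le_trans (hg (n, u n)).
  by rewrite exprSr invfM mulrA ler_pM2r.
(* The corners of the successively chosen quarters bound nested intervals in
   each coordinate. *)
have mono (p : nat -> R) (c : R) : 0 <= c ->
    (forall n, p n.+1 = p n \/ p n.+1 = p n + sz c n.+1) ->
    exists X, forall n, p n <= X <= p n + sz c n.
  move=> c0 hp.
  have inc n k : p n <= p (n + k)%N.
    elim: k => [|k IH]; first by rewrite addn0.
    rewrite addnS; apply: le_trans IH _.
    by have := sz0 c (n + k).+1 c0; case: (hp (n + k)%N) => ->; lra.
  have dec n k : p (n + k)%N + sz c (n + k)%N <= p n + sz c n.
    elim: k => [|k IH]; first by rewrite addn0.
    rewrite addnS; apply: le_trans _ IH.
    have := szS c (n + k)%N; have := sz0 c (n + k).+1 c0; case: (hp (n + k)%N) => ->; lra.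
  have ub n m : p m <= p n + sz c n.
    have [mn|/ltnW nm] := leqP m n.
      by apply: le_trans (inc m (n - m)%N) _; rewrite subnKC // lerDl sz0.
    apply: le_trans _ (dec n (m - n)%N); rewrite subnKC // lerDl sz0 //.
  exists (sup (range p)) => n; apply/andP; split.
    by apply: ub_le_sup; [exists (p 0 + sz c 0) => _ [m _ <-]|exists n].
  by apply: ge_sup => [|_ [m _ <-]]; [exists (p 0); exists 0|].
have [X hX] : exists X, forall n, (u n).1 <= X <= (u n).1 + sz a n.
  apply: mono => // n /=; case: (g _).1; [right|left]; first by rewrite mulr1n.
  by rewrite mulr0n addr0.
have [Y hY] : exists Y, forall n, (u n).2 <= Y <= (u n).2 + sz b n.
  apply: mono => // n /=; case: (g _).2; [right|left]; first by rewrite mulr1n.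
  by rewrite mulr0n addr0.
have bound e : 0 < e -> cmod (rect x y a b) <= 2 * e * (a + b) ^+ 2.
  move=> e0; have [d d0 hd] := rect_small (X +i* Y) e0.
  pose n := Num.bound ((a + b) / d).
  have hn : (a + b) / d < 2 ^+ n.
    have ab0 : 0 <= (a + b) / d by rewrite divr_ge0 ?addr_ge0 // ltW.
    apply: lt_le_trans (archi_boundP ab0) _; rewrite -/n -natrX ler_nat.
    exact/ltnW/ltn_expl.
  have p2 : 0 < (2 : R) ^+ n by rewrite exprn_gt0.
  have := hd (u n).1 (u n).2 (sz a n) (sz b n) (sz0 a n a0) (sz0 b n b0).
  have -> : sz a n + sz b n = (a + b) / 2 ^+ n by rewrite /sz mulrDl.
  move=> /(_ _ (hX n) (hY n)) h.
  have {}h := le_trans (big n) (h _).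
  have : (a + b) / 2 ^+ n < d by rewrite ltr_pdivrMr // mulrC -ltr_pdivrMr.
  move/h; have -> : (4 : R) ^+ n = (2 ^+ n) ^+ 2 by rewrite -exprM mulnC exprM; congr (_ ^+ _); ring.
  by rewrite expr_div_n mulrA ler_pM2r // invr_gt0 exprn_gt0.
apply: cmod0_eq0; apply/eqP; rewrite eq_le cmod_ge0 andbT.
apply/ler_addgt0Pl => e e0; rewrite addr0.
have k0 : 0 < 1 + 2 * (a + b) ^+ 2 by rewrite ltr_pwDl // mulr_ge0 // sqr_ge0.
have /bound/le_trans : 0 < e / (1 + 2 * (a + b) ^+ 2) by rewrite divr_gt0.
apply; set s := (a + b) ^+ 2 in k0 *; set k := 1 + _ in k0 *.
have -> : 2 * (e / k) * s = e * (2 * s / k) by ring.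
by rewrite -{2}(mulr1 e) ler_wpM2l ?(ltW e0) // ler_pdivrMr // mul1r /k; lra.
Qed.

End Rectangles.
End Goursat.

(** * The complex exponential *)

Section Exponential.
Variable R : realType.
Notation C := R[i].

Definition cexp (z : C) : C :=
  (expR (Re z) * cos (Im z)) +i* (expR (Re z) * sin (Im z)).

Lemma cexpD (z w : C) : cexp (z + w) = cexp z * cexp w.
Proof.
by apply: ceqP; rewrite /cexp !cE /= expRD ?cosD ?sinD; ring.
Qed.

Lemma cexp0 : cexp 0 = 1.
Proof. by rewrite /cexp /= expR0 cos0 sin0 mulr1 mulr0. Qed.

Lemma cmod_cexp z : cmod (cexp z) = expR (Re z).
Proof.
rewrite /cmod /cexp /= !exprMn -mulrDr cos2Dsin2 mulr1 sqrtr_sqr ger0_norm // expR_ge0.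
Qed.

Lemma cexpN z : cexp (- z) * cexp z = 1.
Proof. by rewrite -cexpD addNr cexp0. Qed.

Lemma cexp_period x y : cexp (x +i* (y + pi *+ 2)) = cexp (x +i* y).
Proof. by rewrite /cexp /= (periodicn (@cosD2pi R) 1 y) (periodicn (@sinD2pi R) 1 y). Qed.

Lemma rderiv_littleo (f : R -> R) x l : rderiv f x l -> forall e, 0 < e ->
  exists2 d, 0 < d & forall h, `|h| < d -> `|f (x + h) - f x - l * h| <= e * `|h|.
Proof.
move=> /rderivP[g [fg gl gc]] e /gc[d d0 hd]; exists d => // h hh.
by rewrite (fg (x + h)) (addrC x) addrK -mulrBl normrM ler_wpM2r // ltW // hd // addrK.
Qed.

Lemma hasD_cexp z : hasD cexp z (cexp z).
Proof.
have h0 : hasD cexp 0 1.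
  apply/hasDP => e e0.
  have [e' [e'0 e'1 e'9]] : exists e', [/\ 0 < e', e' <= 1 & e' <= e / 9].
    exists (Num.min 1 (e / 9)); rewrite lt_min !ge_min !lexx orbT; split=> //.
    by apply/andP; split; lra.
  have [d1 d10 h1] := rderiv_littleo (is_derive_expR (0 : R)) e'0.
  have [d2 d20 h2] := rderiv_littleo (is_derive_cos (0 : R)) e'0.
  have [d3 d30 h3] := rderiv_littleo (is_derive_sin (0 : R)) e'0.
  exists (Num.min e' (Num.min d1 (Num.min d2 d3))) => [|h].
    by rewrite !lt_min e'0 d10 d20 d30.
  rewrite !lt_min => /and4P[k0 k1 k2 k3]; rewrite add0r cexp0 mul1r.
  set m := cmod h in k0 k1 k2 k3 *.
  have hx : `|Re h| <= m := ler_abs_Re h.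
  have hy : `|Im h| <= m := ler_abs_Im h.
  have {}h1 := h1 _ (le_lt_trans hx k1).
  have {}h2 := h2 _ (le_lt_trans hy k2).
  have {}h3 := h3 _ (le_lt_trans hy k3).
  rewrite !add0r expR0 mul1r in h1; rewrite !add0r cos0 sin0 oppr0 mul0r subr0 in h2.
  rewrite !add0r sin0 cos0 subr0 mul1r in h3.
  set r1 := expR (Re h) - 1 - Re h in h1; set r2 := cos (Im h) - 1 in h2.
  set r3 := sin (Im h) - Im h in h3.
  have -> : cexp h - 1 - h =
      (r1 + r2 + Re h * r2 + r1 * r2) +i* (Re h * Im h + r1 * Im h + r3 * (1 + Re h + r1)).
    by apply: ceqP; rewrite !cE /= /r1 /r2 /r3; ring.
  have m0 : 0 <= m := cmod_ge0 h.
  apply: le_trans (cmod_le _) _ => /=.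
  have b1 : `|r1| <= e' * m by apply: le_trans h1 _; rewrite ler_wpM2l // ltW.
  have b2 : `|r2| <= e' * m by apply: le_trans h2 _; rewrite ler_wpM2l // ltW.
  have b3 : `|r3| <= e' * m by apply: le_trans h3 _; rewrite ler_wpM2l // ltW.
  have b4 : e' * m <= m by rewrite ler_piMl.
  have prod (a b A B : R) : `|a| <= A -> `|b| <= B -> `|a * b| <= A * B.
    by move=> ha hb; rewrite normrM ler_pM.
  have t1 := prod _ _ _ _ hx b2; have t2 := prod _ _ _ _ b1 b2.
  have t3 := prod _ _ _ _ hx hy; have t4 := prod _ _ _ _ b1 hy.
  have t5 : `|r3 * (1 + Re h + r1)| <= (e' * m) * 3.
    apply: prod b3 _; apply: le_trans (ler_normD _ _) _.
    have := ler_normD 1 (Re h); rewrite normr1; lra.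
  have u1 : `|r1 + r2 + Re h * r2 + r1 * r2| <= e' * m + e' * m + m * (e' * m) + (e' * m) * (e' * m).
    apply: le_trans (ler_normD _ _) _; rewrite lerD // (le_trans (ler_normD _ _)) // lerD //.
    by rewrite (le_trans (ler_normD _ _)) // lerD.
  have u2 : `|Re h * Im h + r1 * Im h + r3 * (1 + Re h + r1)| <= m * m + (e' * m) * m + e' * m * 3.
    by apply: le_trans (ler_normD _ _) _; rewrite lerD // (le_trans (ler_normD _ _)) // lerD.
  have mm : m * m <= e' * m by rewrite ler_wpM2r // ltW.
  have v1 : m * (e' * m) <= e' * m by nra.
  have v2 : (e' * m) * (e' * m) <= e' * m by nra.
  have v3 : (e' * m) * m <= e' * m by nra.
  have v4 : 9 * (e' * m) <= e * m by nra.
  lra.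
have h1 : hasD (fun w => w - z) z 1.
  by apply: hasD_eq (hasDB (hasD_id z) (hasD_cst z z)) _ _ => //; rewrite subr0.
have h2 : hasD (fun w => cexp (w - z)) z (1 * 1).
  by apply: hasD_comp h1 _; rewrite subrr.
apply: hasD_eq (hasDZ (cexp z) h2) _ _ => [w|]; last by rewrite !mulr1.
by rewrite -cexpD addrC subrK.
Qed.

Lemma cexp_holo : holo cexp.
Proof. by move=> z; exists (cexp z); exact: hasD_cexp. Qed.

Lemma holo_eq (f g : C -> C) : holo f -> (forall z, f z = g z) -> holo g.
Proof. by move=> + /funext <-. Qed.
Lemma holo_cst (c : C) : holo (fun=> c).
Proof. by move=> z; exists 0; exact: hasD_cst. Qed.
Lemma holo_id : holo (fun z : C => z).
Proof. by move=> z; exists 1; exact: hasD_id. Qed.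
Lemma holoD (f g : C -> C) : holo f -> holo g -> holo (fun z => f z + g z).
Proof. by move=> hf hg z; have [l hl] := hf z; have [k hk] := hg z; eexists; exact: hasDD hl hk. Qed.
Lemma holoM (f g : C -> C) : holo f -> holo g -> holo (fun z => f z * g z).
Proof. by move=> hf hg z; have [l hl] := hf z; have [k hk] := hg z; eexists; exact: hasDM hl hk. Qed.
Lemma holo_comp (f g : C -> C) : holo f -> holo g -> holo (fun z => f (g z)).
Proof. by move=> hf hg z; have [l hl] := hg z; have [k hk] := hf (g z); eexists; exact: hasD_comp hl hk. Qed.
Lemma holoZ c (f : C -> C) : holo f -> holo (fun z => c * f z).
Proof. by move=> hf; apply: holoM => //; exact: holo_cst. Qed.
Lemma holoN (f : C -> C) : holo f -> holo (fun z => - f z).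
Proof. by move=> hf z; have [l hl] := hf z; eexists; exact: hasDN hl. Qed.
Lemma holoB (f g : C -> C) : holo f -> holo g -> holo (fun z => f z - g z).
Proof. by move=> hf hg; apply: holoD => //; exact: holoN. Qed.
Lemma holoX (f : C -> C) n : holo f -> holo (fun z => f z ^+ n).
Proof.
move=> hf; elim: n => [|n IH]; first exact: holo_cst.
by apply: holo_eq (holoM hf IH) _ => z; rewrite exprS.
Qed.

End Exponential.

(** * Mean values over circles and Cauchy's formula *)

Section CircleMean.
Variable R : realType.
Notation C := R[i].

(** The mean of [g] over [[0, 2 pi]], with the integral written as the increment
of an antiderivative. *)
Definition cmean (g : R -> C) : C :=
  let P := xget (fun=> 0) [set P | forall t, pderiv P t (g t)] in
  (P (pi *+ 2) - P 0) / (pi *+ 2)%:C.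

Lemma cmean_eq (g P : R -> C) : (forall t, pderiv P t (g t)) ->
  cmean g = (P (pi *+ 2) - P 0) / (pi *+ 2)%:C.
Proof.
move=> hP; rewrite /cmean; congr (_ / _).
apply: (@pderiv_incr _ _ _ g) => //.
by case: xgetP => [Q _ //|/(_ P)].
Qed.

Lemma pi2_gt0 : 0 < pi *+ 2 :> R.
Proof. by rewrite mulrn_wgt0 // pi_gt0. Qed.

Lemma pi2_neq0 : (pi *+ 2)%:C != 0 :> C.
Proof. by apply/eqP => /(congr1 (@complex.Re R)) /= h; have := pi2_gt0; rewrite h ltxx. Qed.

Lemma cmean_cst c : cmean (fun=> c) = c.
Proof.
rewrite (@cmean_eq _ (fun t => t%:C * c)) => [|t].
  by rewrite mul0r subr0 mulrAC divff ?mul1r // pi2_neq0.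
have := @hasD_pderiv _ id 0 c t 1 (hasD_id _) => h.
by apply: pderiv_eq h _ _ => [s|]; rewrite ?add0r ?mul1r.
Qed.

Lemma cmeanD (f g : R -> C) : (forall t, pcont f t) -> (forall t, pcont g t) ->
  cmean (fun t => f t + g t) = cmean f + cmean g.
Proof.
move=> /antiderivative[P hP] /antiderivative[Q hQ].
rewrite (cmean_eq hP) (cmean_eq hQ) (@cmean_eq _ (fun t => P t + Q t)) => [|t]; first by ring.
exact: pderivD.
Qed.

Lemma cmeanZ c (f : R -> C) : (forall t, pcont f t) ->
  cmean (fun t => c * f t) = c * cmean f.
Proof.
move=> /antiderivative[P hP].
rewrite (cmean_eq hP) (@cmean_eq _ (fun t => c * P t)) => [|t]; first by ring.
exact: pderivZ.
Qed.

Lemma cmean_le (f : R -> C) B : (forall t, pcont f t) ->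
  (forall t, cmod (f t) <= B) -> cmod (cmean f) <= B.
Proof.
move=> /antiderivative[P hP] hB; have p0 := pi2_gt0.
rewrite (cmean_eq hP) cmodM cmodV cmod_real (ger0_norm (ltW p0)) ler_pdivrMr //.
have := @mean_value_ineq _ P f 0 (pi *+ 2) B (ltW p0) (fun t _ => hP t) (fun t _ => hB t).
by rewrite subr0.
Qed.

(** By Goursat the mean of a periodic function over a vertical period does not
depend on the abscissa. *)
Lemma periodic_mean (q : C -> C) L : holo q ->
  (forall x y, q (x +i* (y + pi *+ 2)) = q (x +i* y)) ->
  (forall e : R, 0 < e -> exists s0, forall x y, x <= s0 -> cmod (q (x +i* y) - L) <= e) ->
  forall s, cmean (fun t => q (s +i* t)) = L.
Proof.
move=> qh qp qL s.
have cv x t : pcont (fun u => q (x +i* u)) t by apply/pcont_vertical/holo_ccont.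
have /choice[H dH] : forall y, exists P, forall t, pderiv P t (q (t +i* y)).
  by move=> y; apply: antiderivative => t; apply/pcont_horizontal/holo_ccont.
have /choice[V dV] : forall x, exists P, forall t, pderiv P t (q (x +i* t)).
  by move=> x; apply: antiderivative => t; exact: cv.
have shift s1 : s1 <= s -> cmean (fun t => q (s +i* t)) = cmean (fun t => q (s1 +i* t)).
  move=> ss; rewrite (cmean_eq (dV s)) (cmean_eq (dV s1)); congr (_ / _).
  have a0 : 0 <= s - s1 by rewrite subr_ge0.
  have := goursat qh dH dV s1 0 a0 (ltW pi2_gt0).
  rewrite add0r (addrC s1) subrK.
  have -> : H (pi *+ 2) s - H (pi *+ 2) s1 = H 0 s - H 0 s1.
    apply: (@pderiv_incr _ _ _ (fun t => q (t +i* 0))) => // t.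
    by rewrite -qp add0r.
  move/addrI/(congr1 (fun z => (- 'i) * z)); rewrite !mulrA mulNr.
  by rewrite -expr2 sqr_i opprK !mul1r.
apply/eqP; rewrite -subr_eq0; apply/eqP/cmod0_eq0/eqP; rewrite eq_le cmod_ge0 andbT.
apply/ler_addgt0Pl => e /qL[s0 hs0]; rewrite addr0.
have [s1 s1s s1s0] : exists2 s1, s1 <= s & s1 <= s0.
  by exists (Num.min s s0); rewrite ge_min lexx ?orbT.
rewrite (shift _ s1s) -(cmean_cst (- L)) -cmeanD //; last by move=> t e1 e10; exists 1 => // ? _; rewrite subrr cmod0.
apply: cmean_le => t; last by apply: hs0.
apply: (@pcont_vertical _ (fun z => q z - L)).
by apply: holo_ccont; apply: holoB => //; exact: holo_cst.
Qed.

Definition circ (t : R) : C := cexp (0 +i* t).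

Lemma cmod_circ t : cmod (circ t) = 1.
Proof. by rewrite /circ cmod_cexp /= expR0. Qed.

(** The case [q w = f (a + exp w)] of [periodic_mean]. *)
Lemma mean_value (f : C -> C) a (r : R) : holo f -> 0 < r ->
  cmean (fun t => f (a + r%:C * circ t)) = f a.
Proof.
move=> fh r0.
have rE t : r%:C * circ t = cexp (ln r +i* t).
  have -> : ln r +i* t = (ln r)%:C + (0 +i* t) by apply: ceqP; rewrite !cE /=; ring.
  rewrite cexpD -/(circ t); congr (_ * _).
  by rewrite /cexp /= lnK // cos0 sin0 mulr1 mulr0.
have -> : (fun t => f (a + r%:C * circ t)) = (fun t => (fun w => f (a + cexp w)) (ln r +i* t)).
  by apply/funext => t; rewrite rE.
apply: (@periodic_mean (fun w => f (a + cexp w))) => [|x y|e e0].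
- by apply: holo_comp fh _; apply: holoD; [exact: holo_cst|exact: cexp_holo].
- by rewrite cexp_period.
have [d d0 hd] := holo_ccont a fh e0.
exists (ln (d / 2)) => x y hx; apply/ltW/hd.
have d20 : 0 < d / 2 by lra.
rewrite addrC addKr cmod_cexp /=.
have : expR x <= d / 2 by rewrite -(lnK d20) ler_expR.
lra.
Qed.

(** The integral over the unit circle about [k] in Cauchy's formula for the
derivative. Subtracting [F k] does not change it and keeps the integrand bounded
when the circle shrinks to [k]. *)
Definition cauchy (F : C -> C) (k : C) : C :=
  cmean (fun t => (F (k + circ t) - F k) * circ (- t)).

(** The case [q w = (F (k + exp w) - F k) exp (- w)] of [periodic_mean]. *)
Lemma cauchyE (F : C -> C) k l : holo F -> hasD F k l -> cauchy F k = l.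
Proof.
move=> Fh Fl.
have -> : cauchy F k = cmean (fun t => (fun w => (F (k + cexp w) - F k) * cexp (- w)) (0 +i* t)).
  rewrite /cauchy; congr cmean; apply/funext => t; congr (_ * cexp _).
  by apply: ceqP; rewrite !cE /= ?oppr0.
apply: (@periodic_mean (fun w => (F (k + cexp w) - F k) * cexp (- w))) => [|x y|e e0].
- apply: holoM; last by apply: holo_comp; [exact: cexp_holo|apply: holoN; exact: holo_id].
  apply: holoB; last exact: holo_cst.
  by apply: holo_comp => //; apply: holoD; [exact: holo_cst|exact: cexp_holo].
- rewrite cexp_period; congr (_ * _).
  have e1 : - (x +i* (y + pi *+ 2)) = (- x) +i* (- y - pi *+ 2) by apply: ceqP; rewrite !cE /=; ring.
  have e2 : - (x +i* y) = (- x) +i* (- y - pi *+ 2 + pi *+ 2) by apply: ceqP; rewrite !cE /=; ring.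
  by rewrite e1 e2 cexp_period.
move/hasDP: Fl => /(_ _ e0)[d d0 hd].
have d20 : 0 < d / 2 by lra.
exists (ln (d / 2)) => x y hx; set h := cexp (x +i* y).
have hm : cmod h = expR x by rewrite cmod_cexp.
have hd' : cmod h < d.
  rewrite hm; have : expR x <= d / 2 by rewrite -(lnK d20) ler_expR.
  lra.
have -> : (F (k + h) - F k) * cexp (- (x +i* y)) - l =
    cexp (- (x +i* y)) * (F (k + h) - F k - l * h).
  have := cexpN (x +i* y); rewrite -/h => hh.
  by rewrite -[X in _ - X]mulr1 -hh; ring.
rewrite cmodM; have := hd _ hd'.
have : cmod (cexp (- (x +i* y))) * cmod h = 1 by rewrite -cmodM cexpN cmod1.
have := cmod_ge0 (cexp (- (x +i* y))).
move: (cmod (cexp _)) (cmod h) (cmod (_ - _)) => p m n p0 pm nm.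
have : p * n <= p * (e * m) by rewrite ler_wpM2l.
have -> : p * (e * m) = e * (p * m) by ring.
by rewrite pm mulr1.
Qed.

Lemma pcont_cauchy (F : C -> C) k : (forall z, ccont F z) -> forall t,
  pcont (fun t => (F (k + circ t) - F k) * circ (- t)) t.
Proof.
move=> Fc t.
apply: (pcont_eq (P := fun t => (fun w => (F (k + cexp w) - F k) * cexp (- w)) (0 +i* t))).
  apply: (@pcont_vertical _ (fun w => (F (k + cexp w) - F k) * cexp (- w))).
  apply: ccontM.
    apply: ccontD; last exact: ccont_cst.
    apply: ccont_comp (Fc _).
    by apply: ccontD; [exact: ccont_cst|exact: holo_ccont (@cexp_holo R)].
  by apply/holo_ccont/holo_comp; [exact: cexp_holo|apply: holoN; exact: holo_id].
move=> s; congr (_ * cexp _).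
by apply: ceqP; rewrite !cE /= ?oppr0.
Qed.

Lemma cauchyD F G k : (forall z, ccont F z) -> (forall z, ccont G z) ->
  cauchy (fun z => F z + G z) k = cauchy F k + cauchy G k.
Proof.
move=> Fc Gc; rewrite /cauchy -cmeanD; [|exact: pcont_cauchy|exact: pcont_cauchy].
by congr cmean; apply/funext => t; ring.
Qed.

Lemma cauchyZ c F k : (forall z, ccont F z) ->
  cauchy (fun z => c * F z) k = c * cauchy F k.
Proof.
move=> Fc; rewrite /cauchy -cmeanZ; [|exact: pcont_cauchy].
by congr cmean; apply/funext => t; ring.
Qed.

Lemma cauchyB F G k : (forall z, ccont F z) -> (forall z, ccont G z) ->
  cauchy (fun z => F z - G z) k = cauchy F k - cauchy G k.
Proof.
move=> Fc Gc; have E : (fun z => F z - G z) = (fun z => F z + (-1) * G z).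
  by apply/funext => z; rewrite mulN1r.
rewrite E cauchyD ?cauchyZ ?mulN1r // => z.
by apply: ccontM => //; exact: ccont_cst.
Qed.

Lemma cauchy_le F k B : (forall z, ccont F z) ->
  (forall z, cmod (z - k) <= 1 -> cmod (F z) <= B) -> cmod (cauchy F k) <= 2 * B.
Proof.
move=> Fc FB; apply: cmean_le; first exact: pcont_cauchy.
move=> t; rewrite cmodM cmod_circ mulr1.
apply: le_trans (cmodB _ _) _.
have := FB (k + circ t); have := FB k; rewrite subrr cmod0 ler01 => /(_ isT) h1.
rewrite (addrC k) addrK cmod_circ lexx => /(_ isT); lra.
Qed.

Definition deriv (f : C -> C) (z : C) : C := xget 0 [set l | hasD f z l].

Lemma derivP f z : holo f -> hasD f z (deriv f z).
Proof. by move=> /(_ z)[l hl]; rewrite /deriv; case: xgetP => [k _ //|/(_ l)]. Qed.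

Lemma deriv_eq f z l : hasD f z l -> deriv f z = l.
Proof.
move=> h; apply: (hasD_unique _ h); rewrite /deriv.
by case: xgetP => [k _ //|/(_ l)].
Qed.

Lemma cauchy_estimate f k B : holo f ->
  (forall z, cmod (z - k) <= 1 -> cmod (f z) <= B) -> cmod (deriv f k) <= 2 * B.
Proof.
move=> fh fB; rewrite -(cauchyE fh (derivP k fh)); apply: cauchy_le => // z.
exact: holo_ccont.
Qed.

End CircleMean.

(** * Holomorphy of derivatives and mixed derivatives *)

Section MixedDerivatives.
Variable R : realType.
Notation C := R[i].

Lemma deriv_lipschitz (f : C -> C) z w B : holo f ->
  (forall t : R, 0 <= t <= 1 -> cmod (deriv f (z + t%:C * (w - z))) <= B) ->
  cmod (f w - f z) <= B * cmod (w - z).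
Proof.
move=> fh fB.
have := @mean_value_ineq _ (fun t => f (z + t%:C * (w - z)))
  (fun t => deriv f (z + t%:C * (w - z)) * (w - z)) 0 1 (B * cmod (w - z)) ler01.
have -> : z + 1%:C * (w - z) = w by have -> : 1%:C = 1 :> C by []; ring.
have -> : z + 0%:C * (w - z) = z by have -> : 0%:C = 0 :> C by []; ring.
rewrite subr0 mulr1; apply.
- by move=> t _; apply/hasD_pderiv/derivP.
- by move=> t /fB h; rewrite cmodM ler_wpM2r // cmod_ge0.
Qed.

Lemma deriv_littleo (f : C -> C) z h K : holo f ->
  (forall t : R, 0 <= t <= 1 -> cmod (deriv f (z + t%:C * h) - deriv f z) <= K) ->
  cmod (f (z + h) - f z - deriv f z * h) <= K * cmod h.
Proof.
move=> fh fK.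
have gh : holo (fun w => f w - deriv f z * w) by apply: holoB => //; apply: holoZ; exact: holo_id.
have dg w : deriv (fun w => f w - deriv f z * w) w = deriv f w - deriv f z.
  apply: deriv_eq; apply: hasD_eq (hasDB (derivP w fh) (hasDZ (deriv f z) (hasD_id w))) _ _ => //.
  by rewrite mulr1.
have := @deriv_lipschitz _ z (z + h) K gh.
have -> : z + h - z = h by ring.
have -> : f (z + h) - deriv f z * (z + h) - (f z - deriv f z * z) =
   f (z + h) - f z - deriv f z * h by ring.
by apply => t ht; rewrite dg; exact: fK.
Qed.

Definition lbounded (f : C -> C) := forall r : R, exists B,
  forall z, cmod z <= r -> cmod (f z) <= B.

Definition biholo (Phi : C -> C -> C) := [/\ forall k, holo (Phi^~ k),
  forall z, holo (Phi z) & forall r : R, exists2 B, 0 <= B & forall z k,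
    cmod z <= r -> cmod k <= r -> cmod (Phi z k) <= B].

Lemma biholoC Phi : biholo Phi -> biholo (fun z k => Phi k z).
Proof.
move=> [h1 h2 h3]; split => // r; have [B B0 hB] := h3 r.
by exists B => // z k hz hk; exact: hB.
Qed.

Definition D1 (Phi : C -> C -> C) z k := deriv (Phi^~ k) z.
Definition D2 (Phi : C -> C -> C) z k := deriv (Phi z) k.

Lemma D1_bound Phi : biholo Phi -> forall r : R, exists2 B, 0 <= B & forall z k,
  cmod z <= r -> cmod k <= r -> cmod (D1 Phi z k) <= B.
Proof.
move=> [h1 h2 h3] r; have [B B0 hB] := h3 (r + 1).
exists (2 * B) => [|z k hz hk]; first by rewrite mulr_ge0.
apply: cauchy_estimate => // w hw; apply: hB; last by lra.
by have := cmodD (w - z) z; rewrite subrK; lra.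
Qed.

Lemma cmod_segment (z w : C) (r t : R) : cmod z <= r -> cmod w <= r -> 0 <= t <= 1 ->
  cmod (z + t%:C * (w - z)) <= r.
Proof.
move=> hz hw /andP[t0 t1].
have -> : z + t%:C * (w - z) = (1 - t)%:C * z + t%:C * w by rewrite rmorphB /=; ring.
apply: le_trans (cmodD _ _) _; rewrite !cmodM !cmod_real !ger0_norm; [|lra|lra]. nra.
Qed.

Lemma Phi_lipschitz1 Phi : biholo Phi -> forall r : R, exists2 B, 0 <= B & forall z w k,
  cmod z <= r -> cmod w <= r -> cmod k <= r -> cmod (Phi w k - Phi z k) <= B * cmod (w - z).
Proof.
move=> bP r; have [B B0 hB] := D1_bound bP r; exists B => // z w k hz hw hk.
apply: (@deriv_lipschitz (Phi^~ k)) => [|t ht]; first by case: bP.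
by apply: hB => //; exact: cmod_segment.
Qed.

Lemma D1_lipschitz2 Phi : biholo Phi -> forall r : R, exists2 B, 0 <= B & forall z k k',
  cmod z <= r -> cmod k <= r -> cmod k' <= r ->
  cmod (D1 Phi z k' - D1 Phi z k) <= B * cmod (k' - k).
Proof.
move=> bP r; have [B B0 hB] := Phi_lipschitz1 (biholoC bP) (r + 1).
have [h1 h2 _] := bP.
exists (2 * B) => [|z k k' hz hk hk']; first by rewrite mulr_ge0.
rewrite /D1 -(cauchyE (h1 k') (derivP z (h1 k'))) -(cauchyE (h1 k) (derivP z (h1 k))).
rewrite -cauchyB; [|by move=> w; exact: holo_ccont|by move=> w; exact: holo_ccont].
rewrite -mulrA; apply: cauchy_le => [w|w hw].
  by apply: holo_ccont; exact: holoB.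
apply: hB; [lra|lra|].
by have := cmodD (w - z) z; rewrite subrK; lra.
Qed.

Lemma D1_lipschitz1 Phi : biholo Phi -> forall r : R, exists2 B, 0 <= B & forall z h k,
  cmod z <= r -> cmod h <= r -> cmod k <= r ->
  cmod (D1 Phi (z + h) k - D1 Phi z k) <= B * cmod h.
Proof.
move=> bP r; have [B B0 hB] := Phi_lipschitz1 bP (r + r + 1).
have [h1 h2 _] := bP.
exists (2 * B) => [|z h k hz hh hk]; first by rewrite mulr_ge0.
have r0 : 0 <= r by apply: le_trans hz; exact: cmod_ge0.
have sh : holo (fun w => Phi (w + h) k).
  by apply: (@holo_comp _ (Phi^~ k)) => //; apply: holoD; [exact: holo_id|exact: holo_cst].
have -> : D1 Phi (z + h) k = deriv (fun w => Phi (w + h) k) z.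
  apply/esym/deriv_eq.
  have hd : hasD (fun w => w + h) z 1.
    by apply: hasD_eq (hasDD (hasD_id z) (hasD_cst h z)) _ _ => //; rewrite addr0.
  by apply: hasD_eq (@hasD_comp _ (Phi^~ k) _ _ _ _ hd (derivP _ (h1 k))) _ _ => //; rewrite mulr1.
rewrite /D1 -(cauchyE sh (derivP z sh)) -(cauchyE (h1 k) (derivP z (h1 k))).
rewrite -cauchyB; [|by move=> w; exact: holo_ccont|by move=> w; exact: holo_ccont].
rewrite -mulrA; apply: cauchy_le => [w|w hw].
  by apply: holo_ccont; exact: holoB.
have hw' : cmod w <= r + 1 by have := cmodD (w - z) z; rewrite subrK; lra.
have -> : cmod h = cmod (w + h - w) by rewrite addrC addKr.
apply: hB; [lra| |lra].
by have := cmodD w h; lra.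
Qed.

Lemma Phi_quadratic Phi : biholo Phi -> forall r : R, exists2 B, 0 <= B & forall z h k,
  cmod z <= r -> cmod h <= r -> cmod k <= r ->
  cmod (Phi (z + h) k - Phi z k - D1 Phi z k * h) <= B * cmod h * cmod h.
Proof.
move=> bP r; have [B B0 hB] := D1_lipschitz1 bP r; have [h1 h2 _] := bP.
exists B => // z h k hz hh hk.
apply: (@deriv_littleo (Phi^~ k)) => // t /andP[t0 t1].
have th : cmod (t%:C * h) <= cmod h.
  by rewrite cmodM cmod_real ger0_norm // ler_piMl // cmod_ge0.
apply: le_trans (hB z (t%:C * h) k hz _ hk) _; first lra.
by rewrite ler_wpM2l.
Qed.

Lemma D1_ccont2 Phi z k : biholo Phi -> ccont (D1 Phi z) k.
Proof.
move=> bP e e0; pose r := cmod z + cmod k + 1.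
have [B B0 hB] := D1_lipschitz2 bP r.
have z0 := cmod_ge0 z; have k0 := cmod_ge0 k.
exists (Num.min 1 (e / (B + 1))) => [|w].
  by rewrite lt_min ltr01 divr_gt0 // ltr_wpDl.
rewrite lt_min => /andP[w1]; rewrite ltr_pdivlMr ?ltr_wpDl // => wB.
have hw : cmod w <= r by have := cmodD (w - k) k; rewrite subrK /r; lra.
apply: le_lt_trans (hB z k w _ _ hw) _; [by rewrite /r; lra|by rewrite /r; lra|].
by have := cmod_ge0 (w - k); nra.
Qed.

(** Writing one partial derivative by Cauchy's formula allows the other one to be
taken under the mean; [Phi_quadratic] controls the error uniformly. *)
Lemma hasD_D2 Phi z k : biholo Phi ->
  hasD (fun z => D2 Phi z k) z (cauchy (D1 Phi z) k).
Proof.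
move=> bP; have [h1 h2 _] := bP; apply/hasDP => e e0.
pose r := cmod z + cmod k + 2.
have z0 := cmod_ge0 z; have k0 := cmod_ge0 k.
have [B B0 hB] := Phi_quadratic bP r.
exists (Num.min 1 (e / (2 * B + 1))) => [|h].
  by rewrite lt_min ltr01 divr_gt0 // ltr_wpDl // mulr_ge0.
rewrite lt_min => /andP[hh1]; rewrite ltr_pdivlMr ?ltr_wpDl ?mulr_ge0 // => hhB.
rewrite /D2 -(cauchyE (h2 (z + h)) (derivP k (h2 (z + h)))) -(cauchyE (h2 z) (derivP k (h2 z))).
have c1 w : ccont (Phi (z + h)) w by exact: holo_ccont.
have c2 w : ccont (Phi z) w by exact: holo_ccont.
have c3 w : ccont (D1 Phi z) w by exact: D1_ccont2.
have c4 w : ccont (fun w => Phi (z + h) w - Phi z w) w by apply/holo_ccont/holoB.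
have c5 w : ccont (fun w => h * D1 Phi z w) w by apply: ccontM => //; exact: ccont_cst.
rewrite -cauchyB // [_ * h]mulrC -cauchyZ // -cauchyB //.
have hh0 := cmod_ge0 h.
have : cmod (cauchy (fun w => Phi (z + h) w - Phi z w - h * D1 Phi z w) k) <= 2 * (B * cmod h * cmod h).
  apply: cauchy_le => [w|w hw].
    have -> : (fun w => Phi (z + h) w - Phi z w - h * D1 Phi z w) =
              (fun w => Phi (z + h) w - Phi z w + (- 1) * (h * D1 Phi z w)).
      by apply/funext => u; rewrite mulN1r.
    by apply: ccontD => //; apply: ccontM => //; exact: ccont_cst.
  rewrite [h * _]mulrC; apply: hB; rewrite /r; [lra|lra|].
  by have := cmodD (w - k) k; rewrite subrK; lra.
move/le_trans; apply.
have -> : 2 * (B * cmod h * cmod h) = (2 * B * cmod h) * cmod h by ring.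
by rewrite ler_wpM2r //; nra.
Qed.

Lemma D2_holo Phi k : biholo Phi -> holo (fun z => D2 Phi z k).
Proof. by move=> bP z; eexists; exact: hasD_D2. Qed.

Lemma mixed_derivatives Phi z k : biholo Phi ->
  hasD (fun z => D2 Phi z k) z (deriv (D1 Phi z) k).
Proof.
move=> bP; have dh : holo (D1 Phi z) by exact: (D2_holo z (biholoC bP)).
by rewrite -(cauchyE dh (derivP k dh)); exact: hasD_D2.
Qed.

(** The case [Phi z k = f (z + k)] of [D2_holo]. *)
Lemma deriv_holo f : holo f -> lbounded f -> holo (deriv f).
Proof.
move=> fh fb; pose Phi z k := f (z + k).
have sh a : holo (fun k => f (a + k)).
  by apply: holo_comp => //; apply: holoD; [exact: holo_cst|exact: holo_id].
have bP : biholo Phi.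
  split=> [k|z|r].
  - apply: holo_eq (sh k) _ => z; by rewrite addrC.
  - exact: sh.
  have [B hB] := fb (r + r); exists (Num.max 0 B) => [|z k hz hk].
    by rewrite le_max lexx.
  rewrite le_max hB ?orbT //; have := cmodD z k; lra.
apply: holo_eq (D2_holo 0 bP) _ => z; apply: deriv_eq.
have hd : hasD (fun k => z + k) 0 1.
  by apply: hasD_eq (hasDD (hasD_cst z 0) (hasD_id 0)) _ _ => //; rewrite add0r.
have := @hasD_comp _ f _ 0 (deriv f z) 1 hd.
by rewrite mulr1; apply; rewrite addr0; exact: derivP.
Qed.

End MixedDerivatives.

(** * The maximum principle *)

Section MaximumPrinciple.
Variable R : realType.
Notation C := R[i].

Lemma circE (x y r t : R) : (x +i* y) + r%:C * circ t = (x + r * cos t) +i* (y + r * sin t).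
Proof. by apply: ceqP; rewrite !cE /= expR0; ring. Qed.

Lemma cmod_distr (z w : C) : `|cmod z - cmod w| <= cmod (z - w).
Proof.
have h1 := cmodD (z - w) w; have h2 := cmodD (w - z) z.
rewrite !subrK (cmodBC w z) in h1 h2.
by rewrite ler_norml; apply/andP; split; lra.
Qed.

Lemma ccont_continuous2 (f : C -> C) : (forall z, ccont f z) ->
  continuous (fun p : R * R => cmod (f (p.1 +i* p.2))).
Proof.
move=> fc p; apply/cvgrPdist_lt => e e0.
have [d d0 hd] := fc (p.1 +i* p.2) e e0.
have d20 : 0 < d / 2 by rewrite divr_gt0.
exists (ball p.1 (d / 2), ball p.2 (d / 2)) => [|q [/= q1 q2]].
  by split; exact: nbhsx_ballx.
apply: le_lt_trans (cmod_distr _ _) _; rewrite cmodBC; apply: hd.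
apply: le_lt_trans (cmod_le _) _; rewrite !cE /=.
move: q1 q2; rewrite /ball /= ![`|p.1 - _|]distrC ![`|p.2 - _|]distrC; lra.
Qed.

(** The mean value property only forbids strict interior maxima; adding
[eta * x ^ 2], whose mean over a circle exceeds its central value, excludes the
others. *)
Lemma max_principle (f : C -> C) (S : set (R * R)) B : holo f -> compact S ->
  (forall x y, S (x, y) -> cmod (f (x +i* y)) <= B \/
    exists2 r, 0 < r & forall t, S (x + r * cos t, y + r * sin t)) ->
  forall x y, S (x, y) -> cmod (f (x +i* y)) <= B.
Proof.
move=> fh Sc H x y Sxy.
have S0 : S !=set0 by exists (x, y).
have cx : continuous (fun p : R * R => p.1 ^+ 2).
  by move=> p; apply: (@continuous_comp _ _ _ fst (fun u : R => u ^+ 2)); [exact: cvg_fst|exact: exprn_continuous].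
have [q _ hq] := compact_EVT_max S0 Sc (continuous_subspaceT cx).
suff main eta : 0 < eta -> cmod (f (x +i* y)) <= B + eta * q.1 ^+ 2.
  apply/ler_addgt0Pr => e e0; have q0 := sqr_ge0 q.1.
  have k0 : 0 < q.1 ^+ 2 + 1 by rewrite ltr_wpDl.
  apply: le_trans (main (e / (q.1 ^+ 2 + 1)) _) _; first by rewrite divr_gt0.
  by rewrite lerD2l mulrAC ler_pdivrMr //; nra.
move=> eta0; pose v p : R := cmod (f (p.1 +i* p.2)) + eta * p.1 ^+ 2.
have vc : continuous v.
  move=> p; apply: (@continuousD _ _ _ (fun p : R * R => cmod (f (p.1 +i* p.2))) (fun p => eta * p.1 ^+ 2)).
    by apply: ccont_continuous2 => z; exact: holo_ccont.
  apply: (@continuousM _ _ (cst eta) (fun p : R * R => p.1 ^+ 2)); [exact: cst_continuous|exact: cx].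
have [[a b] /set_mem Sab hm] := compact_EVT_max S0 Sc (continuous_subspaceT vc).
have hS p : S p -> v p <= v (a, b) by move=> Sp; apply: hm; exact: mem_set.
have hfx : cmod (f (x +i* y)) <= v (a, b).
  by apply: le_trans (hS _ Sxy); rewrite /v /= lerDl mulr_ge0 ?sqr_ge0 // ltW.
have ha : a ^+ 2 <= q.1 ^+ 2 by have := hq (a, b) (mem_set Sab).
case: (H a b Sab) => [hB|[r r0 hr]].
  by apply: le_trans hfx _; rewrite /v /= lerD // ler_wpM2l // ltW.
exfalso; set z := a +i* b in hfx *.
have [c c1 cz] := rotation_exists (f z).
pose g t := c * f (z + r%:C * circ t).
have gc t : pcont g t.
  apply: (@pcontZ _ c (fun t => f (z + r%:C * circ t))).
  apply: (@pcont_vertical _ (fun w => f (z + r%:C * cexp w))).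
  apply: holo_ccont; apply: holo_comp => //; apply: holoD; first exact: holo_cst.
  by apply: holoZ; exact: cexp_holo.
have [P hP] := antiderivative gc.
have gm : cmean g = (cmod (f z))%:C.
  rewrite /g cmeanZ ?mean_value //.
  move=> t; apply: (@pcont_vertical _ (fun w => f (z + r%:C * cexp w))).
  apply: holo_ccont; apply: holo_comp => //; apply: holoD; first exact: holo_cst.
  by apply: holoZ; exact: cexp_holo.
have PE : Re (P (pi *+ 2)) - Re (P 0) = cmod (f z) * (pi *+ 2).
  move: gm; rewrite (cmean_eq hP) => /(congr1 (fun w => w * (pi *+ 2)%:C)).
  rewrite divfK ?pi2_neq0 // => /(congr1 (@complex.Re R)).
  by rewrite !cE /= => ->; ring.
(* [G] is an antiderivative of the upper bound for the real part of [g] that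
   maximality at the centre provides. *)
pose G t := cmod (f z) * t - eta * (a * r *+ 2 * sin t + r ^+ 2 / 2 * (t + sin t * cos t)).
have dG t : rderiv G t (cmod (f z) - eta * (a * r *+ 2 * cos t + r ^+ 2 * cos t ^+ 2)).
  rewrite /rderiv /G; apply: is_derive_eq.
  rewrite /GRing.scale /=.
  have := cos2Dsin2 t; have : r ^+ 2 / 2 * 2 = r ^+ 2 by rewrite divfK.
  move: (r ^+ 2 / 2) => s <- cs.
  have -> : sin t * - sin t = cos t ^+ 2 - 1 by rewrite -[X in _ - X]cs mulrN expr2; ring.
  by ring.
have : (Re (P (pi *+ 2)) - G (pi *+ 2)) - (Re (P 0) - G 0) <= 0 * (pi *+ 2 - 0).
  apply: (@mvt_le _ (fun t => Re (P t) - G t)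
    (fun t => Re (g t) - (cmod (f z) - eta * (a * r *+ 2 * cos t + r ^+ 2 * cos t ^+ 2)))).
  - exact: ltW (@pi2_gt0 R).
  - move=> t _; have [h _] := pderiv_rderiv (hP t).
    exact: rderivB.
  move=> t _; have := hS _ (hr t); rewrite /v /= -circE -/z.
  have := ler_Re (g t); rewrite /g cmodM c1 mul1r.
  move: (Re _) (cmod (f (z + _))) (cmod (f z)) => u1 u2 u3; nra.
have s2 : sin (pi *+ 2) = 0 :> R by rewrite -(add0r (pi *+ 2)) (periodicn (@sinD2pi R) 1 0) sin0.
rewrite mul0r /G s2 sin0 !(mulr0, mul0r, add0r, addr0, subr0).
have := @pi2_gt0 R; have : 0 < r ^+ 2 by rewrite exprn_gt0.
move: PE; move: (pi *+ 2) (Re _) (Re _) (cmod _) (r ^+ 2) => p u1 u2 u3 r2 E r20 p0.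
have : 0 < eta * (r2 / 2 * p) by rewrite !mulr_gt0.
lra.
Qed.

End MaximumPrinciple.

(** * The Phragmén-Lindelöf principle *)

Section PhragmenLindelof.
Variable R : realType.
Notation C := R[i].

Lemma complex_sqrt_real (X Y : R) : 0 <= Y -> exists x y, [/\ 0 <= x, 0 <= y,
  x ^+ 2 - y ^+ 2 = X & x * y *+ 2 = Y].
Proof.
move=> Y0; pose n := Num.sqrt (X ^+ 2 + Y ^+ 2).
have n2 : n ^+ 2 = X ^+ 2 + Y ^+ 2 by rewrite sqr_sqrtr // addr_ge0 // sqr_ge0.
have n0 : 0 <= n by exact: sqrtr_ge0.
have Y20 := sqr_ge0 Y.
have nX : `|X| <= n.
  by rewrite -(ler_pXn2r (n:=2)) ?nnegrE // n2 real_normK ?num_real // lerDl.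
move: nX; rewrite ler_norml => /andP[nX1 nX2].
have a0 : 0 <= (n + X) / 2 by lra.
have b0 : 0 <= (n - X) / 2 by lra.
exists (Num.sqrt ((n + X) / 2)), (Num.sqrt ((n - X) / 2)); split; rewrite ?sqrtr_ge0 //.
  by rewrite !sqr_sqrtr //; lra.
rewrite -sqrtrM // (_ : (n + X) / 2 * ((n - X) / 2) = (Y / 2) ^+ 2).
  by rewrite sqrtr_sqr ger0_norm; lra.
have -> : (n + X) / 2 * ((n - X) / 2) = (n ^+ 2 - X ^+ 2) / 4 by field.
by rewrite n2; field.
Qed.

Lemma compact_rect (a b c d : R) : compact ([set p | a <= p.1 <= b /\ c <= p.2 <= d] : set (R * R)).
Proof.
have -> : [set p | a <= p.1 <= b /\ c <= p.2 <= d] = (`[a, b] `*` `[c, d]) :> set (R * R).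
  by apply/seteqP; split=> p /=; rewrite !in_itv.
by apply: compact_setX; exact: segment_compact.
Qed.

Lemma compact_triangle (d : R) : compact ([set p | 0 <= p.2 /\ p.2 <= p.1 /\ p.1 <= d] : set (R * R)).
Proof.
have -> : [set p | 0 <= p.2 /\ p.2 <= p.1 /\ p.1 <= d] =
    [set p | 0 <= p.1 <= d /\ 0 <= p.2 <= d] `&` [set p | 0 <= p.1 - p.2] :> set (R * R).
  apply/seteqP; split=> p /=.
    by move=> [h1 [h2 h3]]; rewrite subr_ge0 h1 h2 h3 (le_trans h1 h2) (le_trans h2 h3).
  by rewrite subr_ge0 => -[[/andP[h1 h2] /andP[h3 h4]] h5].
apply: compact_closedI; first exact: compact_rect.
apply: (@closed_comp _ _ (fun p : R * R => p.1 - p.2) [set y | 0 <= y]); last exact: closed_ge.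
by move=> p _; apply: continuousB; [exact: cvg_fst|exact: cvg_snd].
Qed.

(** How the multipliers of the Phragmén-Lindelöf argument are removed at the end. *)
Lemma le_damping (a B m : R) : 0 <= a ->
  (forall d, 0 < d -> a * expR (- (d * m)) <= B) -> a <= B.
Proof.
move=> a0 H; apply/ler_addgt0Pr => e e0.
have k0 : 0 < a * `|m| + 1 by rewrite ltr_wpDl // mulr_ge0.
have d0 : 0 < e / (a * `|m| + 1) by rewrite divr_gt0.
have := H _ d0; set d := e / _ in d0 *.
have dE : d * (a * `|m| + 1) = e by rewrite /d divfK // gt_eqF.
have h1 : 1 - d * m <= expR (- (d * m)) by exact: expR_ge1Dx.
have h2 : a * (1 - d * m) <= a * expR (- (d * m)) by rewrite ler_wpM2l.
have ad : 0 <= a * d by rewrite mulr_ge0 // ltW.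
have h3 : a * d * m <= a * d * `|m| by rewrite ler_wpM2l // ler_norm.
lra.
Qed.

Lemma expR_small (c k rho : R) : 0 < k -> 0 <= c -> c / k <= rho -> c * expR (- rho) <= k.
Proof.
move=> k0 c0 h; have r0 : 0 <= rho by apply: le_trans h; rewrite divr_ge0 // ltW.
rewrite expRN ler_pdivrMr ?expR_gt0 //.
have := expR_ge1Dx rho; rewrite ler_pdivrMr // in h; nra.
Qed.

Lemma abs_cos_le1 (t : R) : - 1 <= cos t <= 1.
Proof. by rewrite cos_geN1 cos_le1. Qed.

Lemma abs_sin_le1 (t : R) : - 1 <= sin t <= 1.
Proof. by rewrite sin_geN1 sin_le1. Qed.

(** On a quadrant the substitution [z = s ^ 2] leaves room for the multiplier
[exp (- d (1 - 2 i) s ^ 3)], which decays faster than [g] can grow. *)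
Lemma phragmen_lindelof_quadrant (g : C -> C) (A K B : R) : holo g -> 0 < B ->
  0 <= A -> 0 <= K ->
  (forall z, cmod (g z) <= K * expR (A * cmod z)) ->
  (forall x, 0 <= x -> cmod (g x%:C) <= B) ->
  (forall y, 0 <= y -> cmod (g (0 +i* y)) <= B) ->
  forall x y, 0 <= x -> 0 <= y -> cmod (g (x +i* y)) <= B.
Proof.
move=> gh B0 A0 K0 gK gx gy X Y X0 Y0.
have [x [y [x0 y0 hX hY]]] := complex_sqrt_real X Y0.
have yx : y <= x by rewrite -(ler_pXn2r (n:=2)) ?nnegrE //; lra.
have sq (s t : R) : (s +i* t) ^+ 2 = (s ^+ 2 - t ^+ 2) +i* (s * t *+ 2).
  by rewrite expr2; apply: ceqP; rewrite !cE /= -?expr2 //; ring.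
have -> : X +i* Y = (x +i* y) ^+ 2 by rewrite sq hX hY.
(* the real part of [(1 - 2 i) (s + i t) ^ 3] *)
pose q (s t : R) := s ^+ 3 + 6 * s ^+ 2 * t - 3 * s * t ^+ 2 - 2 * t ^+ 3.
have qs (s t : R) : 0 <= t -> t <= s -> s ^+ 3 <= q s t.
  move=> t0 ts; have s0 : 0 <= s by lra.
  have st : 0 <= s - t by rewrite subr_ge0.
  have h1 : s * t ^+ 2 <= s ^+ 2 * t by have := mulr_ge0 (mulr_ge0 s0 t0) st; lra.
  have h2 : t ^+ 3 <= s ^+ 2 * t by have := mulr_ge0 (mulr_ge0 t0 st) (addr_ge0 s0 t0); lra.
  have h3 : 0 <= s ^+ 2 * t by rewrite mulr_ge0 // sqr_ge0.
  by rewrite /q; lra.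
apply: (@le_damping _ _ (q x y)); first exact: cmod_ge0.
move=> d d0.
pose G (s : C) := g (s ^+ 2) * cexp (((- d)%:C * (1 -i* 2)) * s ^+ 3).
have Gh : holo G.
  apply: holoM; first by apply: holo_comp => //; apply: holoX; exact: holo_id.
  by apply: holo_comp; [exact: cexp_holo|apply: holoZ; apply: holoX; exact: holo_id].
have Gm (s t : R) : cmod (G (s +i* t)) = cmod (g ((s +i* t) ^+ 2)) * expR (- (d * q s t)).
  rewrite cmodM cmod_cexp; congr (_ * expR _).
  by rewrite exprS sq !cE /= /q; ring.
rewrite -Gm.
(* At distance [rho] the multiplier outweighs [K exp (2 A s ^ 2)]. *)
pose rho := Num.max (Num.max 1 x) (Num.max ((2 * A + 1) / d) (K / B)).
have r1 : 1 <= rho by rewrite /rho !le_max lexx.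
have rx : x <= rho by rewrite /rho !le_max lexx orbT.
have rA : (2 * A + 1) / d <= rho by rewrite /rho !le_max lexx !orbT.
have rK : K / B <= rho by rewrite /rho !le_max lexx !orbT.
apply: (@max_principle _ G [set p | 0 <= p.2 /\ p.2 <= p.1 /\ p.1 <= rho]) => //; first exact: compact_triangle.
move=> s t /= [t0 [ts sr]]; have s0 : 0 <= s by lra.
have q0 : 0 <= q s t by apply: le_trans (qs _ _ t0 ts); rewrite exprn_ge0.
have e1 : expR (- (d * q s t)) <= 1.
  by rewrite -[X in _ <= X]expR0 ler_expR oppr_le0 mulr_ge0 // ltW.
have damp : cmod (g ((s +i* t) ^+ 2)) <= B -> cmod (G (s +i* t)) <= B.
  by rewrite Gm; apply: le_trans; exact: ler_piMr (cmod_ge0 _) e1.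
have [t00|tpos] := leP t 0.
  left; apply: damp; have -> : t = 0 by lra.
  by rewrite sq expr0n /= subr0 mulr0 mul0rn; apply/gx/sqr_ge0.
have [st|st] := leP s t.
  left; apply: damp; have -> : t = s by lra.
  by rewrite sq subrr; apply: gy; rewrite mulrn_wge0 // mulr_ge0.
have [rs|rs] := leP rho s.
  left; have sr' : s = rho by lra.
  rewrite Gm.
  have hz : cmod ((s +i* t) ^+ 2) <= 2 * s ^+ 2.
    rewrite cmodX cmod_sqr /=.
    by have : t ^+ 2 <= s ^+ 2; [rewrite ler_pXn2r ?nnegrE|lra].
  have hg : cmod (g ((s +i* t) ^+ 2)) <= K * expR (2 * A * s ^+ 2).
    apply: le_trans (gK _) _; rewrite ler_wpM2l // ler_expR.
    by rewrite -mulrA mulrCA ler_wpM2l.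
  have hq : expR (- (d * q s t)) <= expR (- (d * s ^+ 3)).
    by rewrite ler_expR lerN2; apply: (ler_wpM2l (ltW d0)); exact: qs.
  apply: le_trans (ler_pM (cmod_ge0 _) (expR_ge0 _) hg hq) _.
  rewrite -(mulrA K) -expRD.
  apply: le_trans (@expR_small K B rho B0 K0 rK).
  rewrite -sr' in rA r1 *; rewrite ler_wpM2l // ler_expR.
  move: rA; rewrite ler_pdivrMr // => rA.
  have h1 : s <= s ^+ 2 by rewrite expr2 ler_peMl.
  have rA' : 0 <= s * d - (2 * A + 1) by rewrite subr_ge0.
  have h2 := mulr_ge0 (sqr_ge0 s) rA'.
  lra.
right; exists (Num.min t (Num.min ((s - t) / 2) (rho - s))) => [|u].
  by rewrite !lt_min tpos divr_gt0 ?subr_gt0.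
set r := Num.min _ _.
have rt : r <= t by rewrite /r ge_min lexx.
have rst : r <= (s - t) / 2 by rewrite /r !ge_min lexx orbT.
have rrs : r <= rho - s by rewrite /r !ge_min lexx !orbT.
have r0 : 0 <= r by rewrite /r !le_min !subr_ge0 t0 sr divr_ge0 // subr_ge0.
have /andP[c1 c2] := abs_cos_le1 u; have /andP[s1 s2] := abs_sin_le1 u.
have := ler_wpM2l r0 c1; have := ler_wpM2l r0 c2.
have := ler_wpM2l r0 s1; have := ler_wpM2l r0 s2.
by rewrite !mulrN1 !mulr1 /= => ? ? ? ?; repeat split; lra.
Qed.

(** A bounded function only needs the multiplier [exp (- d (1 - i) s)]. *)
Lemma phragmen_lindelof_bounded (g : C -> C) (K B : R) : holo g -> 0 < B -> 0 <= K ->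
  (forall x y, 0 <= y -> cmod (g (x +i* y)) <= K) ->
  (forall x, cmod (g x%:C) <= B) ->
  forall x y, 0 <= y -> cmod (g (x +i* y)) <= B.
Proof.
move=> gh B0 K0 gK gx X Y Y0.
have [x [y [x0 y0 hX hY]]] := complex_sqrt_real X Y0.
have sq (s t : R) : (s +i* t) ^+ 2 = (s ^+ 2 - t ^+ 2) +i* (s * t *+ 2).
  by rewrite expr2; apply: ceqP; rewrite !cE /= -?expr2 //; ring.
have -> : X +i* Y = (x +i* y) ^+ 2 by rewrite sq hX hY.
apply: (@le_damping _ _ (x + y)); first exact: cmod_ge0.
move=> d d0.
pose G (s : C) := g (s ^+ 2) * cexp (((- d)%:C * (1 -i* 1)) * s).
have Gh : holo G.
  apply: holoM; first by apply: holo_comp => //; apply: holoX; exact: holo_id.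
  by apply: holo_comp; [exact: cexp_holo|apply: holoZ; exact: holo_id].
have Gm (s t : R) : cmod (G (s +i* t)) = cmod (g ((s +i* t) ^+ 2)) * expR (- (d * (s + t))).
  rewrite cmodM cmod_cexp; congr (_ * expR _).
  by rewrite !cE /=; ring.
rewrite -Gm.
pose rho := Num.max (Num.max x y) (K / B / d).
have rx : x <= rho by rewrite /rho !le_max lexx.
have ry : y <= rho by rewrite /rho !le_max lexx orbT.
have rK : K / B / d <= rho by rewrite /rho !le_max lexx !orbT.
have rK' : K / B <= d * rho by rewrite [d * _]mulrC -ler_pdivrMr.
apply: (@max_principle _ G [set p | 0 <= p.1 <= rho /\ 0 <= p.2 <= rho]) => //; [exact: compact_rect| |by rewrite /= x0 y0].
move=> s t /= [/andP[s0 sr] /andP[t0 tr]].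
have e1 : expR (- (d * (s + t))) <= 1.
  by rewrite -[X in _ <= X]expR0 ler_expR oppr_le0 mulr_ge0 ?addr_ge0 // ltW.
have damp : cmod (g ((s +i* t) ^+ 2)) <= B -> cmod (G (s +i* t)) <= B.
  by rewrite Gm; apply: le_trans; exact: ler_piMr (cmod_ge0 _) e1.
have far : rho <= s + t -> cmod (G (s +i* t)) <= B.
  move=> rst; rewrite Gm; apply: le_trans (@expR_small K B (d * rho) B0 K0 rK').
  apply: ler_pM; [exact: cmod_ge0|exact: expR_ge0| |].
    by rewrite sq; apply: gK; rewrite mulrn_wge0 // mulr_ge0.
  by rewrite ler_expR lerN2 ler_wpM2l // ltW.
have [t00|tpos] := leP t 0.
  left; apply: damp; have -> : t = 0 by lra.
  by rewrite sq expr0n /= subr0 mulr0 mul0rn; apply/gx.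
have [s00|spos] := leP s 0.
  left; apply: damp; have -> : s = 0 by lra.
  by rewrite sq expr0n /= mul0r mul0rn; apply/gx.
have [rs|rs] := leP rho s; first by left; apply: far; lra.
have [rt|rt] := leP rho t; first by left; apply: far; lra.
right; exists (Num.min (Num.min s t) (Num.min (rho - s) (rho - t))) => [|u].
  by rewrite !lt_min tpos spos !subr_gt0 rs.
set r := Num.min _ _.
have r1 : r <= s by rewrite /r !ge_min lexx.
have r2 : r <= t by rewrite /r !ge_min lexx !orbT.
have r3 : r <= rho - s by rewrite /r !ge_min lexx !orbT.
have r4 : r <= rho - t by rewrite /r !ge_min lexx !orbT.
have r0 : 0 <= r by rewrite /r !le_min !subr_ge0 s0 t0 sr.
have /andP[c1 c2] := abs_cos_le1 u; have /andP[s1 s2] := abs_sin_le1 u.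
have := ler_wpM2l r0 c1; have := ler_wpM2l r0 c2.
have := ler_wpM2l r0 s1; have := ler_wpM2l r0 s2.
by rewrite !mulrN1 !mulr1 /= => ? ? ? ?; split; apply/andP; split; lra.
Qed.

Definition exptype (sigma : R) (f : C -> C) := forall e : R, 0 < e ->
  exists2 K, 0 <= K & forall z, cmod (f z) <= K * expR ((sigma + e) * cmod z).

(** Multiplying by [exp (i (sigma + e) z)] turns exponential type into
boundedness, first on the two quadrants and then on the half-plane. *)
Lemma exptype_bound (f : C -> C) (sigma B : R) : 0 <= sigma -> 0 < B -> holo f ->
  exptype sigma f -> (forall x, cmod (f x%:C) <= B) ->
  forall x y, 0 <= y -> cmod (f (x +i* y)) <= B * expR (sigma * y).
Proof.
move=> s0 B0 fh ft fB x y y0.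
suff main e : 0 < e -> cmod (f (x +i* y)) * expR (- (e * y)) <= B * expR (sigma * y).
  exact: le_damping (cmod_ge0 _) main.
move=> e0; have [K K0 hK] := ft e e0.
pose tau := sigma + e; have tau0 : 0 <= tau by rewrite /tau; lra.
pose g z := f z * cexp ((tau%:C * 'i) * z).
have gh : holo g.
  by apply: holoM => //; apply: holo_comp; [exact: cexp_holo|apply: holoZ; exact: holo_id].
have gm (s t : R) : cmod (g (s +i* t)) = cmod (f (s +i* t)) * expR (- (tau * t)).
  by rewrite cmodM cmod_cexp; congr (_ * expR _); rewrite !cE /=; ring.
have gx (s : R) : cmod (g s%:C) <= B by rewrite gm mulr0 oppr0 expR0 mulr1 fB.
have gy (t : R) : 0 <= t -> cmod (g (0 +i* t)) <= K.
  move=> t0; rewrite gm expRN ler_pdivrMr ?expR_gt0 //; apply: le_trans (hK _) _.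
  by rewrite /cmod /= expr0n /= add0r sqrtr_sqr ger0_norm.
have gK z : cmod (g z) <= K * expR ((tau + tau) * cmod z).
  rewrite mulrDl expRD mulrA /g cmodM; apply: ler_pM; rewrite ?cmod_ge0 //.
  rewrite cmod_cexp ler_expR !cE /=.
  have := ler_abs_Im z; rewrite ler_norml => /andP[h _].
  have := ler_wpM2l tau0 h; lra.
have tt0 : 0 <= tau + tau by lra.
pose B' := Num.max B K.
have B'0 : 0 < B' by rewrite lt_max B0.
have BB : B <= B' by rewrite le_max lexx.
have KB : K <= B' by rewrite le_max lexx orbT.
have Q1 : forall s t, 0 <= s -> 0 <= t -> cmod (g (s +i* t)) <= B'.
  apply: (@phragmen_lindelof_quadrant g (tau + tau) K) => // [s _|t t0].
    exact: le_trans (gx s) BB.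
  exact: le_trans (gy _ t0) KB.
have Q2 : forall s t, 0 <= s -> 0 <= t -> cmod (g ('i * (s +i* t))) <= B'.
  apply: (@phragmen_lindelof_quadrant (fun z => g ('i * z)) (tau + tau) K) => //.
  - by apply: holo_comp => //; apply: holoZ; exact: holo_id.
  - by move=> z; apply: le_trans (gK _) _; rewrite cmodM cmodi mul1r.
  - move=> s s0'; have -> : 'i * s%:C = 0 +i* s by apply: ceqP; rewrite !cE /=; ring.
    exact: le_trans (gy _ s0') KB.
  - move=> t t0; have -> : 'i * (0 +i* t) = (- t)%:C by apply: ceqP; rewrite !cE /=; ring.
    exact: le_trans (gx _) BB.
have U : forall s t, 0 <= t -> cmod (g (s +i* t)) <= B'.
  move=> s t t0; have [s1|/ltW s1] := leP 0 s; first exact: Q1.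
  have -> : s +i* t = 'i * (t +i* (- s)) by apply: ceqP; rewrite !cE /=; ring.
  by apply: Q2 => //; rewrite oppr_ge0.
have := phragmen_lindelof_bounded gh B0 (ltW B'0) U gx x y0.
rewrite gm /tau mulrDl opprD expRD mulrCA => h.
rewrite -ler_pdivrMr ?expR_gt0 // -expRN mulrC; exact: h.
Qed.

End PhragmenLindelof.

(** * The Bernstein-Szegő inequality *)

Section Chebyshev.
Variable R : realType.
Notation C := R[i].

Lemma cmod_nat n : cmod (n%:R : C) = n%:R.
Proof. by rewrite -(rmorph_nat (real_complex R)) cmod_real normr_nat. Qed.

Lemma rderiv_unique (f : R -> R) x l k : rderiv f x l -> rderiv f x k -> l = k.
Proof. by move=> [_ <-] [_ <-]. Qed.

(** The Chebyshev polynomials of the first kind. *)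
Fixpoint cheb (n : nat) (w : C) : C :=
  if n is m.+1 then if m is k.+1 then 2 * w * cheb m w - cheb k w else w else 1.

Lemma chebSS n w : cheb n.+2 w = 2 * w * cheb n.+1 w - cheb n w.
Proof. by []. Qed.

Lemma nat_ind2 (P : nat -> Prop) : P 0%N -> P 1%N ->
  (forall n, P n -> P n.+1 -> P n.+2) -> forall n, P n.
Proof.
move=> P0 P1 PS n; suff : P n /\ P n.+1 by case.
by elim: n => [//|n [h1 h2]]; split => //; exact: PS.
Qed.

Lemma cheb_joukowski n (J : C) : J != 0 ->
  cheb n ((J + J^-1) / 2) = (J ^+ n + J^-1 ^+ n) / 2.
Proof.
move=> J0; move: n; apply: nat_ind2 => [||n h1 h2].
- by rewrite !expr0 -[X in _ = X / _]/(2%:R) divff // pnatr_eq0.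
- by rewrite !expr1.
rewrite chebSS h1 h2 !exprS.
have e : J * J^-1 = 1 by rewrite divff.
have -> : 2 * ((J + J^-1) / 2) * ((J * J ^+ n + J^-1 * J^-1 ^+ n) / 2) - (J ^+ n + J^-1 ^+ n) / 2
  = (J * (J * J ^+ n) + J^-1 * (J^-1 * J^-1 ^+ n) + (J * J^-1 - 1) * (J ^+ n + J^-1 ^+ n)) / 2.
  by field.
by rewrite e subrr mul0r addr0.
Qed.

Lemma cheb_bound n w : cmod (cheb n w) <= (2 * (1 + cmod w)) ^+ n.
Proof.
have w0 := cmod_ge0 w; move: n; apply: nat_ind2 => [||n h1 h2].
- by rewrite -[cheb 0 w]/(1 : C) cmod1 expr0.
- by rewrite expr1 /=; lra.
rewrite chebSS; apply: le_trans (cmodB _ _) _; rewrite !cmodM.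
rewrite cmod_nat.
rewrite !exprS in h2 *; set p := _ ^+ n in h1 h2 *.
have p0 : 0 <= p by apply: le_trans h1; exact: cmod_ge0.
have h3 : 2 * cmod w * cmod (cheb n.+1 w) <= 2 * cmod w * (2 * (1 + cmod w) * p).
  by rewrite ler_wpM2l // mulr_ge0.
nra.
Qed.

Lemma cheb_real n (x : R) : `|x| <= 1 -> exists2 r : R, cheb n x%:C = r%:C & `|r| <= 1.
Proof.
move=> x1.
have hr : exists r : R, cheb n x%:C = r%:C.
  move: n; apply: nat_ind2 => [||n [r1 h1] [r2 h2]]; [by exists 1|by exists x|].
  exists (2 * x * r2 - r1); rewrite chebSS h1 h2 !rmorphB !rmorphM /=.
  by rewrite rmorph_nat.
have [r rE] := hr; exists r => //; rewrite -cmod_real -rE.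
have xc : cos (acos x) = x by apply: acosK; rewrite in_itv /= -ler_norml.
pose J := circ (acos x).
have cJ : cmod J = 1 by exact: cmod_circ.
have J0 : J != 0 by apply/eqP => h; move: cJ; rewrite h cmod0 => /eqP; rewrite eq_sym oner_eq0.
have JV : J^-1 = circ (- acos x).
  apply: (mulfI J0); rewrite divff // /J /circ -cexpD.
  have -> : (0 +i* acos x) + (0 +i* (- acos x)) = 0 by apply: ceqP; rewrite !cE /=; ring.
  by rewrite cexp0.
have -> : x%:C = (J + J^-1) / 2.
  have n2 : (2 : C) != 0 by rewrite pnatr_eq0.
  apply: (mulIf n2); rewrite divfK // JV; apply: ceqP; rewrite !cE /= expR0 ?cosN ?sinN ?xc; ring.
rewrite cheb_joukowski // cmodM cmodV.
rewrite cmod_nat.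
rewrite ler_pdivrMr // mul1r; apply: le_trans (cmodD _ _) _.
by rewrite !cmodX cmodV cJ invr1 expr1n.
Qed.

(** The unit ball of the real Bernstein space of type [sigma]. *)
Definition bernstein_class (sigma : R) (f : C -> C) :=
  [/\ holo f, exptype sigma f & forall x : R, exists2 r : R, f x%:C = r%:C & `|r| <= 1].

Lemma cheb_class sigma f n : 0 <= sigma -> bernstein_class sigma f ->
  bernstein_class (n%:R * sigma) (fun z => cheb n (f z)).
Proof.
move=> s0 [fh ft fr]; split.
- move: n; apply: nat_ind2 => [||n h1 h2]; [exact: holo_cst|exact: fh|].
  by apply: holo_eq (holoB (holoM (holoZ 2 fh) h2) h1) _.
- move=> e e0; pose e' := e / n.+1%:R.
  have e'0 : 0 < e' by rewrite divr_gt0 // ltr0n.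
  have [K K0 hK] := ft e' e'0.
  exists ((2 * (1 + K)) ^+ n) => [|z]; first by rewrite exprn_ge0 // mulr_ge0 // addr_ge0.
  apply: le_trans (cheb_bound _ _) _.
  have hz := hK z.
  have E1 : 1 <= expR ((sigma + e') * cmod z).
    by rewrite -[X in X <= _]expR0 ler_expR mulr_ge0 ?cmod_ge0 // addr_ge0 // ltW.
  have b1 : 2 * (1 + cmod (f z)) <= 2 * (1 + K) * expR ((sigma + e') * cmod z) by lra.
  apply: le_trans (_ : (2 * (1 + K) * expR ((sigma + e') * cmod z)) ^+ n <= _).
    by rewrite lerXn2r // nnegrE mulr_ge0 ?addr_ge0 ?cmod_ge0 ?expR_ge0 ?mulr_ge0 ?addr_ge0.
  rewrite exprMn -expRM_natl ler_wpM2l ?exprn_ge0 ?mulr_ge0 ?addr_ge0 //.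
  rewrite ler_expR mulrA ler_wpM2r ?cmod_ge0 // mulrDr lerD2l.
  rewrite /e' mulrCA -[X in _ <= X]mulr1 ler_wpM2l ?(ltW e0) //.
  by rewrite ler_pdivrMr ?ltr0n // mul1r ler_nat.
by move=> x; have [r -> r1] := fr x; exact: cheb_real.
Qed.

Lemma bernoulli (a : R) n : 0 <= a -> 1 + n%:R * a <= (1 + a) ^+ n.
Proof.
move=> a0; elim: n => [|n IH]; first by rewrite mul0r addr0 expr0.
rewrite exprS -natr1; have n0 : 0 <= n%:R :> R by [].
have := ler_wpM2l (addr_ge0 ler01 a0) IH; have := mulr_ge0 n0 (mulr_ge0 a0 a0); lra.
Qed.

Lemma le1_bounded_powers (r B : R) : (forall n, r ^+ n <= B) -> r <= 1.
Proof.
move=> h; rewrite leNgt; apply/negP => r1.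
have a0 : 0 < r - 1 by rewrite subr_gt0.
have B0 : 0 <= B by apply: le_trans (h 0%N); rewrite expr0.
pose n := Num.bound (B / (r - 1)).
have := archi_boundP (divr_ge0 B0 (ltW a0)); rewrite -/n ltr_pdivrMr // => hn.
have := bernoulli n (ltW a0); have := h n.
have -> : 1 + (r - 1) = r by ring.
lra.
Qed.

Lemma joukowski_exists (w : C) : exists J : C,
  [/\ J != 0, w = (J + J^-1) / 2 & 1 <= cmod J].
Proof.
have key J : J * (2 * w - J) = 1 -> J != 0 /\ w = (J + J^-1) / 2.
  move=> h; have J0 : J != 0.
    by apply/eqP => J0; move: h; rewrite J0 mul0r => /esym/eqP; rewrite oner_eq0.
  split=> //; have -> : J^-1 = 2 * w - J by apply: (mulfI J0); rewrite divff.
  by field.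
pose s := sqrtc (w ^+ 2 - 1); have s2 : s ^+ 2 = w ^+ 2 - 1 by exact: sqr_sqrtc.
have [h0 hE] : w + s != 0 /\ w = (w + s + (w + s)^-1) / 2.
  apply: key; have -> : (w + s) * (2 * w - (w + s)) = w ^+ 2 - s ^+ 2 by ring.
  by rewrite s2; ring.
have [h1|h1] := leP 1 (cmod (w + s)); first by exists (w + s).
exists (w + s)^-1; split; rewrite ?invr_eq0 //; first by rewrite invrK [X in X / _]addrC.
by rewrite cmodV invf_ge1 ?cmod_gt0 // ltW.
Qed.

(** All the functions [cheb n (f z)] obey the Phragmén-Lindelöf bound; comparing
[n]-th powers bounds the Joukowski preimage [J] of [f z], which confines [f z] to
the ellipse with foci [-1], [1] and semi-axes [cosh (sigma y)], [sinh (sigma y)]. *)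
Lemma bernstein_ellipse sigma f x y : 0 <= sigma -> 0 <= y -> bernstein_class sigma f ->
  let ch := (expR (sigma * y) + expR (- (sigma * y))) / 2 in
  let sh := (expR (sigma * y) - expR (- (sigma * y))) / 2 in
  Im (f (x +i* y)) ^+ 2 * ch ^+ 2 <= sh ^+ 2 * (ch ^+ 2 - Re (f (x +i* y)) ^+ 2).
Proof.
move=> s0 y0 fB; set w := f _.
have [J [J0 wJ J1]] := joukowski_exists w.
set p := expR (sigma * y).
have p1 : 1 <= p by rewrite /p -[X in X <= _]expR0 ler_expR mulr_ge0.
have p0 : 0 < p by lra.
rewrite expRN -/p.
set q := cmod J in J1; have q0 : 0 < q by lra.
have qp : q <= p.
  rewrite -(mul1r p) -ler_pdivrMr //; apply: (@le1_bounded_powers _ 3) => n.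
  rewrite expr_div_n ler_pdivrMr ?exprn_gt0 //.
  have [Th Tt Tr] := cheb_class n s0 fB.
  have Tb (t : R) : cmod (cheb n (f t%:C)) <= 1 by have [r -> r1] := Tr t; rewrite cmod_real.
  have := exptype_bound (mulr_ge0 (ler0n _ n) s0) ltr01 Th Tt Tb x y0.
  rewrite -/w wJ cheb_joukowski // mul1r -mulrA expRM_natl -/p cmodM cmodV.
  rewrite cmod_nat.
  rewrite ler_pdivrMr // => h.
  have := cmodB (J ^+ n + J^-1 ^+ n) (J^-1 ^+ n); rewrite addrK !cmodX cmodV -/q.
  have : q^-1 ^+ n <= 1 by rewrite exprn_ile1 // ?invr_ge0 ?(ltW q0) // invf_le1.
  have : 1 <= p ^+ n by rewrite exprn_ege1.
  lra.
have Jn : q ^+ 2 = Re J ^+ 2 + Im J ^+ 2 by exact: cmod_sqr.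
have qn : q != 0 by rewrite gt_eqF.
have pn : p != 0 by rewrite gt_eqF.
pose c := Re J / q; pose s := Im J / q.
have cs : c ^+ 2 + s ^+ 2 = 1 by rewrite /c /s !expr_div_n -mulrDl -Jn divff // expf_neq0.
have JV : J^-1 = (c / q) +i* (- s / q).
  apply: (mulfI J0); rewrite divff //; apply: ceqP; rewrite !cE /= /c /s.
    have -> : Re J * (Re J / q / q) - Im J * (- (Im J / q) / q) = (Re J ^+ 2 + Im J ^+ 2) / q ^+ 2 by field.
    by rewrite -Jn divff // expf_neq0.
  by field.
have wE : w = (c * ((q + q^-1) / 2)) +i* (s * ((q - q^-1) / 2)).
  have n2 : (2 : C) != 0 by rewrite pnatr_eq0.
  rewrite wJ JV; apply: (mulIf n2); rewrite divfK //.
  by apply: ceqP; rewrite !cE /= /c /s; field.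
clear JV; clearbody c s; rewrite wE /=.
have iq : p^-1 <= q^-1 by rewrite lef_pV2 ?posrE.
have iq1 : q^-1 <= q by apply: (le_trans _ J1); rewrite invf_le1 //.
set A := (q + q^-1) / 2; set B := (q - q^-1) / 2; set ch := (p + p^-1) / 2; set sh := (p - p^-1) / 2.
have eA : ch ^+ 2 = sh ^+ 2 + 1 by rewrite /ch /sh; field.
have eB : A ^+ 2 = B ^+ 2 + 1 by rewrite /A /B; field.
have B0 : 0 <= B by rewrite /B; lra.
have Bsh : B <= sh by rewrite /B /sh; lra.
have B2 : B ^+ 2 <= sh ^+ 2 by rewrite lerXn2r // nnegrE //; lra.
have A2 : A ^+ 2 <= ch ^+ 2 by lra.
have t1 : 0 <= s ^+ 2 * ch ^+ 2 * (sh ^+ 2 - B ^+ 2).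
  by apply: (mulr_ge0 (mulr_ge0 (sqr_ge0 _) (sqr_ge0 _))); rewrite subr_ge0.
have t2 : 0 <= c ^+ 2 * sh ^+ 2 * (ch ^+ 2 - A ^+ 2).
  by apply: (mulr_ge0 (mulr_ge0 (sqr_ge0 _) (sqr_ge0 _))); rewrite subr_ge0.
rewrite -subr_ge0.
have -> : sh ^+ 2 * (ch ^+ 2 - (c * A) ^+ 2) - (s * B) ^+ 2 * ch ^+ 2 =
  s ^+ 2 * ch ^+ 2 * (sh ^+ 2 - B ^+ 2) + c ^+ 2 * sh ^+ 2 * (ch ^+ 2 - A ^+ 2)
  + (1 - (c ^+ 2 + s ^+ 2)) * (sh ^+ 2 * ch ^+ 2) by ring.
by rewrite cs subrr mul0r addr0 addr_ge0.
Qed.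

Lemma holo_rderiv (f : C -> C) (x : R) : holo f ->
  rderiv (fun t => Re (f t%:C)) x (Re (deriv f x%:C)).
Proof.
move=> fh.
have := pderiv_rderiv (@pderiv_horizontal _ f x 0 _ (derivP _ fh)) => -[h _].
by apply: rderiv_eq h _ _ => // t.
Qed.

Lemma class_deriv_real sigma f (x : R) : bernstein_class sigma f -> Im (deriv f x%:C) = 0.
Proof.
move=> [fh _ fr].
have [_ h] := pderiv_rderiv (@pderiv_horizontal _ f x 0 _ (derivP _ fh)).
have h0 : rderiv (fun t => Im (f (t +i* 0))) x 0.
  apply: rderiv_eq (is_derive_cst (0 : R) x 1) _ _ => // t.
  by have [r -> _] := fr t.
exact: rderiv_unique h h0.
Qed.

(** The ellipses collapse onto [[-1, 1]] as [y] goes to [0]; comparing first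
order terms there is the Bernstein-Szegő inequality. *)
Lemma bernstein_szego sigma f (x : R) : 0 <= sigma -> bernstein_class sigma f ->
  Re (deriv f x%:C) ^+ 2 <= sigma ^+ 2 * (1 - Re (f x%:C) ^+ 2).
Proof.
move=> s0 fB; have [fh _ fr] := fB.
pose w y := f (x +i* y).
have [dX dZ] := pderiv_rderiv (@pderiv_vertical _ f x 0 _ (derivP _ fh)).
have fx0 : f (x +i* 0) = f x%:C by [].
have X_cont : {for 0, continuous (fun y => Re (w y))} by exact: rderiv_continuous dX.
have b_eq : Im (deriv f x%:C * 'i) = Re (deriv f x%:C) by rewrite !cE /=; ring.
rewrite [Im _]b_eq in dZ; set b := Re _ in dZ *.
pose ch y := (expR (sigma * y) + expR (- (sigma * y))) / 2.
pose sh y := (expR (sigma * y) - expR (- (sigma * y))) / 2.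
have dlin : rderiv (fun y => sigma * y) 0 (sigma * 1) by apply: rderivZ; exact: is_derive_id.
have dp : rderiv (fun y => expR (sigma * y)) 0 sigma.
  apply: rderiv_eq (is_derive1_comp (is_derive_expR _) dlin) _ _ => //.
  by rewrite mulr0 expR0 mul1r mulr1.
have dn : rderiv (fun y => expR (- (sigma * y))) 0 (- sigma).
  have dl : rderiv (fun y => - (sigma * y)) 0 (- sigma).
    by apply: rderiv_eq (rderivZ (-1) dlin) _ _ => [t|]; rewrite mulN1r // mulr1.
  apply: rderiv_eq (is_derive1_comp (is_derive_expR _) dl) _ _ => //.
  by rewrite mulr0 oppr0 expR0 mul1r.
have dsh : rderiv sh 0 sigma.
  by apply: rderiv_eq (rderivZ (2^-1) (rderivB dp dn)) _ _ => [t|]; [rewrite mulrC|field].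
have dch : rderiv ch 0 0.
  by apply: rderiv_eq (rderivZ (2^-1) (rderivD dp dn)) _ _ => [t|]; [rewrite mulrC|field].
have ch_cont : {for 0, continuous ch} by exact: rderiv_continuous dch.
have /is_derive1_caratheodory[gZ [eZ cZ gZ0]] := dZ.
have /is_derive1_caratheodory[gS [eS cS gS0]] := dsh.
pose h y := gS y ^+ 2 * (ch y ^+ 2 - Re (w y) ^+ 2) - gZ y ^+ 2 * ch y ^+ 2.
have cM (u v : R -> R) : {for 0, continuous u} -> {for 0, continuous v} ->
  {for 0, continuous (fun y => u y * v y)} by move=> cu cv; exact: (@continuousM _ _ u v).
have c2 (u : R -> R) : {for 0, continuous u} -> {for 0, continuous (fun y => u y ^+ 2)}.
  by move=> cu; exact: cM.
have cB (u v : R -> R) : {for 0, continuous u} -> {for 0, continuous v} ->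
  {for 0, continuous (fun y => u y - v y)} by move=> cu cv; exact: (@continuousB _ _ _ u v).
have h_cont : {for 0, continuous h}.
  apply/cB; apply/cM; [exact: c2| |exact: c2|exact: c2].
  by apply/cB; exact: c2.
have hE : h 0 = sigma ^+ 2 * (1 - Re (f x%:C) ^+ 2) - b ^+ 2.
  by rewrite /h gS0 gZ0 /ch mulr0 oppr0 expR0 /w fx0; field.
rewrite -subr_ge0 -hE leNgt; apply/negP => h0.
have hpos y : 0 < y -> 0 <= h y.
  move=> y0; have := bernstein_ellipse x s0 (ltW y0) fB.
  rewrite /= -/(ch y) -/(sh y) -/(w y).
  have -> : Im (w y) = gZ y * y.
    have := eZ y; rewrite subr0 fx0; have [r -> _] := fr x => /= <-.
    by rewrite /w subr0.
  have -> : sh y = gS y * y.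
    by have := eS y; rewrite subr0 => <-; rewrite /sh mulr0 oppr0 expR0 subrr mul0r subr0.
  rewrite /h => hh; have y2 : 0 < y ^+ 2 by rewrite exprn_gt0.
  by rewrite -(pmulr_lge0 _ y2); lra.
move: h_cont => /cvgrPdist_lt /(_ (- h 0)); rewrite oppr_gt0 => /(_ h0) /nbhs_ballP[d /= d0 hd].
have d20 : 0 < d / 2 by lra.
have := hd (d / 2); rewrite /ball /= sub0r normrN ger0_norm ?(ltW d20) // => /(_ ltac:(lra)).
have := hpos _ d20; rewrite ltr_norml => h1 /andP[h2 h3]; lra.
Qed.

End Chebyshev.

(** * Equality in the Bernstein-Szegő inequality *)

Section Equality.
Variable R : realType.
Notation C := R[i].

Lemma exptypeD sigma (f g : C -> C) : exptype sigma f -> exptype sigma g ->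
  exptype sigma (fun z => f z + g z).
Proof.
move=> hf hg e e0; have [K K0 hK] := hf e e0; have [L L0 hL] := hg e e0.
exists (K + L) => [|z]; first exact: addr_ge0.
by rewrite mulrDl; apply: le_trans (cmodD _ _) (lerD (hK z) (hL z)).
Qed.

Lemma exptypeZ sigma c (f : C -> C) : exptype sigma f -> exptype sigma (fun z => c * f z).
Proof.
move=> hf e e0; have [K K0 hK] := hf e e0.
exists (cmod c * K) => [|z]; first by rewrite mulr_ge0 // cmod_ge0.
by rewrite cmodM -mulrA ler_wpM2l ?cmod_ge0.
Qed.

Lemma exptype_lbounded sigma (f : C -> C) : 0 <= sigma -> exptype sigma f -> lbounded f.
Proof.
move=> s0 hf r; have [K K0 hK] := hf 1 ltr01.
exists (K * expR ((sigma + 1) * r)) => z hz; apply: le_trans (hK z) _.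
by rewrite ler_wpM2l // ler_expR ler_wpM2l // addr_ge0.
Qed.

Lemma exptype_deriv sigma (f : C -> C) : 0 <= sigma -> holo f -> exptype sigma f ->
  exptype sigma (deriv f).
Proof.
move=> s0 fh hf e e0; have [K K0 hK] := hf e e0.
exists (2 * (K * expR (sigma + e))) => [|z]; first by rewrite !mulr_ge0 // expR_ge0.
rewrite -mulrA; apply: cauchy_estimate => // w hw; apply: le_trans (hK w) _.
rewrite -mulrA -expRD ler_wpM2l // ler_expR.
have := cmodD (w - z) z; rewrite subrK => h.
have se : 0 <= sigma + e by lra.
have := ler_wpM2l se (le_trans h (lerD hw (lexx _))); lra.
Qed.

Lemma class_deriv (f : C -> C) : bernstein_class 1 f -> bernstein_class 1 (deriv f).
Proof.
move=> fB; have [fh ft fr] := fB; split.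
- by apply: deriv_holo => //; exact: exptype_lbounded ft.
- exact: exptype_deriv.
move=> x; exists (Re (deriv f x%:C)).
  by apply: ceqP => //=; rewrite (class_deriv_real x fB).
have := bernstein_szego x ler01 fB; rewrite expr1n mul1r => h.
have := sqr_ge0 (Re (f x%:C)) => h2.
by rewrite -(ler_pXn2r (n:=2)) ?nnegrE // real_normK ?num_real // expr1n; lra.
Qed.

(** The operators [p + q d/dz] with [p ^ 2 + q ^ 2 = 1], which act on sinusoids
of frequency [1] as translations, preserve the class: this is the Bernstein-Szegő
inequality. *)
Lemma class_rotate (f : C -> C) (p q : R) : p ^+ 2 + q ^+ 2 = 1 -> bernstein_class 1 f ->
  bernstein_class 1 (fun z => p%:C * f z + q%:C * deriv f z).
Proof.
move=> pq fB; have [fh ft fr] := fB; have [dh dt dr] := class_deriv fB; split.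
- by apply: holoD; exact: holoZ.
- by apply: exptypeD; exact: exptypeZ.
move=> x; have [a fx _] := fr x; have [b dx _] := dr x.
exists (p * a + q * b); first by rewrite fx dx -!rmorphM -rmorphD.
have := bernstein_szego x ler01 fB; rewrite fx dx /= expr1n mul1r => h.
rewrite -(ler_pXn2r (n:=2)) ?nnegrE // real_normK ?num_real // expr1n.
have h2 : 0 <= (p * b - q * a) ^+ 2 by exact: sqr_ge0.
have -> : (p * a + q * b) ^+ 2 = (p ^+ 2 + q ^+ 2) * (a ^+ 2 + b ^+ 2) - (p * b - q * a) ^+ 2 by ring.
by rewrite pq mul1r; lra.
Qed.

Lemma rderiv_at_max (g : R -> R) x l : rderiv g x l -> (forall t, exists k, rderiv g t k) ->
  (forall t, g t <= g x) -> l = 0.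
Proof.
move=> gl gd gm; apply: (rderiv_unique gl).
apply: (@derive1_at_max _ g (x - 1) (x + 1)) => //.
- lra.
- by move=> t _; have [k [h _]] := gd t.
- by rewrite in_itv /=; apply/andP; split; lra.
Qed.

Definition Dn (j : nat) (f : C -> C) := iter j (@deriv R) f.

Lemma class_Dn j f : bernstein_class 1 f -> bernstein_class 1 (Dn j f).
Proof. by move=> fB; elim: j => [//|j IH]; exact: class_deriv. Qed.

Lemma Dn_rderiv j f x : bernstein_class 1 f ->
  rderiv (fun t => Re (Dn j f t%:C)) x (Re (Dn j.+1 f x%:C)).
Proof. by move=> fB; have [fh _ _] := class_Dn j fB; exact: holo_rderiv. Qed.

Lemma Dn_rotate j f p q : bernstein_class 1 f ->
  Dn j (fun z => p * f z + q * deriv f z) =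
  (fun z => p * Dn j f z + q * Dn j.+1 f z).
Proof.
move=> fB; elim: j => [//|j IH]; rewrite /Dn iterS -/(Dn j _) IH.
apply/funext => z; apply: deriv_eq; have [h1 _ _] := class_Dn j fB.
have [h2 _ _] := class_Dn j.+1 fB.
by apply: hasDD; apply: hasDZ; exact: derivP.
Qed.

(** If the Bernstein-Szegő inequality is an equality at a non-critical point,
then [f'' = - f] there because [1 - f ^ 2 - f' ^ 2] is minimal; feeding the
operators [p + q d/dz] into this statement propagates it to all orders. *)
Lemma extremal_derivatives j : forall f, bernstein_class 1 f ->
  Re (f 0) ^+ 2 + Re (deriv f 0) ^+ 2 = 1 -> Re (deriv f 0) != 0 ->
  Re (Dn j.+2 f 0) = - Re (Dn j f 0).
Proof.
have Q0 f : bernstein_class 1 f ->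
    Re (f 0) ^+ 2 + Re (deriv f 0) ^+ 2 = 1 -> Re (deriv f 0) != 0 ->
    Re (Dn 2 f 0) = - Re (f 0).
  move=> fB e1 t0.
  pose E x := Re (f x%:C) * Re (f x%:C) + Re (deriv f x%:C) * Re (deriv f x%:C).
  pose dE x := (Re (deriv f x%:C) * Re (f x%:C) + Re (f x%:C) * Re (deriv f x%:C)) +
     (Re (Dn 2 f x%:C) * Re (deriv f x%:C) + Re (deriv f x%:C) * Re (Dn 2 f x%:C)).
  have hE x : rderiv E x (dE x).
    have h1 := Dn_rderiv 0 x fB; have h2 := Dn_rderiv 1 x fB.
    exact: rderivD (rderivM h1 h1) (rderivM h2 h2).
  have : dE 0 = 0.
    apply: (rderiv_at_max (hE 0)) => [t|t]; first by exists (dE t).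
    have := bernstein_szego t ler01 fB; rewrite expr1n mul1r /E -!expr2 => h.
    by rewrite e1; lra.
  rewrite /dE => h0.
  have : Re (deriv f 0) * (Re (Dn 2 f 0) + Re (f 0)) = 0.
    by move: h0; rewrite -[0%:C]/(0 : C); lra.
  by move/eqP; rewrite mulf_eq0 (negbTE t0) /= addr_eq0 => /eqP.
elim: j => [|j IH] f fB e1 t0; first exact: Q0.
have d2 := Q0 f fB e1 t0; set s := Re (f 0) in e1 d2; set t := Re (deriv f 0) in e1 t0.
(* One of the two signs of [q] keeps the new derivative at [0] nonzero. *)
have [q [q0 pq qt]] : exists q : R, [/\ q != 0, (3 / 5) ^+ 2 + q ^+ 2 = 1 & (3 / 5) * t - q * s != 0].
  have n45 : 4 / 5 != 0 :> R by rewrite mulf_neq0 ?invr_neq0 ?pnatr_eq0.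
  have e45 : (3 / 5) ^+ 2 + (4 / 5) ^+ 2 = 1 :> R by field.
  have [h|h] := eqVneq ((3 / 5) * t - (4 / 5) * s) 0; last by exists (4 / 5).
  exists (- (4 / 5)); split; [by rewrite oppr_eq0|by rewrite sqrrN|].
  apply/eqP => h2; move/eqP: t0; lra.
pose g z := (3 / 5 : R)%:C * f z + q%:C * deriv f z.
have gB : bernstein_class 1 g by exact: class_rotate.
have gE k : Re (Dn k g 0) = 3 / 5 * Re (Dn k f 0) + q * Re (Dn k.+1 f 0).
  by rewrite /g Dn_rotate // !cE /=; ring.
have g0 : Re (g 0) = 3 / 5 * s + q * t by exact: (gE 0%N).
have g1 : Re (deriv g 0) = 3 / 5 * t - q * s by rewrite (gE 1%N) -/t d2; ring.
have := IH g gB; rewrite g0 g1 qt => /(_ _ isT) h.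
have {}h : Re (Dn j.+2 g 0) = - Re (Dn j g 0).
  apply: h; have -> : (3 / 5 * s + q * t) ^+ 2 + (3 / 5 * t - q * s) ^+ 2 =
    ((3 / 5) ^+ 2 + q ^+ 2) * (s ^+ 2 + t ^+ 2) by ring.
  by rewrite pq e1 mulr1.
have hf := IH f fB e1 t0.
rewrite !gE hf in h.
by apply: (mulfI q0); lra.
Qed.

(** A function with uniformly bounded derivatives is determined by its Taylor
coefficients at one point: on intervals of length [1/2] the mean value theorem
gains a factor [1/2] per derivative. *)
Lemma flat_zero (d : nat -> R -> R) B : (forall j x, rderiv (d j) x (d j.+1 x)) ->
  (forall j x, `|d j x| <= B) -> (forall j, d j 0 = 0) -> forall j x, d j x = 0.
Proof.
move=> hd hB h0.
have local a : (forall j, d j a = 0) -> forall x, `|x - a| <= 1 / 2 -> forall j, d j x = 0.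
  move=> ha x0 hx0 j0.
  have B0 : 0 <= B by apply: le_trans (hB 0%N 0).
  have est n : forall j x, `|x - a| <= 1 / 2 -> `|d j x| * 2 ^+ n <= B.
    elim: n => [|n IH] j x hx; first by rewrite expr0 mulr1.
    have half u : `|u - a| <= `|x - a| -> `|d j.+1 u| * 2 ^+ n <= B.
      by move=> hu; apply: IH; exact: le_trans hx.
    have p0 : 0 < (2 : R) ^+ n by rewrite exprn_gt0.
    have [c hc ->] : exists2 c, `|c - a| <= `|x - a| & `|d j x| = `|d j.+1 c| * `|x - a|.
      have [ax|/ltW xa] := leP a x.
        have [c /andP[c1 c2] e] := mvt ax (fun u _ => hd j u).
        exists c; first by rewrite !ger0_norm; lra.
        by rewrite -normrM -e ha subr0.
      have [c /andP[c1 c2] e] := mvt xa (fun u _ => hd j u).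
      exists c; first by rewrite !ler0_norm; lra.
      by rewrite -normrM -(opprB a x) mulrN -e ha sub0r !normrN.
    have := half c hc; rewrite exprS => h.
    have : (`|d j.+1 c| * 2 ^+ n) * (2 * `|x - a|) <= B * 1.
      have s1 : 0 <= `|d j.+1 c| * 2 ^+ n by rewrite mulr_ge0 // ltW.
      by apply: ler_pM => //; lra.
    by lra.
  apply/eqP; rewrite -normr_eq0; apply/negP => /negP v0.
  have {}v0 : 0 < `|d j0 x0| by rewrite lt_neqAle eq_sym v0 /=.
  pose n := Num.bound (B / `|d j0 x0|).
  have := archi_boundP (divr_ge0 B0 (ltW v0)); rewrite -/n ltr_pdivrMr // => hn.
  have : (n%:R : R) <= 2 ^+ n by rewrite -natrX ler_nat ltnW // ltn_expl.
  have := est n j0 x0 hx0; nra.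
suff big k : forall x, `|x| <= k%:R / 2 -> forall j, d j x = 0.
  move=> j x; apply: (big (Num.bound (2 * `|x|))).
  have := archi_boundP (_ : 0 <= 2 * `|x|); rewrite mulr_ge0 // => /(_ isT); lra.
elim: k => [|k IH] x hx j.
  have -> : x = 0 by apply/eqP; rewrite -normr_le0; move: hx; rewrite mul0r.
  exact: h0.
have k1 : 0 < (k.+1%:R : R) by rewrite ltr0n.
have kE : (k.+1%:R : R) = k%:R + 1 by rewrite natr1.
have k0 : 0 <= (k%:R : R) by [].
have kn : (k.+1%:R : R) != 0 by rewrite gt_eqF.
apply: (local (x * (k%:R / k.+1%:R))) => [i|].
  apply: IH; rewrite normrM (@ger0_norm _ (k%:R / _)); last by rewrite divr_ge0 // ltW.
  rewrite mulrA ler_pdivrMr //; nra.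
have -> : x - x * (k%:R / k.+1%:R) = x / k.+1%:R.
  have -> : k%:R = k.+1%:R - 1 :> R by rewrite kE addrK.
  by field.
rewrite normrM normfV (ger0_norm (ltW k1)) ler_pdivrMr //; lra.
Qed.

Lemma harmonic_oscillator (M : R) (u v : R -> R) : (forall x, rderiv u x (M * v x)) ->
  (forall x, rderiv v x (- (M * u x))) ->
  forall x, u x = u 0 * cos (M * x) + v 0 * sin (M * x).
Proof.
move=> du dv x.
have dc := @rderiv_cos_linear R M.
have ds := @rderiv_sin_linear R M.
have W1 : u x * cos (M * x) - v x * sin (M * x) = u 0 * cos (M * 0) - v 0 * sin (M * 0).
  apply: (@rderiv0_cst _ (fun y => u y * cos (M * y) - v y * sin (M * y))) => y.
  by apply: rderiv_eq (rderivB (rderivM (du y) (dc y)) (rderivM (dv y) (ds y))) _ _ => //; ring.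
have W2 : u x * sin (M * x) + v x * cos (M * x) = u 0 * sin (M * 0) + v 0 * cos (M * 0).
  apply: (@rderiv0_cst _ (fun y => u y * sin (M * y) + v y * cos (M * y))) => y.
  by apply: rderiv_eq (rderivD (rderivM (du y) (ds y)) (rderivM (dv y) (dc y))) _ _ => //; ring.
move: W1 W2; rewrite mulr0 cos0 sin0 !mulr0 !mulr1 subr0 add0r => <- <-.
rewrite -[LHS]mulr1 -(cos2Dsin2 (M * x)); ring.
Qed.

Lemma extremal_sinusoid1 f : bernstein_class 1 f ->
  Re (f 0) ^+ 2 + Re (deriv f 0) ^+ 2 = 1 -> Re (deriv f 0) != 0 ->
  forall x : R, Re (f x%:C) = Re (f 0) * cos x + Re (deriv f 0) * sin x.
Proof.
move=> fB e1 t0 x.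
have hd j y : rderiv (fun y => Re (Dn j.+2 f y%:C) + Re (Dn j f y%:C)) y
    (Re (Dn j.+3 f y%:C) + Re (Dn j.+1 f y%:C)).
  by apply: rderivD; exact: Dn_rderiv.
have hB j (y : R) : `|Re (Dn j.+2 f y%:C) + Re (Dn j f y%:C)| <= 1 + 1.
  have [_ _ /(_ y)[r -> r1]] := class_Dn j.+2 fB.
  have [_ _ /(_ y)[r' -> r1']] := class_Dn j fB.
  by apply: le_trans (ler_normD _ _) _; rewrite lerD.
have h0 j : Re (Dn j.+2 f 0%:C) + Re (Dn j f 0%:C) = 0.
  by rewrite (extremal_derivatives j fB e1 t0) addNr.
have hz := flat_zero hd hB h0.
have := @harmonic_oscillator 1 (fun y => Re (f y%:C)) (fun y => Re (deriv f y%:C)).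
move=> /(_ _ _ x); rewrite !mul1r; apply=> y.
  by rewrite mul1r; exact: (Dn_rderiv 0 y fB).
have := hz 0%N y => /eqP; rewrite addr_eq0 => /eqP e.
by rewrite mul1r -e; exact: (Dn_rderiv 1 y fB).
Qed.

(** The general type, by rescaling the variable. *)
Lemma extremal_sinusoid (M : R) f : 0 < M -> bernstein_class M f ->
  Re (deriv f 0) ^+ 2 = M ^+ 2 * (1 - Re (f 0) ^+ 2) -> Re (deriv f 0) != 0 ->
  forall x : R, Re (f x%:C) = Re (f 0) * cos (M * x) + Re (deriv f 0) / M * sin (M * x).
Proof.
move=> M0 [fh ft fr] e1 t0 x; have Mn : M != 0 by rewrite gt_eqF.
pose g z := f (M^-1%:C * z).
have lh : holo (fun z : C => M^-1%:C * z) by apply: holoZ; exact: holo_id.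
have gB : bernstein_class 1 g.
  split.
  - exact: holo_comp.
  - move=> e e0; have [K K0 hK] := ft _ (mulr_gt0 e0 M0); exists K => // z.
    apply: le_trans (hK _) _; rewrite ler_wpM2l // ler_expR cmodM cmod_real.
    rewrite ger0_norm ?invr_ge0 ?(ltW M0) // mulrA.
    by have -> : (M + e * M) * M^-1 = 1 + e by field.
  by move=> y; rewrite /g -rmorphM; exact: fr.
have dg : deriv g 0 = deriv f 0 * M^-1%:C.
  apply: deriv_eq; have hl := hasDZ M^-1%:C (hasD_id (0 : C)).
  have := hasD_comp hl (derivP _ fh); rewrite mulr0 mulr1; exact.
have g0 : g 0 = f 0 by rewrite /g mulr0.
have dgr : Re (deriv g 0) = Re (deriv f 0) / M by rewrite dg !cE /=; ring.
have := @extremal_sinusoid1 g gB.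
rewrite g0 dgr expr_div_n e1 mulrAC divff ?expf_neq0 // mul1r addrC subrK => /(_ erefl).
rewrite mulf_neq0 ?invr_neq0 // => /(_ isT (M * x)).
by rewrite {1}/g -rmorphM mulKf.
Qed.

End Equality.

(** * Convex bodies and polarity *)

Section ConvexBodies.
Variables (R : realType) (m : nat).
Implicit Types (x y t : 'rV[R]_m) (V K : set 'rV[R]_m).

Lemma dotC x y : dot x y = dot y x.
Proof. by apply: eq_bigr => j _; rewrite mulrC. Qed.

Lemma dotDr x y t : dot x (y + t) = dot x y + dot x t.
Proof. by rewrite /dot -big_split; apply: eq_bigr => j _; rewrite mxE mulrDr. Qed.

Lemma dotZr a x y : dot x (a *: y) = a * dot x y.
Proof. by rewrite /dot mulr_sumr; apply: eq_bigr => j _; rewrite mxE mulrCA. Qed.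

Lemma dotZl a x y : dot (a *: x) y = a * dot x y.
Proof. by rewrite dotC dotZr dotC. Qed.

Lemma dotDl x y t : dot (x + y) t = dot x t + dot y t.
Proof. by rewrite dotC dotDr !(dotC t). Qed.

Lemma dotNr x y : dot x (- y) = - dot x y.
Proof. by rewrite -scaleN1r dotZr mulN1r. Qed.

Lemma dot0r x : dot x 0 = 0.
Proof. by rewrite -(scale0r 0) dotZr mul0r. Qed.

Lemma dot_delta x j : dot 'e_j x = x 0 j.
Proof.
rewrite /dot (bigD1 j) //= big1 => [|i ij]; first by rewrite mxE !eqxx mul1r addr0.
by rewrite mxE (negbTE ij) andbF mul0r.
Qed.

Lemma dot_sqr_eq0 x : dot x x = 0 -> x = 0.
Proof.
move=> /eqP; rewrite psumr_eq0 => [/allP h|j _]; last by rewrite -expr2 sqr_ge0.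
apply/rowP => j; have := h j (mem_index_enum _); rewrite mulf_eq0 orbb => /eqP ->.
by rewrite mxE.
Qed.

Lemma dot_sqrD x y c :
  dot (x + c *: y) (x + c *: y) = dot x x + 2 * c * dot x y + c ^+ 2 * dot y y.
Proof. by rewrite !dotDr !dotDl !dotZr !dotZl (dotC y x); ring. Qed.

Lemma dot_sqr_ge0 x : 0 <= dot x x.
Proof. by rewrite /dot sumr_ge0 // => j _; rewrite -expr2 sqr_ge0. Qed.

Lemma dot_sqr_gt0 x : x != 0 -> 0 < dot x x.
Proof.
move=> x0; rewrite lt_neqAle dot_sqr_ge0 andbT eq_sym.
by apply: contraNneq x0 => /dot_sqr_eq0 ->.
Qed.

Lemma norm_coord x j : `|x 0 j| <= `|x|.
Proof.
rewrite [leRHS]/Num.Def.normr /= mx_normrE.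
by apply/bigmax_geP; right => /=; exists (0, j).
Qed.

Lemma norm_rV_le x B : 0 <= B -> (forall j, `|x 0 j| <= B) -> `|x| <= B.
Proof.
move=> B0 h; rewrite [leLHS]/Num.Def.normr /= mx_normrE (bigmax_le _ B0) //= => -[i j] _.
by rewrite ord1.
Qed.

Lemma dot_norm_le x y : `|dot x y| <= m%:R * `|x| * `|y|.
Proof.
apply: le_trans (ler_norm_sum _ _ _) _.
apply: le_trans (_ : \sum_(j < m) `|x| * `|y| <= _).
  by apply: ler_sum => j _; rewrite normrM ler_pM // norm_coord.
by rewrite sumr_const card_ord -[X in X <= _]mulr_natl mulrA.
Qed.

Lemma dot_comp_continuous (T : topologicalType) (f g : T -> 'rV[R]_m) :
  continuous f -> continuous g -> continuous (fun p => dot (f p) (g p)).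
Proof.
move=> fc gc; rewrite /dot; elim: (index_enum _) => [|j s IH].
  by under eq_fun do rewrite big_nil; exact: cst_continuous.
under eq_fun do rewrite big_cons.
move=> p; apply: (@continuousD _ _ _ (fun p => f p 0 j * g p 0 j)
  (fun p => \sum_(j <- s) f p 0 j * g p 0 j)); last exact: IH.
apply: (@continuousM _ _ (fun p => f p 0 j) (fun p => g p 0 j)).
  by apply: (@continuous_comp _ _ _ f (fun x : 'rV[R]_m => x 0 j)); [exact: fc|exact: coord_continuous].
by apply: (@continuous_comp _ _ _ g (fun x : 'rV[R]_m => x 0 j)); [exact: gc|exact: coord_continuous].
Qed.

Lemma dot_continuous2 : continuous (fun p : 'rV[R]_m * 'rV[R]_m => dot p.1 p.2).
Proof. by apply: dot_comp_continuous => p; [exact: cvg_fst|exact: cvg_snd]. Qed.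

Lemma dot_continuous x : continuous (fun y : 'rV[R]_m => dot x y).
Proof. by apply: dot_comp_continuous => p; [exact: cst_continuous|exact: cvg_id]. Qed.

Lemma body_convex V x y s : convex_body V -> 0 <= s -> s <= 1 -> V x -> V y ->
  V (s *: x + (1 - s) *: y).
Proof.
by move=> [_ cV _] s0 s1 Vx Vy; have /set_mem := cV x y (Itv01 s0 s1) (mem_set Vx) (mem_set Vy).
Qed.

Lemma interiorP V x : interior V x -> exists2 r : R, 0 < r & forall y, `|y| < r -> V (x + y).
Proof.
move=> /nbhs_ballP[r /= r0 h]; exists r => // y hy; apply: h.
by rewrite -ball_normE /ball_ /= opprD addNKr normrN.
Qed.

Lemma body_ball V : convex_body V -> origin_symmetric V ->
  exists2 r : R, 0 < r & forall x, `|x| < r -> V x.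
Proof.
move=> hV sV; have [_ _ [p /interiorP[r r0 hr]]] := hV; exists r => // x hx.
have h1 : V (p + x) by exact: hr.
have h2 : V (- (p - x)) by apply/sV/hr; rewrite normrN.
have -> : x = 2^-1 *: (p + x) + (1 - 2^-1) *: (- (p - x)).
  have -> : 1 - 2^-1 = 2^-1 :> R by field.
  rewrite -scalerDr opprB [x - p]addrC addrACA subrr add0r.
  by rewrite -[x + x]mulr2n -[x *+ 2]scaler_nat scalerA mulVf ?scale1r // pnatr_eq0.
by apply: body_convex => //; lra.
Qed.

Lemma body0 V : convex_body V -> origin_symmetric V -> V 0.
Proof. by move=> hV sV; have [r r0 h] := body_ball hV sV; apply: h; rewrite normr0. Qed.

Lemma body_bounded V : convex_body V -> exists2 A : R, 0 < A & forall x, V x -> `|x| <= A.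
Proof.
move=> [cV _ _]; have [A [_ hA]] := compact_bounded cV.
exists (`|A| + 1) => [|x Vx]; first by rewrite ltr_wpDl.
by apply: hA => //; rewrite ltr_pwDr // ler_norm.
Qed.

Lemma polarN V y : polar V y -> polar V (- y).
Proof. by move=> h t Vt; rewrite dotNr normrN; exact: h. Qed.

Lemma polar_ball V : convex_body V ->
  exists2 r : R, 0 < r & forall y, `|y| <= r -> polar V y.
Proof.
move=> hV; have [A A0 hA] := body_bounded hV.
have k0 : 0 < m%:R * A + 1 by rewrite ltr_wpDl // mulr_ge0 // ltW.
exists (m%:R * A + 1)^-1; first by rewrite invr_gt0.
move=> y hy t Vt; apply: le_trans (dot_norm_le _ _) _.
have h1 : m%:R * `|t| <= m%:R * A + 1.
  by have := ler_wpM2l (ler0n R m) (hA t Vt); lra.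
apply: le_trans (ler_pM _ _ h1 hy) _ => //.
by rewrite divff // gt_eqF.
Qed.

Lemma polar_closed V : closed (polar V).
Proof.
have -> : polar V = \bigcap_(t in V) [set y | `|dot t y| <= 1].
  by apply/seteqP; split.
apply: closed_bigI => t Vt.
apply: (@closed_comp _ _ (fun y => `|dot t y|) [set r | r <= 1]); last exact: closed_le.
move=> y _; apply: (@continuous_comp _ _ _ (fun y => dot t y) Num.norm); first exact: dot_continuous.
exact: norm_continuous.
Qed.

Lemma polar_compact V : convex_body V -> origin_symmetric V -> compact (polar V).
Proof.
move=> hV sV; have [r r0 hr] := body_ball hV sV.
apply: bounded_closed_compact; last exact: polar_closed.
exists (2 / r); split => [|B hB y py]; first exact: num_real.
have B0 : 0 <= B by apply: le_trans (ltW hB); rewrite divr_ge0 // ltW.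
apply: norm_rV_le => // j.
have Vt : V ((r / 2) *: 'e_j).
  apply: hr; apply: le_lt_trans (_ : r / 2 < r); last by lra.
  apply: norm_rV_le => [|i]; first by rewrite divr_ge0 // ltW.
  rewrite !mxE normrM eqxx /= (ger0_norm (_ : 0 <= r / 2)); last by rewrite divr_ge0 // ltW.
  by case: (i == j); rewrite /= ?normr1 ?mulr1 // normr0 mulr0 divr_ge0 // ltW.
have := py _ Vt; rewrite dotZl.
rewrite dot_delta normrM (ger0_norm (_ : 0 <= r / 2)); last by rewrite divr_ge0 // ltW.
move=> h; apply: le_trans (ltW hB); rewrite ler_pdivlMr //; lra.
Qed.

(** The nontrivial half of the bipolar theorem: a point outside [V] is separated
from [V] by the direction to its nearest point of [V]. *)
Lemma bipolar V p : convex_body V -> origin_symmetric V ->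
  (forall y, polar V y -> `|dot p y| <= 1) -> V p.
Proof.
move=> hV sV hp; apply: contrapT => nVp.
have V0 := body0 hV sV; have [cV _ _] := hV.
have c1 : continuous (fun q : 'rV[R]_m => dot (p - q) (p - q)).
  by apply: dot_comp_continuous => q; apply: continuousB; [exact: cst_continuous|exact: cvg_id|exact: cst_continuous|exact: cvg_id].
have [q /set_mem Vq hq] := EVT_min_rV (ex_intro _ _ V0) cV (continuous_subspaceT c1).
set n := p - q in hq.
have n0 : n != 0 by rewrite subr_eq0; apply/eqP => e; apply: nVp; rewrite e.
have nn := dot_sqr_gt0 n0.
have sep t : V t -> dot n t <= dot n q.
  move=> Vt; rewrite -subr_ge0 -dotNr -dotDr -opprB dotNr oppr_ge0.
  have A0 := dot_sqr_ge0 (t - q).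
  rewrite leNgt; apply/negP => pos.
  have A1 : 0 < dot (t - q) (t - q) + 1 by lra.
  (* A step of this length from [q] towards [t] would come closer to [p]. *)
  have [s [s0 s1 sA]] : exists s, [/\ 0 < s, s <= 1 & s * (dot (t - q) (t - q) + 1) <= dot n (t - q)].
    exists (Num.min 1 (dot n (t - q) / (dot (t - q) (t - q) + 1))); split.
    - by rewrite lt_min ltr01 divr_gt0.
    - by rewrite ge_min lexx.
    - by rewrite -ler_pdivlMr // ge_min lexx orbT.
  have := hq (s *: t + (1 - s) *: q) (mem_set (body_convex hV (ltW s0) s1 Vt Vq)).
  have -> : p - (s *: t + (1 - s) *: q) = n + (- s) *: (t - q).
    by rewrite /n scalerBl scale1r scaleNr scalerBr !opprD !opprK; rewrite -!addrA; congr (_ + _); rewrite addrCA.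
  rewrite dot_sqrD; move: A0 pos s0 s1 sA; move: (dot n n) (dot n _) (dot (t - q) _) s => a b d s.
  nra.
pose c := dot n q + dot n n / 2.
have q0 : 0 <= dot n q by have := sep 0 V0; rewrite dot0r.
have c0 : 0 < c by rewrite /c; lra.
have py : polar V (c^-1 *: n).
  move=> t Vt; rewrite dotZr normrM normfV (gtr0_norm c0) mulrC ler_pdivrMr // mul1r dotC.
  have h1 := sep t Vt; have h2 := sep _ (sV t Vt); rewrite dotNr in h2.
  by rewrite ler_norml /c; apply/andP; split; lra.
have := hp _ py; rewrite dotZr normrM normfV (gtr0_norm c0) mulrC ler_pdivrMr // mul1r dotC.
have -> : dot n p = dot n q + dot n n.
  by rewrite -dotDr; congr (dot _ _); rewrite /n addrC subrK.
by rewrite ger0_norm /c; lra.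
Qed.

Lemma dot_toC x y : dot (toC x) (toC y) = (dot x y)%:C.
Proof.
by rewrite /dot rmorph_sum; apply: eq_bigr => j _; rewrite !mxE -rmorphM.
Qed.

Lemma dot_toC_norm t (z : 'rV[R[i]]_m) A : (forall j, `|t 0 j| <= A) ->
  cmod (dot (toC t) z) <= \sum_j A * cmod (z 0 j).
Proof.
move=> hA; rewrite /dot; elim/big_ind2: _ => [|a1 b1 a2 b2 h1 h2|j _].
- by rewrite cmod0.
- by apply: le_trans (cmodD _ _) _; rewrite lerD.
by rewrite cmodM mxE cmod_real ler_wpM2r ?cmod_ge0.
Qed.

Lemma dnorm_has_sup V z : convex_body V -> V 0 -> has_sup [set cmod (dot (toC t) z) | t in V].
Proof.
move=> hV V0; split; first by exists (cmod (dot (toC 0) z)); exists 0.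
have [A A0 hA] := body_bounded hV.
exists (\sum_j A * cmod (z 0 j)) => _ [t Vt <-]; apply: dot_toC_norm => j.
exact: le_trans (norm_coord _ _) (hA t Vt).
Qed.

Lemma dnorm_ub V z t : convex_body V -> V 0 -> V t -> cmod (dot (toC t) z) <= dnorm V z.
Proof.
move=> hV V0 Vt; apply: ub_le_sup; first by have [] := dnorm_has_sup z hV V0.
by exists t.
Qed.

Lemma dnorm_le V z B : V 0 -> (forall t, V t -> cmod (dot (toC t) z) <= B) -> dnorm V z <= B.
Proof.
move=> V0 h; apply: ge_sup => [|_ [t Vt <-]]; last exact: h.
by exists (cmod (dot (toC 0) z)); exists 0.
Qed.

Lemma dnorm_ge0 V z : convex_body V -> V 0 -> 0 <= dnorm V z.
Proof. by move=> hV V0; apply: le_trans (dnorm_ub z hV V0 V0); exact: cmod_ge0. Qed.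

Lemma dnorm_lin V (z w : 'rV[R[i]]_m) (c : R[i]) : convex_body V -> V 0 ->
  dnorm V (z + c *: w) <= dnorm V z + cmod c * dnorm V w.
Proof.
move=> hV V0; apply: dnorm_le => // t Vt.
have -> : dot (toC t) (z + c *: w) = dot (toC t) z + c * dot (toC t) w.
  by rewrite /dot mulr_sumr -big_split; apply: eq_bigr => j _; rewrite !mxE /=; ring.
apply: le_trans (cmodD _ _) _; rewrite cmodM lerD //; first exact: dnorm_ub.
by rewrite ler_wpM2l ?cmod_ge0 //; exact: dnorm_ub.
Qed.

Lemma dnorm_real_ub V y t : convex_body V -> V 0 -> V t -> `|dot t y| <= dnorm V (toC y).
Proof. by move=> hV V0 Vt; rewrite -cmod_real -dot_toC; exact: dnorm_ub. Qed.

Lemma dnorm_real_le V y B : V 0 -> (forall t, V t -> `|dot t y| <= B) -> dnorm V (toC y) <= B.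
Proof. by move=> V0 h; apply: dnorm_le => // t Vt; rewrite dot_toC cmod_real; exact: h. Qed.

Lemma polar0 V : polar V 0.
Proof. by move=> t _; rewrite dot0r normr0. Qed.

Lemma bnorm_max K x : convex_body K -> origin_symmetric K ->
  exists y, [/\ polar K y, dot y x = bnorm K x & forall t, polar K t -> `|dot t x| <= dot y x].
Proof.
move=> hK sK.
have [y /set_mem py hy] := EVT_max_rV (ex_intro _ _ (@polar0 K)) (polar_compact hK sK)
  (continuous_subspaceT (@dot_continuous x)).
have h t : polar K t -> `|dot t x| <= dot y x.
  move=> pt; rewrite (dotC t) (dotC y) ler_norml hy ?mem_set // andbT lerNl -dotNr.
  by apply/hy/mem_set/polarN.
exists y; split => //; apply/eqP; rewrite eq_le; apply/andP; split.
  apply: le_trans (ler_norm _) _; apply: ub_le_sup; last by exists y.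
  by exists (dot y x) => _ [t pt <-]; exact: h.
apply: ge_sup => [|_ [t pt <-]]; last exact: h.
by exists `|dot 0 x|; exists 0 => //; exact: polar0.
Qed.

(** The two numbers are iterated maxima of the same pairing on [V] and the polar
of [K], taken in different orders. *)
Lemma maxnorm_pairing K V : convex_body K -> origin_symmetric K ->
  convex_body V -> origin_symmetric V ->
  exists a y, [/\ V a, polar K y, dot a y = maxnorm K V, dot a y = maxnorm_dual V K &
    forall t u, V t -> polar K u -> `|dot t u| <= dot a y].
Proof.
move=> hK sK hV sV; have V0 := body0 hV sV; have [cV _ _] := hV.
have ne : (V `*` polar K) !=set0 by exists (0, 0); split => //; exact: polar0.
have cc : continuous (fun p : 'rV[R]_m * 'rV[R]_m => dot p.1 p.2) := dot_continuous2.
have [[a y] /set_mem[/= Va py] hm] :=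
  compact_EVT_max ne (compact_setX cV (polar_compact hK sK)) (continuous_subspaceT cc).
have h t u : V t -> polar K u -> `|dot t u| <= dot a y.
  move=> Vt pu; rewrite ler_norml; apply/andP; split.
    rewrite lerNl -dotNr; apply: (hm (t, - u)); apply/mem_set; split => //; exact: polarN.
  by apply: (hm (t, u)); apply/mem_set.
have bK t : V t -> bnorm K t <= dot a y.
  by move=> Vt; have [u [pu <- _]] := bnorm_max t hK sK; rewrite dotC; apply: le_trans (ler_norm _) (h _ _ Vt pu).
have dV u : polar K u -> dnorm V (toC u) <= dot a y.
  by move=> pu; apply: dnorm_real_le => // t Vt; exact: h.
exists a, y; split => //; apply/eqP; rewrite eq_le; apply/andP; split.
- have [u [pu hu hu2]] := bnorm_max a hK sK.
  apply: le_trans (_ : bnorm K a <= _).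
    by rewrite -hu dotC; apply: le_trans (ler_norm _) (hu2 _ py).
  by apply: ub_le_sup; [exists (dot a y) => _ [t Vt <-]; exact: bK|exists a].
- by apply: ge_sup => [|_ [t Vt <-]]; [exists (bnorm K a); exists a|exact: bK].
- apply: le_trans (_ : dnorm V (toC y) <= _).
    by apply: le_trans (ler_norm _) _; exact: dnorm_real_ub.
  by apply: ub_le_sup; [exists (dot a y) => _ [t Vt <-]; exact: dV|exists y].
- by apply: ge_sup => [|_ [t Vt <-]]; [exists (dnorm V (toC y)); exists y|exact: dV].
Qed.

Lemma maxnorm_dualE K V : convex_body K -> origin_symmetric K ->
  convex_body V -> origin_symmetric V -> maxnorm_dual V K = maxnorm K V.
Proof. by move=> hK sK hV sV; have [a [y [_ _ <- <- _]]] := maxnorm_pairing hK sK hV sV. Qed.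

Lemma pairing_le_maxnorm K V t u : convex_body K -> origin_symmetric K ->
  convex_body V -> origin_symmetric V -> V t -> polar K u -> `|dot t u| <= maxnorm K V.
Proof. by move=> hK sK hV sV; have [a [y [_ _ <- _ h]]] := maxnorm_pairing hK sK hV sV; exact: h. Qed.

Lemma maxnorm_gt0 K V : (0 < m)%N -> convex_body K -> origin_symmetric K ->
  convex_body V -> origin_symmetric V -> 0 < maxnorm K V.
Proof.
move=> hm hK sK hV sV; have [r r0 hr] := body_ball hV sV; have [s s0 hs] := polar_ball hK.
pose j := Ordinal hm; pose e : 'rV[R]_m := 'e_j.
have e1 : `|e| <= 1.
  by apply: norm_rV_le => // i; rewrite mxE eqxx /=; case: (i == j); rewrite ?normr1 ?normr0.
have ee : dot e e = 1 by rewrite dot_delta mxE !eqxx.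
have Vt : V ((r / 2) *: e).
  apply: hr; rewrite normrZ (ger0_norm (_ : 0 <= r / 2)); last by rewrite divr_ge0 // ltW.
  have : r / 2 * `|e| <= r / 2 * 1 by rewrite ler_wpM2l // divr_ge0 // ltW.
  lra.
have pu : polar K (s *: e).
  by apply: hs; rewrite normrZ (gtr0_norm s0) -[leRHS]mulr1 ler_wpM2l // ltW.
have := pairing_le_maxnorm hK sK hV sV Vt pu; rewrite dotZl dotZr ee mulr1.
apply: lt_le_trans; rewrite gtr0_norm ?mulr_gt0 //; lra.
Qed.

Lemma not_interior_of_max (A : set 'rV[R]_m) x y M : 0 < M -> dot x y = M ->
  (forall t, A t -> dot t y <= M) -> ~ interior A x.
Proof.
move=> M0 e h /interiorP[r r0 hr].
pose d := r / (2 * (`|x| + 1)).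
have k0 : 0 < 2 * (`|x| + 1) by rewrite mulr_gt0 // ltr_wpDl.
have d0 : 0 < d by rewrite divr_gt0.
have hd : `|d *: x| < r.
  rewrite normrZ (gtr0_norm d0).
  have : d * (2 * (`|x| + 1)) = r by rewrite /d divfK // gt_eqF.
  have := normr_ge0 x; nra.
have := h _ (hr _ hd); rewrite dotDl dotZl e; nra.
Qed.

(** Extremality forces the two norms to be maximal, and a linear functional does
not attain its positive maximum over a set in the interior of the set. *)
Lemma extremal_pair K V a y : (0 < m)%N -> convex_body K -> origin_symmetric K ->
  convex_body V -> origin_symmetric V -> V a -> polar K y -> dot a y = maxnorm K V ->
  extremal_pts K V a /\ extremal_pts_dual V K y.
Proof.
move=> hm hK sK hV sV Va py e; have V0 := body0 hV sV.
have M0 := maxnorm_gt0 hm hK sK hV sV.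
have [u [pu hu hu2]] := bnorm_max a hK sK.
split; split.
- split; first exact: subset_closure.
  apply: (not_interior_of_max M0 e) => t Vt.
  exact: le_trans (ler_norm _) (pairing_le_maxnorm hK sK hV sV Vt py).
- apply/eqP; rewrite eq_le -hu; apply/andP; split.
    by rewrite dotC; apply: le_trans (ler_norm _) (pairing_le_maxnorm hK sK hV sV Va pu).
  by rewrite -e dotC; apply: le_trans (ler_norm _) (hu2 _ py).
- split; first exact: subset_closure.
  rewrite dotC in e; apply: (not_interior_of_max M0 e) => t pt; rewrite dotC.
  exact: le_trans (ler_norm _) (pairing_le_maxnorm hK sK hV sV Va pt).
- rewrite maxnorm_dualE //; apply/eqP; rewrite eq_le; apply/andP; split.
    by apply: dnorm_real_le => // t Vt; exact: pairing_le_maxnorm.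
  by rewrite -e; apply: le_trans (ler_norm _) _; exact: dnorm_real_ub.
Qed.

End ConvexBodies.

(** * Restriction to lines and directional derivatives *)

Section Lines.
Variables (R : realType) (m : nat).
Notation C := R[i].
Implicit Types (x v : 'rV[R]_m) (z w : 'rV[C]_m) (F : 'rV[C]_m -> C).

Lemma normC_cmod (c : C) : `|c| = (cmod c)%:C.
Proof. by rewrite normc_def; case: c. Qed.

Definition dirD F z w : C := 'D_w (F : 'rV[C]_m -> C^o) z.

Lemma entire_hasD0 F z w : entire F -> hasD (fun c => F (z + c *: w)) 0 (dirD F z w).
Proof.
move=> /(_ z) dF; apply/hasDP => e e0.
have [a a0 wE] : exists2 a : R, 0 <= a & `|w| = a%:C.
  have wr : 0 <= `|w| by [].
  have wE : `|w| = (Re `|w|)%:C by rewrite [LHS]complexE (ger0_Im wr) mulr0 addr0.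
  by exists (Re `|w|) => //; rewrite -ler0c -wE.
have k0 : 0 < a + 1 by lra.
have e1 : 0 < (e / (a + 1))%:C :> C by rewrite ltcR divr_gt0.
have /eqaddoP/(_ _ e1)/nbhs_ballP[d /= d0 hd] := diff_locally dF.
have dE : d = (Re d)%:C by rewrite [LHS]complexE (ger0_Im (ltW d0)) mulr0 addr0.
have dR : 0 < Re d by rewrite -ltcR -dE.
exists (Re d / (a + 1)) => [|c hc]; first by rewrite divr_gt0.
have cw : `|0 - c *: w| < d.
  rewrite sub0r normrN normrZ normC_cmod wE dE -rmorphM ltcR.
  move: hc; rewrite ltr_pdivlMr //; have := cmod_ge0 c; nra.
rewrite -ball_normE in hd; have := hd (c *: w) cw; rewrite /= !fctE /=.
rewrite [`|c *: w|]normrZ wE !normC_cmod -!rmorphM lecR.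
rewrite add0r scale0r addr0 [z + _]addrC.
rewrite linearZ /= -deriveE // -/(dirD F z w) -[c *: dirD F z w]/(c * dirD F z w) [c * dirD _ _ _]mulrC.
rewrite opprD addrA => h; apply: le_trans h _.
have -> : e / (a + 1) * (cmod c * a) = (e * a / (a + 1)) * cmod c by ring.
by apply: (ler_wpM2r (cmod_ge0 c)); rewrite ler_pdivrMr //; nra.
Qed.

Lemma entire_hasD F z w c : entire F ->
  hasD (fun c => F (z + c *: w)) c (dirD F (z + c *: w) w).
Proof.
move=> Fe; have h1 : hasD (fun b => b - c) c 1.
  by apply: hasD_eq (hasDB (hasD_id c) (hasD_cst c c)) _ _ => //; rewrite subr0.
have h2 := entire_hasD0 (z + c *: w) w Fe.
rewrite -(subrr c) in h2.
apply: hasD_eq (hasD_comp h1 h2) _ _ => [b|]; last by rewrite mulr1.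
by rewrite -addrA -scalerDl subrKC.
Qed.

Lemma entire_holo F z w : entire F -> holo (fun c => F (z + c *: w)).
Proof. by move=> Fe c; eexists; exact: entire_hasD. Qed.

Lemma toC_line x v (t : R) : toC x + t%:C *: toC v = toC (x + t *: v).
Proof. by apply/rowP => j; rewrite !mxE rmorphD rmorphM. Qed.

Lemma derive_line (f : 'rV[R]_m -> R) x v l :
  rderiv (fun t => f (x + t *: v)) 0 l -> 'D_v f x = l.
Proof.
move=> [_ <-]; rewrite /derive; set g1 := fun h => _; set g2 := fun h => _.
suff -> : g1 = g2 by [].
rewrite funeqE /g1 /g2 => h /=; rewrite addr0 scale0r addr0 [_%:A]mulr1.
by rewrite [x + _]addrC.
Qed.

Lemma Re_sum (I : Type) (r : seq I) (G : I -> C) :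
  Re (\sum_(i <- r) G i) = \sum_(i <- r) Re (G i).
Proof. by elim/big_rec2: _ => [//|i a b _ <-]; rewrite ReD. Qed.

Section RealEntire.
Variables (F0 : 'rV[C]_m -> C) (f0 : 'rV[R]_m -> R).
Hypothesis Fe : entire F0.
Hypothesis hreal : forall x, restr F0 x = (f0 x)%:C.

Lemma real_on_line x v (t : R) : F0 (toC x + t%:C *: toC v) = (f0 (x + t *: v))%:C.
Proof. by rewrite toC_line -hreal. Qed.

Lemma rderiv_line x v t : rderiv (fun t => f0 (x + t *: v)) t
  (Re (dirD F0 (toC (x + t *: v)) (toC v))).
Proof.
have h := @holo_rderiv _ _ t (entire_holo (toC x) (toC v) Fe).
apply: rderiv_eq h _ _ => [s|]; first by rewrite real_on_line.
by congr (Re _); rewrite (deriv_eq (entire_hasD _ _ _ Fe)) toC_line.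
Qed.

Lemma gradientE x j : gradient f0 x 0 j = Re (dirD F0 (toC x) (toC 'e_j)).
Proof.
rewrite mxE; apply: derive_line.
have h := rderiv_line x 'e_j 0; rewrite scale0r addr0 in h; exact: h.
Qed.

Lemma dirD_dot x v : Re (dirD F0 (toC x) (toC v)) = dot v (gradient f0 x).
Proof.
have e : toC v = \sum_j (v 0 j)%:C *: toC 'e_j.
  rewrite [LHS]row_sum_delta; apply: eq_bigr => j _; rewrite mxE; congr (_ *: _).
  by apply/rowP => i; rewrite !mxE; case: (_ && _).
rewrite e /dirD deriveE // linear_sum.
apply: etrans (Re_sum _ _) _; apply: eq_bigr => j _.
rewrite linearZ /= -deriveE // gradientE /dirD.
by rewrite -[_ *: _]/(_ * _) ReM /= mul0r subr0.
Qed.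

Lemma deriv_line_dot x v : Re (deriv (fun c => F0 (toC x + c *: toC v)) 0) = dot v (gradient f0 x).
Proof. by rewrite (deriv_eq (entire_hasD _ _ _ Fe)) scale0r addr0 dirD_dot. Qed.

End RealEntire.
End Lines.

(** * Extremal lines *)

Section ExtremalLine.
Variables (R : realType) (m : nat).
Notation C := R[i].
Implicit Types (x y v w : 'rV[R]_m) (F : 'rV[C]_m -> C) (V : set 'rV[R]_m).

Lemma line_exptype V F (z : 'rV[C]_m) (w : 'rV[C]_m) sigma : convex_body V -> V 0 ->
  exp_type V F -> dnorm V w <= sigma -> exptype sigma (fun c => F (z + c *: w)).
Proof.
move=> hV V0 [_ hF] ws e e0; have w0 := dnorm_ge0 w hV V0.
have s0 : 0 <= sigma by lra.
(* small enough for [d * sigma <= e] *)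
pose d := e / (sigma + 1); have s1 : 0 < sigma + 1 by lra.
have d0 : 0 < d by rewrite divr_gt0.
have dE : d * (sigma + 1) = e by rewrite /d divfK // gt_eqF.
have [K K0 hK] := hF d d0.
exists (K * expR ((1 + d) * dnorm V z)) => [|c]; first by rewrite mulr_ge0 ?expR_ge0 // ltW.
apply: le_trans (hK _) _; rewrite -mulrA -expRD ler_wpM2l ?(ltW K0) // ler_expR.
have c0 := cmod_ge0 c; have d1 : 0 <= 1 + d by lra.
apply: le_trans (ler_wpM2l d1 (dnorm_lin z w c hV V0)) _.
rewrite mulrDr lerD2l.
have -> : (1 + d) * (cmod c * dnorm V w) = ((1 + d) * dnorm V w) * cmod c by ring.
rewrite ler_wpM2r //.
apply: le_trans (ler_wpM2l d1 ws) _; lra.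
Qed.

Lemma two_lines_biholo V F (z w w' : 'rV[C]_m) : convex_body V -> V 0 -> exp_type V F ->
  biholo (fun c k => F (z + c *: w + k *: w')).
Proof.
move=> hV V0 [Fe hF]; split=> [k|c|r].
- apply: holo_eq (entire_holo (z + k *: w') w Fe) _ => c.
  by rewrite addrAC.
- exact: entire_holo.
have [K K0 hK] := hF 1 ltr01.
exists (K * expR ((1 + 1) * (dnorm V z + r * dnorm V w + r * dnorm V w'))).
  by rewrite mulr_ge0 ?expR_ge0 // ltW.
move=> c k hc hk; apply: le_trans (hK _) _; rewrite ler_wpM2l ?(ltW K0) // ler_expR.
rewrite ler_wpM2l //; apply: le_trans (dnorm_lin _ _ _ hV V0) _.
apply: lerD; last by rewrite ler_wpM2r ?dnorm_ge0.
apply: le_trans (dnorm_lin _ _ _ hV V0) _; rewrite lerD2l.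
by rewrite ler_wpM2r ?dnorm_ge0.
Qed.

Section BoundedReal.
Variables (V : set 'rV[R]_m) (F0 : 'rV[C]_m -> C) (f0 : 'rV[R]_m -> R) (N : R).
Hypothesis hV : convex_body V.
Hypothesis V0 : V 0.
Hypothesis hF : exp_type V F0.
Hypothesis hreal : forall x, restr F0 x = (f0 x)%:C.
Hypothesis N0 : 0 < N.
Hypothesis hN : forall x, `|f0 x| <= N.

Let Fe : entire F0. Proof. by case: hF. Qed.

Lemma line_class x v sigma : dnorm V (toC v) <= sigma ->
  bernstein_class sigma (fun c => N^-1%:C * F0 (toC x + c *: toC v)).
Proof.
move=> vs; split.
- by apply: holoZ; exact: entire_holo.
- by apply: exptypeZ; exact: (line_exptype _ hV V0 hF vs).
move=> t; exists (N^-1 * f0 (x + t *: v)); first by rewrite (real_on_line hreal) -rmorphM.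
by rewrite normrM (ger0_norm (_ : 0 <= N^-1)) ?invr_ge0 ?(ltW N0) // mulrC ler_pdivrMr // mul1r.
Qed.

Lemma deriv_line_class x v :
  Re (deriv (fun c => N^-1%:C * F0 (toC x + c *: toC v)) 0) = dot v (gradient f0 x) / N.
Proof.
rewrite (deriv_eq (hasDZ _ (derivP 0 (entire_holo (toC x) (toC v) Fe)))) ReM /=.
by rewrite (deriv_line_dot Fe hreal) mul0r subr0 mulrC.
Qed.

Lemma value_line_class x v : Re (N^-1%:C * F0 (toC x + 0 *: toC v)) = f0 x / N.
Proof. by rewrite (real_on_line hreal x v 0) scale0r addr0 ReM /= mul0r subr0 mulrC. Qed.

Lemma directional_bernstein_szego x v sigma : 0 <= sigma -> dnorm V (toC v) <= sigma ->
  dot v (gradient f0 x) ^+ 2 <= sigma ^+ 2 * (N ^+ 2 - f0 x ^+ 2).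
Proof.
move=> s0 vs; have := bernstein_szego 0 s0 (line_class x vs).
rewrite -[0%:C]/(0 : C) deriv_line_class value_line_class !expr_div_n.
have n2 : 0 < N ^+ 2 by rewrite exprn_gt0.
have Nn : N != 0 by rewrite gt_eqF.
rewrite ler_pdivrMr // => h; apply: le_trans h _.
by have -> : sigma ^+ 2 * (1 - f0 x ^+ 2 / N ^+ 2) * N ^+ 2 = sigma ^+ 2 * (N ^+ 2 - f0 x ^+ 2)
  by field.
Qed.

(** By [extremal_sinusoid], a point [(s, t)] of the unit circle describes [f0 / N]
on the line; its angle is the phase [c]. *)
Lemma extremal_direction x v M : 0 < M -> dnorm V (toC v) <= M ->
  dot v (gradient f0 x) ^+ 2 = M ^+ 2 * (N ^+ 2 - f0 x ^+ 2) -> dot v (gradient f0 x) != 0 ->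
  exists c : R, forall t, f0 (x + t *: v) = N * sin (M * t + c).
Proof.
move=> M0 vM e d0; have Nn : N != 0 by rewrite gt_eqF.
have Mn : M != 0 by rewrite gt_eqF.
have := extremal_sinusoid M0 (line_class x vM).
rewrite deriv_line_class value_line_class !expr_div_n e => /(_ _ _) h.
have {}h := h _ _.
have e1 : M ^+ 2 * (N ^+ 2 - f0 x ^+ 2) / N ^+ 2 = M ^+ 2 * (1 - f0 x ^+ 2 / N ^+ 2) by field.
have {}h := h e1 (mulf_neq0 d0 (invr_neq0 Nn)).
set s := f0 x / N in h; set t := dot v (gradient f0 x) / N / M in h.
have st : s ^+ 2 + t ^+ 2 = 1 by rewrite /s /t !expr_div_n e; field; rewrite ?Mn ?Nn.
have [c [cs ct]] : exists c, sin c = s /\ cos c = t.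
  have t1 : -1 <= t <= 1.
    rewrite -ler_norml -(ler_pXn2r (n:=2)) ?nnegrE // expr1n real_normK ?num_real //.
    by have := sqr_ge0 s; lra.
  have ct : cos (acos t) = t by apply: acosK; rewrite in_itv /=.
  have : sin (acos t) ^+ 2 = s ^+ 2 by have := cos2Dsin2 (acos t); rewrite ct; lra.
  move/eqP; rewrite eqf_sqr => /orP[|] /eqP es; first by exists (acos t).
  by exists (- acos t); rewrite sinN cosN es opprK.
exists c => u; have := h u.
rewrite (real_on_line hreal) ReM /= mul0r subr0 => hu.
have -> : f0 (x + u *: v) = N * (N^-1 * f0 (x + u *: v)) by rewrite mulVKf.
by rewrite hu sinD cs ct; ring.
Qed.

Lemma derivative_sinusoid_line x y M : (forall t, f0 (x + t *: y) = N * sin (M * t)) ->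
  forall t, dot y (gradient f0 (x + t *: y)) = N * M * cos (M * t).
Proof.
move=> hline t; rewrite -(dirD_dot Fe hreal).
have ds := rderivZ N (rderiv_sin_linear M t).
apply: (rderiv_unique (rderiv_line Fe hreal x y t)).
by apply: rderiv_eq ds _ _ => [s|]; [rewrite hline|ring].
Qed.

(** Along an extremal line the combination of [f0] and its derivative in the
direction [y] that attains [N] is maximal with respect to displacements across
the line; the resulting first order relation, differentiated twice, is the
oscillator equation for every component of the gradient. *)
Lemma gradient_extremal_line x y w M : 0 < M -> dnorm V (toC y) <= M ->
  (forall t, f0 (x + t *: y) = N * sin (M * t)) ->
  forall t, dot w (gradient f0 (x + t *: y)) = dot w (gradient f0 x) * cos (M * t).
Proof.
move=> M0 yM hline; have Mn : M != 0 by rewrite gt_eqF.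
pose Phi c k := F0 (toC x + c *: toC y + k *: toC w).
have bP : biholo Phi by exact: (two_lines_biholo _ _ _ hV V0 hF).
have [P1 P2 _] := bP.
have PhiE (t s : R) : Phi t%:C s%:C = (f0 (x + t *: y + s *: w))%:C.
  by rewrite /Phi toC_line (real_on_line hreal).
have D1E (t s : R) : Re (D1 Phi t%:C s%:C) = dot y (gradient f0 (x + t *: y + s *: w)).
  have -> : D1 Phi t%:C s%:C = deriv (fun c => F0 (toC (x + s *: w) + c *: toC y)) t%:C.
    rewrite /D1 /Phi; congr deriv; apply/funext => c.
    by rewrite -toC_line addrAC.
  rewrite (deriv_eq (entire_hasD _ _ _ Fe)) toC_line (dirD_dot Fe hreal).
  by rewrite addrAC.
pose h c := D2 Phi c 0.
have hh : holo h by exact: D2_holo.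
have hb : lbounded h.
  move=> r; have [B _ hB] := D1_bound (biholoC bP) (Num.max 0 r).
  exists B => z hz; apply: (hB 0 z); first by rewrite cmod0 le_max lexx.
  by rewrite le_max hz orbT.
have h1h := deriv_holo hh hb.
have h1b : lbounded (deriv h).
  move=> r; have [B hB] := hb (r + 1); exists (2 * B) => z hz.
  apply: cauchy_estimate => // u hu; apply: hB.
  by have := cmodD (u - z) z; rewrite subrK; lra.
have h2h := deriv_holo h1h h1b.
have hE (t : R) : Re (h t%:C) = dot w (gradient f0 (x + t *: y)).
  by rewrite /h /D2 /Phi toC_line (deriv_line_dot Fe hreal).
pose u (t : R) := Re (h t%:C); pose u1 (t : R) := Re (deriv h t%:C).
pose u2 (t : R) := Re (deriv (deriv h) t%:C).
have du t : rderiv u t (u1 t) by exact: holo_rderiv.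
have du1 t : rderiv u1 t (u2 t) by exact: holo_rderiv.
have du2 t : rderiv u2 t (Re (deriv (deriv (deriv h)) t%:C)) by exact: holo_rderiv.
have dydot := derivative_sinusoid_line hline.
have first t : M * sin (M * t) * u t + cos (M * t) * u1 t = 0.
  have dh : holo (D1 Phi t%:C) by exact: (D2_holo t%:C (biholoC bP)).
  pose E (s : R) := sin (M * t) * Re (Phi t%:C s%:C) + cos (M * t) / M * Re (D1 Phi t%:C s%:C).
  have dE (s : R) : rderiv E s (sin (M * t) * Re (deriv (Phi t%:C) s%:C) +
      cos (M * t) / M * Re (deriv (D1 Phi t%:C) s%:C)).
    by apply: rderivD; apply: rderivZ; exact: holo_rderiv.
  have Emax s : E s <= E 0.
    have -> : E 0 = N.
      rewrite /E PhiE D1E scale0r addr0 /= hline dydot.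
      have -> : sin (M * t) * (N * sin (M * t)) + cos (M * t) / M * (N * M * cos (M * t)) =
        N * (cos (M * t) ^+ 2 + sin (M * t) ^+ 2) by field.
      by rewrite cos2Dsin2 mulr1.
    rewrite /E PhiE D1E /=.
    have := directional_bernstein_szego (x + t *: y + s *: w) (ltW M0) yM.
    set d := dot y _; set a := f0 _ => hd.
    have h1 : a ^+ 2 + (d / M) ^+ 2 <= N ^+ 2.
      have : (d / M) ^+ 2 <= N ^+ 2 - a ^+ 2.
        by rewrite expr_div_n ler_pdivrMr ?exprn_gt0 // mulrC.
      lra.
    have cs := cos2Dsin2 (M * t); set p := sin _ in cs *; set q := cos _ in cs *.
    apply: le_trans (ler_norm _) _.
    rewrite -(ler_pXn2r (n:=2)) ?nnegrE ?(ltW N0) // real_normK ?num_real //.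
    have h2 := sqr_ge0 (p * (d / M) - q * a).
    have -> : (p * a + q / M * d) ^+ 2 =
      (q ^+ 2 + p ^+ 2) * (a ^+ 2 + (d / M) ^+ 2) - (p * (d / M) - q * a) ^+ 2 by field.
    by rewrite cs mul1r; lra.
  have := rderiv_at_max (dE 0) (fun s => ex_intro _ _ (dE s)) Emax.
  have -> : Re (deriv (D1 Phi t%:C) 0%:C) = u1 t.
    by rewrite /u1 (deriv_eq (mixed_derivatives t%:C 0 bP)).
  rewrite -/(D2 Phi t%:C 0) -/(h t%:C) -/(u t) => e.
  have -> : M * sin (M * t) * u t + cos (M * t) * u1 t =
    M * (sin (M * t) * u t + cos (M * t) / M * u1 t) by field.
  by rewrite e mulr0.
have dc := @rderiv_cos_linear R M; have ds := @rderiv_sin_linear R M.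
have zero (g dg : R -> R) : (forall t, rderiv g t (dg t)) -> (forall t, g t = 0) -> forall t, dg t = 0.
  move=> hg g0 t; apply: (rderiv_unique (hg t)).
  by apply: rderiv_eq (is_derive_cst (0 : R) t 1) _ _ => // s; rewrite g0.
have second t : cos (M * t) * (M ^+ 2 * u t + u2 t) = 0.
  have := zero _ _ (fun t => rderivD (rderivM (rderivZ M (ds t)) (du t)) (rderivM (dc t) (du1 t))) first t.
  by move=> <-; ring.
(* Differentiating once more covers the zeros of the cosine. *)
have osc t : M ^+ 2 * u t + u2 t = 0.
  have := zero _ _ (fun t => rderivM (dc t) (rderivD (rderivZ (M ^+ 2) (du t)) (du2 t))) second t.
  have [c0|c0] := eqVneq (cos (M * t)) 0; last first.
    by move=> _; apply: (mulfI c0); rewrite mulr0 second.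
  rewrite c0 mul0r addr0 => /eqP; rewrite mulf_eq0 => /orP[|/eqP //].
  rewrite mulf_eq0 oppr_eq0 (negbTE Mn) orbF => /eqP s0.
  by have := cos2Dsin2 (M * t); rewrite c0 s0 expr0n /= addr0 => /esym/eqP; rewrite oner_eq0.
have u10 : u1 0 = 0 by have := first 0; rewrite mulr0 sin0 cos0 mulr0 mul0r add0r mul1r.
move=> t; rewrite -hE -/(u t).
rewrite (@harmonic_oscillator _ M u (fun t => u1 t / M)) => [|s|s].
- by rewrite u10 mul0r mul0r addr0 /u hE scale0r addr0.
- by rewrite mulrCA divff // mulr1.
have -> : - (M * u s) = u2 s / M.
  have -> : u2 s = - (M ^+ 2 * u s) by apply/eqP; rewrite -addr_eq0 addrC osc.
  by field.
by apply: rderiv_eq (rderivZ M^-1 (du1 s)) _ _ => [v|]; rewrite mulrC.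
Qed.

End BoundedReal.

Lemma gradient_trig (R1 R2 : R) a x :
  gradient (trig R1 R2 a) x = (R2 * cos (dot a x) - R1 * sin (dot a x)) *: a.
Proof.
apply/rowP => j; rewrite !mxE; apply: derive_line.
have dl : rderiv (fun t => dot a x + dot a 'e_j * t) 0 (dot a 'e_j).
  apply: rderiv_eq (rderivD (is_derive_cst (dot a x) (0 : R) (1 : R)) (rderiv_linear (dot a 'e_j) 0)) _ _ => //.
  by rewrite add0r.
have dc := is_derive1_comp (is_derive_cos _) dl.
have ds := is_derive1_comp (is_derive_sin _) dl.
have ae : dot a 'e_j = a 0 j by rewrite dotC dot_delta.
apply: rderiv_eq (rderivD (rderivZ R1 dc) (rderivZ R2 ds)) _ _ => [t|].
  by rewrite /trig dotDr dotZr /= [dot a 'e_j * t]mulrC.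
by rewrite mulr0 addr0 ae; ring.
Qed.

End ExtremalLine.

(** * The theorem *)

Unset Implicit Arguments.

Theorem theorem3p1 (R : realType) (m : nat) (hm : (0 < m)%N)
    (K V : set 'rV[R]_m)
    (hK : convex_body K) (sK : origin_symmetric K)
    (hV : convex_body V) (sV : origin_symmetric V)
    (F0 : 'rV[R[i]]_m -> R[i]) (f0 : 'rV[R]_m -> R)
    (hB : exp_type V F0) (hC : bounded_continuous (restr F0))
    (hreal : forall x : 'rV[R]_m, restr F0 x = (f0 x)%:C)
    (hext : extremal_I K V f0 (restr F0) \/ extremal_II K V f0 (restr F0)) :
  exists (a : 'rV[R]_m) (R1 R2 : R) (x0 y0 : 'rV[R]_m),
    [/\ extremal_pts K V a,
        extremal_pts_dual V K y0,
        forall tau : R,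
          f0 (x0 + tau *: y0) = trig R1 R2 a (x0 + tau *: y0) /\
          gradient f0 (x0 + tau *: y0)
            = gradient (trig R1 R2 a) (x0 + tau *: y0)
      & f0 x0 = 0].
Proof.
have V0 := body0 hV sV; have M0 := maxnorm_gt0 hm hK sK hV sV.
have [Fe _] := hB.
set M := maxnorm K V in M0; pose N := Cnorm (restr F0).
have hN x : `|f0 x| <= N.
  have [_ [B hB']] := hC; rewrite -cmod_real -hreal; apply: ub_le_sup; last by exists x.
  by exists B => _ [y _ <-]; exact: hB'.
have N0 : 0 <= N by apply: le_trans (hN 0).
(* If [f0] vanishes identically, any pair attaining the maximum of the pairing
   will do. *)
have [N00|Npos] := leP N 0.
  have f00 : f0 = trig 0 0 0.
    apply/funext => x; rewrite /trig !mul0r addr0; apply/eqP; rewrite -normr_le0.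
    exact: le_trans (hN x) N00.
  have [a [y [Va py e _ _]]] := maxnorm_pairing hK sK hV sV.
  have [ha hy] := extremal_pair hm hK sK hV sV Va py e.
  exists a, 0, 0, 0, y; split => // [t|]; last by rewrite f00 /trig !mul0r addr0.
  by rewrite f00 !gradient_trig /trig !mul0r subrr !scale0r.
have dM y : polar K y -> dnorm V (toC y) <= M.
  by move=> py; apply: dnorm_real_le => // t Vt; exact: pairing_le_maxnorm.
(* Both kinds of extremality give a direction of equality in the one-variable
   Bernstein-Szegő inequality, at a point that is not critical. *)
have [x1 [y [py e d0]]] : exists x y, [/\ polar K y,
    dot y (gradient f0 x) ^+ 2 = M ^+ 2 * (N ^+ 2 - f0 x ^+ 2) & dot y (gradient f0 x) != 0].
  case: hext => [[x hx]|[x [hx g0]]].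
    have [y [py yE _]] := bnorm_max (gradient f0 x) hK sK.
    have MN : dot y (gradient f0 x) = M * N by rewrite yE.
    have := directional_bernstein_szego hV V0 hB hreal Npos hN x (ltW M0) (dM _ py).
    rewrite MN exprMn => h.
    have M2 : 0 < M ^+ 2 by rewrite exprn_gt0.
    have f2 : f0 x ^+ 2 = 0.
      apply/eqP; rewrite eq_le sqr_ge0 andbT; move: h; rewrite ler_pM2l //; lra.
    by exists x, y; rewrite MN exprMn f2 subr0 mulf_neq0 // gt_eqF.
  have [y [py yE ymax]] := bnorm_max (gradient f0 x) hK sK.
  exists x, y; split => //.
    by rewrite yE; move: hx; rewrite -/M -/N; lra.
  have [r r0 hr] := polar_ball hK.
  pose k := r / (`|gradient f0 x| + 1).
  have g1 : 0 < `|gradient f0 x| + 1 by rewrite ltr_wpDl.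
  have k0 : 0 < k by rewrite divr_gt0.
  have pk : polar K (k *: gradient f0 x).
    apply: hr; rewrite normrZ (gtr0_norm k0) /k mulrAC ler_pdivrMr //.
    by rewrite ler_wpM2l ?(ltW r0) // lerDl.
  rewrite gt_eqF //; apply: lt_le_trans (ymax _ pk).
  by rewrite dotZl normr_gt0 mulf_neq0 ?gt_eqF // dot_sqr_gt0.
have [c hc] := extremal_direction hV V0 hB hreal Npos hN M0 (dM _ py) e d0.
have Mn : M != 0 by rewrite gt_eqF.
have Nn : N != 0 by rewrite gt_eqF.
have [x0 line] : exists x0, forall t, f0 (x0 + t *: y) = N * sin (M * t).
  exists (x1 + (- (c / M)) *: y) => t.
  rewrite -addrA -scalerDl hc; congr (_ * sin _).
  by field.
have grad w := gradient_extremal_line hV V0 hB hreal Npos hN w M0 (dM _ py) line.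
pose a := N^-1 *: gradient f0 x0.
have ay : dot a y = M.
  rewrite /a dotZl dotC; have := derivative_sinusoid_line hB hreal line 0.
  by rewrite scale0r addr0 mulr0 cos0 mulr1 => ->; rewrite mulKf.
have Va : V a.
  apply: (bipolar hV sV) => v pv.
  have v1 : dnorm V (toC v) <= 1 by apply: dnorm_real_le.
  have := directional_bernstein_szego hV V0 hB hreal Npos hN x0 ler01 v1.
  rewrite expr1n mul1r => h.
  rewrite /a dotZl normrM normfV (gtr0_norm Npos) mulrC ler_pdivrMr // mul1r dotC.
  rewrite -(ler_pXn2r (n:=2)) ?nnegrE ?(ltW Npos) // real_normK ?num_real //.
  by have := sqr_ge0 (f0 x0); lra.
have [ha hy] := extremal_pair hm hK sK hV sV Va py ay.
have trigE t : dot a (x0 + t *: y) = dot a x0 + M * t by rewrite dotDr dotZr ay mulrC.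
exists a, (- (N * sin (dot a x0))), (N * cos (dot a x0)), x0, y; split => // [t|].
  have back : M * t = dot a x0 + M * t - dot a x0 by ring.
  split.
    by rewrite line {1}back sinB /trig trigE; ring.
  rewrite gradient_trig trigE.
  have -> : N * cos (dot a x0) * cos (dot a x0 + M * t) - - (N * sin (dot a x0)) * sin (dot a x0 + M * t)
    = N * cos (M * t).
    by rewrite [in RHS]back cosB; ring.
  apply/rowP => j.
  rewrite -dot_delta grad dot_delta /a scalerA [RHS]mxE mulrC; congr (_ * _).
  by field.
by have := line 0; rewrite scale0r addr0 mulr0 sin0 mulr0.
Qed.
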